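(* Let the coefficients $\bar A_0,\bar C_0,\bar A_1,\bar C_1$ satisfy hypothesis (L2) (stated in the context) and let $\psi(\cdot)\in L^2_{\mathcal F_T}(0,T;\mathbb R^n)$. Let $(Y(\cdot),Z(\cdot,\cdot))\in\mathcal M^2[0,T]$ be the unique adapted M-solution of the linear mean-field backward stochastic Volterra integral equation $$Y(t)=\psi(t)+\int_t^T\Big(\bar A_0(t,s)Y(s)+\bar C_0(t,s)Z(s,t)+\mathbb E'[\bar A_1(t,s)Y(s)+\bar C_1(t,s)Z(s,t)]\Big)ds-\int_t^TZ(t,s)dW(s),\quad t\in[0,T].$$ Further, let $\varphi(\cdot)\in L^2_{\mathbb F}(0,T;\mathbb R^n)$ and let $X(\cdot)\in L^2_{\mathbb F}(0,T;\mathbb R^n)$ be the solution of the linear mean-field forward stochastic Volterra integral equation $$X(t)=\varphi(t)+\int_0^t\Big(\bar A_0(s,t)^TX(s)+\mathbb E^*[\bar A_1(s,t)^TX(s)]\Big)ds+\int_0^t\Big(\mathbb E[\bar C_0(s,t)^T|\mathcal F_s]X(s)+\mathbb E^*\big[\mathbb E[\bar C_1(s,t)^T|\mathcal F_s]X(s)\big]\Big)dW(s),\quad t\in[0,T].$$ Then $$\mathbb E\int_0^T\langle Y(t),\varphi(t)\rangle dt=\mathbb E\int_0^T\langle X(t),\psi(t)\rangle dt.$$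
   Context: Let $T>0$ and let $(\Omega,\mathcal F,\mathbb F,\mathbb P)$ be a complete filtered probability space on which a one-dimensional standard Brownian motion $W$ is defined, $\mathbb F=\{\mathcal F_t\}_{t\ge0}$ being its natural filtration augmented by all $\mathbb P$-null sets. $(\Omega^2,\mathcal F^2,\mathbb P^2)$ is the completion of the product of $(\Omega,\mathcal F,\mathbb P)$ with itself, and $\mathbb F^2=\{\mathcal F_t\otimes\mathcal F_t\}_{t\in[0,T]}$ (completed). Put $\Delta=\{(t,s)\in[0,T]^2: t\le s\}$. $L^2_{\mathcal F_T}(0,T;\mathbb R^n)$: $\mathcal F_T$-measurable (not necessarily adapted) processes with $\mathbb E\int_0^T|X(s)|^2ds<\infty$; $L^2_{\mathbb F}(0,T;\mathbb R^n)$: its $\mathbb F$-adapted elements. $\mathcal M^2[0,T]$: pairs $(y,z)$ with $y\in L^2_{\mathbb F}(0,T;\mathbb R^n)$, $z:[0,T]^2\times\Omega\to\mathbb R^n$ with $z(t,\cdot)$ $\mathbb F$-adapted for a.e. $t$, $\mathbb E\int_0^T\int_0^T|z(t,s)|^2dsdt<\infty$, and $y(t)=\mathbb E[y(t)|\mathcal F_S]+\int_S^tz(t,s)dW(s)$ for $t\in[S,T]$, $S\in[0,T)$. An adapted M-solution is a pair $(Y,Z)$ in these spaces satisfying the equation in the Itô sense and $Y(t)=\mathbb EY(t)+\int_0^tZ(t,s)dW(s)$, $t\in[0,T]$. Notation: $\mathbb E'$ integrates out the second $\Omega$-variable, $\mathbb E'[\bar A_1(t,s)Y(s)](\omega)=\int_\Omega\bar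 A_1(t,s,\omega,\omega')Y(s,\omega')\mathbb P(d\omega')$, and similarly for $\bar C_1(t,s)Z(s,t)$. $\mathbb E^*$ integrates out the first one: $\mathbb E^*[\bar A_1(s,t)^TX(s)](\omega)=\int_\Omega\bar A_1(s,t,\omega^*,\omega)^TX(s,\omega^* )\mathbb P(d\omega^* )$. The term $\mathbb E^*[\mathbb E[\bar C_1(s,t)^T|\mathcal F_s]X(s)](\omega)$ means $\int_\Omega D(s,t,\omega^*,\omega)^TX(s,\omega^* )\mathbb P(d\omega^* )$, where $D(s,t,\cdot,\cdot)$ is the conditional expectation of $\bar C_1(s,t,\cdot,\cdot)$ on $(\Omega^2,\mathcal F^2,\mathbb P^2)$ given $\mathcal F_s\otimes\mathcal F_s$; equivalently, it is $\mathbb E\big[\mathbb E^*[\bar C_1(s,t)^TX(s)]\,\big|\,\mathcal F_s\big](\omega)$. A superscript $T$ on a matrix denotes transpose. Hypothesis (L2): $\bar A_0,\bar C_0:\Delta\times\Omega\to\mathbb R^{n\times n}$ and $\bar A_1,\bar C_1:\Delta\times\Omega^2\to\mathbb R^{n\times n}$ are measurable and uniformly bounded; for any $t\in[0,T]$, $s\mapsto(\bar A_0(t,s),\bar C_0(t,s))$ is $\mathbb F$-progressively measurable on $[t,T]$ and $s\mapsto(\bar A_1(t,s),\bar C_1(t,s))$ is $\mathbb F^2$-progressively measurable on $[t,T]$. (Under (L2) both equations are uniquely solvable in the stated spaces.) *)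

(* Defs.v *)
From HB Require Import structures.
From mathcomp Require Import all_boot all_order all_algebra.
From mathcomp Require Import all_classical all_reals all_analysis.

Set Implicit Arguments.
Unset Strict Implicit.
Unset Printing Implicit Defensive.

Import Order.TTheory GRing.Theory Num.Theory.
Import numFieldNormedType.Exports.

Local Open Scope classical_set_scope.
Local Open Scope ring_scope.

(* Time is the whole of R: processes are total functions of t : R of which only
   the values for t in [0, T] matter. Sub-sigma-algebras are G : set (set Omega)
   and measurability with respect to G is measurability on the library type
   g_sigma_algebraType G (whose sigma-algebra is <<s G >> = G). *)

Section measurability.
Context {R : realType}.

Definition mx_measurable {d} {T : measurableType d} {m n : nat}
    (D : set T) (f : T -> 'M[R]_(m, n)) : Prop :=
  forall i j, measurable_fun D (fun x => f x i j).

Definition augmented {d} {T : measurableType d}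
    (mu : {measure set T -> \bar R}) (G : set (set T)) : set (set T) :=
  <<s G `|` mu.-negligible >>.

Definition adapted {T : pointedType} {m n : nat} (F : R -> set (set T))
    (a b : R) (X : R -> T -> 'M[R]_(m, n)) : Prop :=
  forall t : R, a <= t <= b ->
    mx_measurable setT (X t : g_sigma_algebraType (F t) -> 'M[R]_(m, n)).

Definition progressive {T : pointedType} {m n : nat} (F : R -> set (set T))
    (a b : R) (X : R -> T -> 'M[R]_(m, n)) : Prop :=
  forall u : R, a <= u <= b ->
    mx_measurable (`[a, u] `*` setT)
      (fun p : measurableTypeR R * g_sigma_algebraType (F u) => X p.1 p.2).

(* g is a version of the conditional expectation of f given the sub-sigma-algebra
   G, entry by entry. *)
Definition is_cond_exp {d} {T : measurableType d} {m n : nat}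
    (mu : {measure set T -> \bar R}) (G : set (set T))
    (f g : T -> 'M[R]_(m, n)) : Prop :=
  mx_measurable setT (g : g_sigma_algebraType G -> 'M[R]_(m, n)) /\
  forall i j,
    [/\ mu.-integrable setT (fun x => (f x i j)%:E),
        mu.-integrable setT (fun x => (g x i j)%:E) &
        forall A, G A ->
          (\int[mu]_(x in A) (g x i j)%:E = \int[mu]_(x in A) (f x i j)%:E)%E].

Definition dotv {n : nat} (x y : 'cV[R]_n) : R := \sum_i x i ord0 * y i ord0.

Definition vint {d} {T : measurableType d} {n : nat}
    (mu : {measure set T -> \bar R}) (D : set T) (f : T -> 'cV[R]_n) : 'cV[R]_n :=
  \col_i \int[mu]_(x in D) f x i ord0.

End measurability.

Section product_space.
Context {R : realType} {d : measure_display} {Omega : measurableType d}.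
Variable P : probability Omega R.

(* (Omega^2, F^2, P^2) is the completion of the product space, in the form of the
   library's completed extension, which lives on the Caratheodory
   sigma-algebra of the outer measure (P \x P)^* (the completed Lebesgue
   measure is obtained in the same way). The carrier of Omega2 is convertible to
   Omega * Omega. *)
Definition PxP : {measure set (Omega * Omega) -> \bar R} := (P \x P)%E.

Definition Omega2 : measurableType _ := caratheodory_type (PxP^*)%mu.

Definition P2 : {measure set Omega2 -> \bar R} :=
  @completed_measure_extension _ _ _ PxP.

Definition filtration2 (F : R -> set (set Omega)) (t : R) : set (set Omega2) :=
  augmented P2 [set A `*` B | A in F t & B in F t].

End product_space.
Arguments filtration2 {R d Omega} P F t.

Section brownian.
Context {R : realType} {d : measure_display} {Omega : measurableType d}.
Variables (P : probability Omega R) (W : R -> Omega -> R).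

Definition brownian_filtration (t : R) : set (set Omega) :=
  augmented P (\bigcup_(s in `[0, t])
    preimage_set_system setT (W s : Omega -> measurableTypeR R) measurable).

Definition increment (s t : R) (w : Omega) : measurableTypeR R := W t w - W s w.

(* Standard Brownian motion relative to its augmented natural filtration. *)
Record brownian_motion : Prop := BrownianMotion {
  bm_measurable : forall t : R, 0 <= t ->
    measurable_fun setT (W t : Omega -> measurableTypeR R) ;
  bm_start : {ae P, forall w, W 0 w = 0} ;
  bm_continuous :
    {ae P, forall w, {within `[0, +oo[, continuous (fun t => W t w)}} ;
  bm_gaussian : forall s t : R, 0 <= s -> s < t ->
    forall B : set (measurableTypeR R), measurable B ->
    P (increment s t @^-1` B) = normal_prob 0 (Num.sqrt (t - s)) B ;
  bm_indep : forall s t : R, 0 <= s -> s < t ->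
    forall (A : set Omega) (B : set (measurableTypeR R)),
    brownian_filtration s A -> measurable B ->
    (P (A `&` increment s t @^-1` B) =
     P A * P (increment s t @^-1` B))%E }.

End brownian.

Section ito.
Context {R : realType} {d : measure_display} {Omega : measurableType d}.
Variables (P : probability Omega R) (F : R -> set (set Omega)).
Variable W : R -> Omega -> R.
Notation mu := (@lebesgue_measure R).

Definition L2 {n : nat} (G : set (set Omega)) (a b : R)
    (X : R -> Omega -> 'cV[R]_n) : Prop :=
  mx_measurable (`[a, b] `*` setT)
    (fun p : measurableTypeR R * g_sigma_algebraType G => X p.1 p.2) /\
  (\int[P]_w \int[mu]_(t in `[a, b]) (dotv (X t w) (X t w))%:E < +oo)%E.

Record simple_process (n : nat) (a b : R) := SimpleProcess {
  sp_size : nat ;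
  sp_time : nat -> R ;
  sp_val : nat -> Omega -> 'cV[R]_n ;
  sp_time0 : sp_time 0 = a ;
  sp_timeN : sp_time sp_size = b ;
  sp_time_le : forall k, (k < sp_size)%N -> sp_time k <= sp_time k.+1 ;
  sp_val_measurable : forall k, (k < sp_size)%N ->
    mx_measurable setT (sp_val k : g_sigma_algebraType (F (sp_time k)) -> _) ;
  sp_val_bounded : exists K : R, forall k w i, (k < sp_size)%N ->
    `|sp_val k w i ord0| <= K }.

Definition sp_process n a b (H : simple_process n a b) (t : R) (w : Omega)
    : 'cV[R]_n :=
  \sum_(k < sp_size H) \1_(`]sp_time H k, sp_time H k.+1]) t *: sp_val H k w.

Definition sp_integral n a b (H : simple_process n a b) (w : Omega)
    : 'cV[R]_n :=
  \sum_(k < sp_size H)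
    (W (sp_time H k.+1) w - W (sp_time H k) w) *: sp_val H k w.

(* I is (a version of) the Ito integral of z over [a, b]: the limit in
   L^2(Omega) of the integrals of simple processes converging to z in
   L^2([a, b] x Omega). *)
Definition is_ito_integral (n : nat) (a b : R) (z : R -> Omega -> 'cV[R]_n)
    (I : Omega -> 'cV[R]_n) : Prop :=
  [/\ L2 measurable a b z, adapted F a b z, mx_measurable setT I &
  exists H : nat -> simple_process n a b,
    (fun k => \int[P]_w \int[mu]_(t in `[a, b])
       (dotv (z t w - sp_process (H k) t w)
             (z t w - sp_process (H k) t w))%:E)%E @ \oo --> 0%E /\
    (fun k => \int[P]_w
       (dotv (I w - sp_integral (H k) w)
             (I w - sp_integral (H k) w))%:E)%E @ \oo --> 0%E].

End ito.

Section equations.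
Context {R : realType} {d : measure_display} {Omega : measurableType d}.
Variables (P : probability Omega R) (W : R -> Omega -> R) (T : R) (n : nat).
Notation mu := (@lebesgue_measure R).
Notation F := (brownian_filtration P W).

Definition Delta : set (measurableTypeR R * measurableTypeR R) :=
  [set p | [/\ 0 <= p.1, p.1 <= p.2 & p.2 <= T]].

Definition L2_FT (X : R -> Omega -> 'cV[R]_n) : Prop := L2 P (F T) 0 T X.

Definition L2_F (X : R -> Omega -> 'cV[R]_n) : Prop :=
  L2_FT X /\ adapted F 0 T X.

Record L2_coef_Omega (A : R -> R -> Omega -> 'M[R]_n) : Prop := L2CoefOmega {
  coef_Omega_measurable : mx_measurable (Delta `*` setT)
    (fun p : (measurableTypeR R * measurableTypeR R) * Omega =>
       A p.1.1 p.1.2 p.2) ;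
  coef_Omega_bounded : exists K : R, forall (t s : R) w i j, Delta (t, s) ->
    `|A t s w i j| <= K ;
  coef_Omega_progressive : forall t : R, 0 <= t <= T -> progressive F t T (A t) }.

Record L2_coef_Omega2 (A : R -> R -> Omega * Omega -> 'M[R]_n) : Prop := L2CoefOmega2 {
  coef_Omega2_measurable : mx_measurable (Delta `*` setT)
    (fun p : (measurableTypeR R * measurableTypeR R) * Omega2 P =>
       A p.1.1 p.1.2 p.2) ;
  coef_Omega2_bounded : exists K : R, forall (t s : R) w i j, Delta (t, s) ->
    `|A t s w i j| <= K ;
  coef_Omega2_progressive : forall t : R, 0 <= t <= T ->
    progressive (filtration2 P F) t T
      (A t : R -> Omega2 P -> 'M[R]_n) }.

Definition hypothesis_L2 (A0 C0 : R -> R -> Omega -> 'M[R]_n)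
    (A1 C1 : R -> R -> Omega * Omega -> 'M[R]_n) : Prop :=
  [/\ L2_coef_Omega A0, L2_coef_Omega C0, L2_coef_Omega2 A1 & L2_coef_Omega2 C1].

(* Elements of these L^2 spaces are classes modulo dt x dP, so identities between
   them at time t hold for almost every t. *)
Record M2 (y : R -> Omega -> 'cV[R]_n) (z : R -> R -> Omega -> 'cV[R]_n)
    : Prop := MkM2 {
  M2_y : L2_F y ;
  M2_z_measurable : mx_measurable ((`[0, T] `*` `[0, T]) `*` setT)
    (fun p : (measurableTypeR R * measurableTypeR R) * g_sigma_algebraType (F T)
       => z p.1.1 p.1.2 p.2) ;
  M2_z_adapted : {ae mu, forall t : R, 0 <= t <= T -> adapted F 0 T (z t)} ;
  M2_z_L2 : (\int[P]_w \int[mu]_(t in `[0%R, T]) \int[mu]_(s in `[0%R, T])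
    (dotv (z t s w) (z t s w))%:E < +oo)%E ;
  M2_mart : forall S : R, 0 <= S -> S < T ->
    {ae mu, forall t : R, S <= t <= T ->
      exists E I : Omega -> 'cV[R]_n,
        [/\ is_cond_exp P (F S) (y t) E,
            is_ito_integral P F W S t (z t) I &
            {ae P, forall w, y t w = E w + I w}]} }.

Section coefficients.
Variables (A0 C0 : R -> R -> Omega -> 'M[R]_n).
Variables (A1 C1 : R -> R -> Omega * Omega -> 'M[R]_n).

Record adapted_M_solution (psi : R -> Omega -> 'cV[R]_n)
    (Y : R -> Omega -> 'cV[R]_n) (Z : R -> R -> Omega -> 'cV[R]_n)
    : Prop := AdaptedMSolution {
  bsvie_M2 : M2 Y Z ;
  bsvie_eq : {ae mu, forall t : R, 0 <= t <= T ->
    exists2 I : Omega -> 'cV[R]_n,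
      is_ito_integral P F W t T (Z t) I &
      {ae P, forall w, Y t w = psi t w
        + vint mu `[t, T] (fun s =>
            A0 t s w *m Y s w + C0 t s w *m Z s t w
            + vint P setT (fun w' =>
                A1 t s (w, w') *m Y s w' + C1 t s (w, w') *m Z s t w'))
        - I w}} ;
  bsvie_mart : {ae mu, forall t : R, 0 <= t <= T ->
    exists2 I : Omega -> 'cV[R]_n,
      is_ito_integral P F W 0 t (Z t) I &
      {ae P, forall w, Y t w = vint P setT (Y t) + I w}} }.

(* D0 s t and D1 s t are versions, jointly measurable in (s, t) and the random
   variables, of E[C0(s,t)^T | F_s] and of the conditional expectation of
   C1(s,t)^T given the completion of F_s (x) F_s. *)
Record cond_exp_coef (D0 : R -> R -> Omega -> 'M[R]_n)
    (D1 : R -> R -> Omega * Omega -> 'M[R]_n) : Prop := CondExpCoef {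
  D0_measurable : mx_measurable (Delta `*` setT)
    (fun p : (measurableTypeR R * measurableTypeR R) * Omega =>
       D0 p.1.1 p.1.2 p.2) ;
  D1_measurable : mx_measurable (Delta `*` setT)
    (fun p : (measurableTypeR R * measurableTypeR R) * Omega2 P =>
       D1 p.1.1 p.1.2 p.2) ;
  D0_cond_exp : forall s t : R, Delta (s, t) ->
    is_cond_exp P (F s) (fun w => (C0 s t w)^T) (D0 s t) ;
  D1_cond_exp : forall s t : R, Delta (s, t) ->
    is_cond_exp (P2 P) (filtration2 P F s)
      (fun w => (C1 s t w)^T) (D1 s t) }.

Record fsvie_solution (phi X : R -> Omega -> 'cV[R]_n) : Prop := FsvieSolution {
  fsvie_L2_F : L2_F X ;
  fsvie_eq : exists (D0 : R -> R -> Omega -> 'M[R]_n)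
                    (D1 : R -> R -> Omega * Omega -> 'M[R]_n),
    cond_exp_coef D0 D1 /\
    {ae mu, forall t : R, 0 <= t <= T ->
      exists2 I : Omega -> 'cV[R]_n,
        is_ito_integral P F W 0 t (fun s w =>
          D0 s t w *m X s w
          + vint P setT (fun w' => D1 s t (w', w) *m X s w')) I &
        {ae P, forall w, X t w = phi t w
          + vint mu `[0, t] (fun s =>
              (A0 s t w)^T *m X s w
              + vint P setT (fun w' => (A1 s t (w', w))^T *m X s w'))
          + I w}} }.

End coefficients.
End equations.

(* Main.v *)
Require Import Defs.
From HB Require Import structures.
From mathcomp Require Import all_boot all_order all_algebra.
From mathcomp Require Import all_classical all_reals all_analysis.
From mathcomp Require Import finmap measurable_realfun ring lra.

(* Let [v t s] be the mean of <X(t), b(t,s)>, where b(t,s) is the drift of the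
   backward equation.  X(t) is F_t-measurable, hence orthogonal to the Ito
   integral over [t,T], so pairing the backward equation with X(t) gives, for
   almost every t,
     E<X(t),psi(t)> = E<X(t),Y(t)> - int_t^T v t s ds.
   Pairing the forward equation with Y(t) = E Y(t) + int_0^t Z(t,s) dW(s), the
   Ito isometry turns the stochastic term into a time integral of
   E<Z(t,s), diffusion(s,t)>.  At fixed times s <= t, transposing the kernels
   and removing the conditional expectations, which face F_s-measurable
   variables only, shows that this plus the drift contribution is v s t, so
     E<Y(t),phi(t)> = E<Y(t),X(t)> - int_0^t v s t ds.
   Both double integrals are the integral of v over the triangle t <= s.
   The kernels on Omega^2 are measurable only for the completed product; they
   are first replaced, off a null set, by product-measurable ones, to which
   Fubini applies. *)

Set Implicit Arguments.
Unset Strict Implicit.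
Unset Printing Implicit Defensive.

Import Order.TTheory GRing.Theory Num.Theory.
Import numFieldNormedType.Exports.

Local Open Scope classical_set_scope.
Local Open Scope ring_scope.

(** * Integrals of real functions on rectangles *)

(** A kernel measurable for the completed product has measurable sections at almost every sample
    point but not at all of them, so even the inner expectations need care. Two different repairs
    are made. The drift kernels [A1], [C1] must be integrated in time; they are replaced once, off a
    null set of pairs of sample points that is the same for all times. The kernels [D0], [D1] enter
    only through an Ito integral, whose isometry already provides integrability in time, so they are
    treated separately at each pair of times. There they are also truncated, because a conditional
    expectation inherits the bound of the coefficient only almost surely. Completeness of [P]
    carries each almost sure replacement through the outer expectation.

    The exchanged arguments of Z in the backward drift are essential: [v s t] contains Z(t,s), which
    is known at time s, so that the conditional expectations can be removed. Y(t) is known only at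
    the later time t, but it meets the A-kernels alone, which carry no conditional expectation. *)

Section real_integral.
Context {d} {T : measurableType d} {R : realType}.
Variable mu : {measure set T -> \bar R}.
Implicit Types (D : set T) (f g : T -> R).

Lemma Rintegrable_measurable D f :
  mu.-integrable D (EFin \o f) -> measurable_fun D f.
Proof. by move=> /measurable_int /measurable_EFinP. Qed.

Lemma Rintegrable_le D f g : measurable D -> measurable_fun D f ->
  (forall x, D x -> `|f x| <= g x) ->
  mu.-integrable D (EFin \o g) -> mu.-integrable D (EFin \o f).
Proof.
move=> mD mf fg; apply: le_integrable => //; first exact/measurable_EFinP.
move=> x Dx /=; rewrite lee_fin (le_trans (fg _ Dx))//.
by rewrite ler_norm.
Qed.

Lemma Rintegrable_ae_le D f g : measurable D -> measurable_fun D f ->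
  {ae mu, forall x, D x -> `|f x| <= g x} ->
  mu.-integrable D (EFin \o g) -> mu.-integrable D (EFin \o f).
Proof.
move=> mD mf fg ig; apply/integrableP; split; first exact/measurable_EFinP.
have /integrableP[mg] := ig; apply: le_lt_trans.
apply: ae_ge0_le_integral => //.
- by apply: measurableT_comp => //; exact/measurable_EFinP.
- by apply: measurableT_comp => //.
apply: filterS fg => x fg Dx /=; rewrite lee_fin (le_trans (fg Dx))//.
by rewrite ler_norm.
Qed.

Lemma RintegrableD D f g : measurable D ->
  mu.-integrable D (EFin \o f) -> mu.-integrable D (EFin \o g) ->
  mu.-integrable D (EFin \o (fun x => f x + g x)).
Proof.
move=> mD iF iG; have := integrableD mD iF iG.
by apply: eq_integrable => // x _.
Qed.

Lemma RintegrableB D f g : measurable D ->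
  mu.-integrable D (EFin \o f) -> mu.-integrable D (EFin \o g) ->
  mu.-integrable D (EFin \o (fun x => f x - g x)).
Proof.
move=> mD iF iG; have := integrableB mD iF iG.
by apply: eq_integrable => // x _.
Qed.

Lemma RintegrableZl D f r : measurable D ->
  mu.-integrable D (EFin \o f) -> mu.-integrable D (EFin \o (fun x => r * f x)).
Proof.
move=> mD iF; have := integrableZl mD r iF.
by apply: eq_integrable => // x _.
Qed.

Lemma Rintegrable_sum (I : Type) (s : seq I) (p : pred I) D (h : I -> T -> R) :
  measurable D -> (forall i, p i -> mu.-integrable D (EFin \o h i)) ->
  mu.-integrable D (EFin \o (fun x => \sum_(i <- s | p i) h i x)).
Proof.
move=> mD ih.
have -> : EFin \o (fun x => \sum_(i <- s | p i) h i x) =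
    fun x => (\sum_(i <- s | p i) (h i x)%:E)%E.
  by apply/funext => x /=; rewrite sumEFin.
by apply: integrable_sum => // i pi; exact: ih.
Qed.

Lemma Rintegral_sum (I : Type) (s : seq I) (p : pred I) D (h : I -> T -> R) :
  measurable D -> (forall i, p i -> mu.-integrable D (EFin \o h i)) ->
  \int[mu]_(x in D) (\sum_(i <- s | p i) h i x) =
  \sum_(i <- s | p i) \int[mu]_(x in D) h i x.
Proof.
move=> mD ih; elim: s => [|i s IH].
  rewrite !big_nil; under eq_Rintegral do rewrite big_nil.
  by rewrite Rintegral_cst// mul0r.
rewrite !big_cons; under eq_Rintegral do rewrite big_cons.
case: ifP => // pi; rewrite RintegralD//; last exact: Rintegrable_sum.
  by rewrite IH.
exact: ih.
Qed.

Lemma ae_eq_Rintegral D f g : measurable D ->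
  measurable_fun D f -> measurable_fun D g ->
  {ae mu, forall x, D x -> f x = g x} ->
  \int[mu]_(x in D) f x = \int[mu]_(x in D) g x.
Proof.
move=> mD mf mg fg; congr fine; apply: ae_eq_integral => //.
- exact/measurable_EFinP.
- exact/measurable_EFinP.
- by apply: filterS fg => x fg Dx; rewrite fg.
Qed.

Lemma Rintegral_EFin D f : measurable D -> mu.-integrable D (EFin \o f) ->
  (\int[mu]_(x in D) (f x)%:E)%E = (\int[mu]_(x in D) f x)%:E.
Proof. by move=> mD iF; rewrite /Rintegral fineK//; exact: integrable_fin_num. Qed.

Lemma ge0_Rintegrable D f : measurable D -> measurable_fun D f ->
  (forall x, D x -> 0 <= f x) ->
  mu.-integrable D (EFin \o f) <-> (\int[mu]_(x in D) (f x)%:E < +oo)%E.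
Proof.
move=> mD mf f0; split=> [/integrableP[_]|iF].
  by under eq_integral => x /set_mem Dx do rewrite /= ger0_norm ?f0//.
apply/integrableP; split; first exact/measurable_EFinP.
by under eq_integral => x /set_mem Dx do rewrite /= ger0_norm ?f0//.
Qed.

(* Stated with [f ^+ 2] bounded rather than with the library's [Lfun], whose
   norm is an integral over the whole space. *)
Lemma Rintegrable_mul_sqr D f g : measurable D ->
  measurable_fun D f -> measurable_fun D g ->
  mu.-integrable D (EFin \o (fun x => f x ^+ 2)) ->
  mu.-integrable D (EFin \o (fun x => g x ^+ 2)) ->
  mu.-integrable D (EFin \o (fun x => f x * g x)).
Proof.
move=> mD mf mg iF iG.
apply: (Rintegrable_le mD _ _ (RintegrableD mD iF iG)).
  exact: measurable_funM.
move=> x Dx /=; rewrite normrM -[f x ^+ 2]real_normK ?num_real//.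
rewrite -[g x ^+ 2]real_normK ?num_real//.
by have := sqr_ge0 (`|f x| - `|g x|); nra.
Qed.

End real_integral.

Section sections.
Context {d1 d2} {T1 : measurableType d1} {T2 : measurableType d2} {R : realType}.
Implicit Types (A : set T1) (B : set T2).

Lemma measurable_fun_section1 {d3} {T3 : measurableType d3} A B
    (f : T1 * T2 -> T3) x : measurable A -> measurable B ->
  measurable_fun (A `*` B) f -> A x -> measurable_fun B (fun y => f (x, y)).
Proof.
move=> mA mB mf Ax; apply: (measurable_comp (F := A `*` B)) => //.
- exact: measurableX.
- by move=> _ [y By <-].
- by apply/measurable_funTS/measurable_fun_pair.
Qed.

Lemma measurable_fun_section2 {d3} {T3 : measurableType d3} A B
    (f : T1 * T2 -> T3) y : measurable A -> measurable B ->
  measurable_fun (A `*` B) f -> B y -> measurable_fun A (fun x => f (x, y)).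
Proof.
move=> mA mB mf By; apply: (measurable_comp (F := A `*` B)) => //.
- exact: measurableX.
- by move=> _ [x Ax <-].
- by apply/measurable_funTS/measurable_fun_pair.
Qed.

End sections.

(** * Tonelli and Fubini on a rectangle, by extension by zero *)

Section fubini_domain.
Context {d1 d2} {T1 : measurableType d1} {T2 : measurableType d2} {R : realType}.
Variable m1 : {sigma_finite_measure set T1 -> \bar R}.
Variable m2 : {sigma_finite_measure set T2 -> \bar R}.
Variables (A : set T1) (B : set T2).
Hypotheses (mA : measurable A) (mB : measurable B).
Implicit Types f : T1 * T2 -> R.

Let mAB : measurable (A `*` B). Proof. exact: measurableX. Qed.

Let patchE f x y : (f \_ (A `*` B)) (x, y) =
  ((fun x => ((fun y => f (x, y)) \_ B) y) \_ A) x.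
Proof.
rewrite /patch; case: ifPn => [/set_mem[/= Ax By]|].
  by rewrite !mem_set.
rewrite notin_setE/= => nAB; case: ifPn => // /set_mem Ax.
by rewrite memNset// => By; apply: nAB.
Qed.

Let int2 (f : T1 * T2 -> \bar R) x :
  (\int[m2]_y (f \_ (A `*` B)) (x, y) =
  ((fun x => \int[m2]_(y in B) f (x, y)) \_ A) x)%E.
Proof.
rewrite /patch; case: ifPn => [/set_mem Ax|/negP nAx].
  rewrite [RHS]integral_mkcond; apply: eq_integral => y _; rewrite /patch.
  have [By|By] := boolP (y \in B).
    by rewrite mem_set//=; split => //; exact/set_mem.
  by rewrite memNset//= => -[_ ?]; move/negP: By; apply; exact/mem_set.
rewrite integral0_eq// => y _; rewrite memNset//= => -[Ax _].
by apply: nAx; exact/mem_set.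
Qed.

Let int1 (f : T1 * T2 -> \bar R) y :
  (\int[m1]_x (f \_ (A `*` B)) (x, y) =
  ((fun y => \int[m1]_(x in A) f (x, y)) \_ B) y)%E.
Proof.
rewrite /patch; case: ifPn => [/set_mem By|/negP nBy].
  rewrite [RHS]integral_mkcond; apply: eq_integral => x _; rewrite /patch.
  have [Ax|Ax] := boolP (x \in A).
    by rewrite mem_set//=; split => //; exact/set_mem.
  by rewrite memNset//= => -[? _]; move/negP: Ax; apply; exact/mem_set.
rewrite integral0_eq// => x _; rewrite memNset//= => -[_ By].
by apply: nBy; exact/mem_set.
Qed.

Lemma tonelli_domain (f : T1 * T2 -> \bar R) :
  measurable_fun (A `*` B) f -> (forall x, 0 <= f x)%E ->
  (\int[m1]_(x in A) \int[m2]_(y in B) f (x, y) =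
   \int[m2]_(y in B) \int[m1]_(x in A) f (x, y))%E.
Proof.
move=> mf f0; have mp : measurable_fun setT (f \_ (A `*` B)).
  by apply/(measurable_restrictT _ mAB).
have p0 x : (0 <= (f \_ (A `*` B)) x)%E by rewrite /patch; case: ifP.
rewrite integral_mkcond -(funext (int2 f)).
by rewrite [RHS]integral_mkcond -(funext (int1 f)) fubini_tonelli.
Qed.

Lemma integrable_domainP f : measurable_fun (A `*` B) f ->
  (m1 \x m2)%E.-integrable (A `*` B) (EFin \o f) <->
  (\int[m1]_(x in A) \int[m2]_(y in B) `|f (x, y)|%:E < +oo)%E.
Proof.
move=> mf; rewrite integrable_mkcond//.
have mp : measurable_fun setT ((EFin \o f) \_ (A `*` B)).
  by apply/(measurable_restrictT _ mAB)/measurable_EFinP.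
rewrite (integrable12ltyP m1 m2 mp).
under eq_integral => x _.
  rewrite (_ : (\int[m2]_y _ = \int[m2]_y ((EFin \o Num.norm \o f) \_ (A `*` B)) (x, y))%E); last first.
    by apply: eq_integral => y _; rewrite /patch; case: ifP => //; rewrite abse0.
  rewrite int2; over.
by rewrite -integral_mkcond.
Qed.

Lemma ae_integrable_section f : (m1 \x m2)%E.-integrable (A `*` B) (EFin \o f) ->
  {ae m1, forall x, A x -> m2.-integrable B (EFin \o (fun y => f (x, y)))}.
Proof.
rewrite integrable_mkcond// => /ae_integrable1; apply: filterS => x ix Ax.
rewrite integrable_mkcond//; apply: eq_integrable ix => // y _.
rewrite restrict_EFin /= patchE /patch mem_set//= .
by case: ifP.
Qed.

Let fineint2 f x : fine (\int[m2]_y ((EFin \o f) \_ (A `*` B)) (x, y))%E =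
  ((fun x => \int[m2]_(y in B) f (x, y)) \_ A) x.
Proof. by rewrite int2 /patch; case: ifP. Qed.

(** No integrability of the sections is assumed: the extended integral of a section is the
    difference of the integrals of its positive and negative parts, each measurable by Tonelli, and
    [fine] preserves measurability even where it replaces an infinite value by 0. *)
Lemma measurable_Rintegral_section f : measurable_fun (A `*` B) f ->
  measurable_fun A (fun x => \int[m2]_(y in B) f (x, y)).
Proof.
move=> mf; apply/(measurable_restrictT _ mA).
rewrite -(funext (fineint2 f)); apply: measurableT_comp => //.
have mp : measurable_fun setT ((EFin \o f) \_ (A `*` B)).
  by apply/(measurable_restrictT _ mAB)/measurable_EFinP.
pose g : T1 * T2 -> \bar R := (EFin \o f) \_ (A `*` B).
rewrite -/g in mp *.
have mgp : measurable_fun setT (fubini_F m2 (g^\+)%E).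
  by apply: measurable_fun_fubini_tonelli_F => //; exact: measurable_funepos.
have mgn : measurable_fun setT (fubini_F m2 (g^\-)%E).
  by apply: measurable_fun_fubini_tonelli_F => //; exact: measurable_funeneg.
have := emeasurable_funB mgp mgn.
apply: eq_measurable_fun => x _; rewrite integralE.
by congr (_ - _)%E; apply: eq_integral => y _; rewrite ?funepos_comp ?funeneg_comp.
Qed.

Lemma integrable_Rintegral_section f :
  (m1 \x m2)%E.-integrable (A `*` B) (EFin \o f) ->
  m1.-integrable A (EFin \o (fun x => \int[m2]_(y in B) f (x, y))).
Proof.
move=> iF; have mf := Rintegrable_measurable iF.
have /(integrable_domainP mf) h := iF.
apply/integrableP; split.
  by apply/measurable_EFinP; exact: measurable_Rintegral_section.
apply: le_lt_trans h; apply: ae_ge0_le_integral => //.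
- apply: measurableT_comp => //; apply/measurable_EFinP.
  exact: measurable_Rintegral_section.
- by move=> x _; apply: integral_ge0.
- apply/(measurable_restrictT _ mA).
  rewrite (_ : _ \_ A = fun x => \int[m2]_y ((EFin \o Num.norm \o f) \_ (A `*` B)) (x, y))%E.
    have mh : measurable_fun setT ((EFin \o Num.norm \o f) \_ (A `*` B)).
      apply/(measurable_restrictT _ mAB)/measurable_EFinP.
      exact: measurableT_comp.
    have := @measurable_fun_fubini_tonelli_F _ _ _ _ _ m2 _ mh; apply.
    by move=> x; rewrite /patch; case: ifP => // _; rewrite lee_fin.
  by apply/funext => x; rewrite int2.
(* Bounding the norm of the integral by the integral of the norm needs an integrable section, which
   is available for almost every [x] only. *)
- apply: filterS (ae_integrable_section iF) => x ix Ax /=.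
  rewrite (@EFin_normr_Rintegral _ _ _ m2 B (fun y => f (x, y))) ?ix//.
  by apply: le_abse_integral => //; case/integrableP: (ix Ax).
Qed.

End fubini_domain.

Section fubini_domain_exchange.
Context {d1 d2} {T1 : measurableType d1} {T2 : measurableType d2} {R : realType}.
Variable m1 : {sigma_finite_measure set T1 -> \bar R}.
Variable m2 : {sigma_finite_measure set T2 -> \bar R}.
Variables (A : set T1) (B : set T2).
Hypotheses (mA : measurable A) (mB : measurable B).
Implicit Types f : T1 * T2 -> R.

Lemma measurable_fun_swap_domain f : measurable_fun (A `*` B) f ->
  measurable_fun (B `*` A) (fun z => f (z.2, z.1)).
Proof.
move=> mf; apply: (measurable_comp (F := A `*` B)) => //.
- exact: measurableX.
- by move=> _ [[y x] [/= By Ax] <-].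
- by apply/measurable_funTS/measurable_fun_pair.
Qed.

Lemma integrable_swap_domain f : (m1 \x m2)%E.-integrable (A `*` B) (EFin \o f) ->
  (m2 \x m1)%E.-integrable (B `*` A) (EFin \o (fun z => f (z.2, z.1))).
Proof.
move=> iF; have mf := Rintegrable_measurable iF.
apply/(integrable_domainP _ _ mB mA (measurable_fun_swap_domain mf)) => /=.
have /(integrable_domainP _ _ mA mB mf) := iF.
rewrite (@tonelli_domain _ _ _ _ _ m1 m2 _ _ mA mB (fun z => `|f z|%:E))//.
by apply/measurable_EFinP; exact: measurableT_comp.
Qed.

Lemma Rfubini f : (m1 \x m2)%E.-integrable (A `*` B) (EFin \o f) ->
  \int[m1]_(x in A) \int[m2]_(y in B) f (x, y) =
  \int[m2]_(y in B) \int[m1]_(x in A) f (x, y).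
Proof.
move=> iF; have mAB : measurable (A `*` B) by exact: measurableX.
have mf := Rintegrable_measurable iF.
have iFp := integrable_Rintegral_section mA mB iF.
have iFs := integrable_Rintegral_section mB mA (integrable_swap_domain iF).
pose g := f \_ (A `*` B).
have ig : (m1 \x m2)%E.-integrable setT (EFin \o g).
  move: iF; rewrite integrable_mkcond// => iF.
  by apply: eq_integrable iF => // z _; rewrite restrict_EFin.
have gE1 x : \int[m2]_y g (x, y) = ((fun x => \int[m2]_(y in B) f (x, y)) \_ A) x.
  rewrite /patch; case: ifPn => [Ax|nAx].
    rewrite [RHS]Rintegral_mkcond; apply: eq_Rintegral => y _.
    by rewrite /g /patch in_setX/= Ax.
  under eq_Rintegral do rewrite /g /patch in_setX/= (negbTE nAx)/=.
  by rewrite Rintegral_cst// mul0r.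
have gE2 y : \int[m1]_x g (x, y) = ((fun y => \int[m1]_(x in A) f (x, y)) \_ B) y.
  rewrite /patch; case: ifPn => [By|nBy].
    rewrite [RHS]Rintegral_mkcond; apply: eq_Rintegral => x _.
    by rewrite /g /patch in_setX/= By andbT.
  under eq_Rintegral do rewrite /g /patch in_setX/= (negbTE nBy) andbF/=.
  by rewrite Rintegral_cst// mul0r.
rewrite Rintegral_mkcond [RHS]Rintegral_mkcond -(funext gE1) -(funext gE2).
have iae1 : {ae m1, forall x, m2.-integrable setT (EFin \o (fun y => g (x, y)))}.
  by have := ae_integrable1 ig; apply: filterS.
have iae2 : {ae m2, forall y, m1.-integrable setT (EFin \o (fun x => g (x, y)))}.
  by have := ae_integrable2 ig; apply: filterS.
rewrite /Rintegral; congr fine.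
(* An inner real integral agrees with the extended one where the section is integrable, so each side
   is compared almost everywhere with an iterated extended integral. *)
transitivity (\int[m1]_x \int[m2]_y (g (x, y))%:E)%E.
  apply: ae_eq_integral => //.
  - apply/measurable_EFinP; rewrite -[X in measurable_fun X _]/(setT) .
    apply: measurableT_comp => //; exact: (measurable_fubini_F ig).
  - exact: (measurable_fubini_F ig).
  - by apply: filterS iae1 => x ix _; rewrite -/(Rintegral _ _ _) -Rintegral_EFin.
rewrite (Fubini ig); apply: ae_eq_integral => //.
- exact: (measurable_fubini_G ig).
- apply/measurable_EFinP.
  by apply: measurableT_comp => //; exact: (measurable_fubini_G ig).
- by apply: filterS iae2 => x ix _; rewrite -/(Rintegral _ _ _) -Rintegral_EFin.
Qed.

End fubini_domain_exchange.

(** * Conditional expectations *)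

Section sub_sigma_algebra.
Context {d} {T : measurableType d} {R : realType}.
Variable mu : {measure set T -> \bar R}.
Variable G : set (set T).
Hypothesis subG : <<s G >> `<=` measurable.
Notation TG := (g_sigma_algebraType G).

Lemma measurable_fun_sub_sigma {d'} {U : measurableType d'} (f : T -> U) :
  measurable_fun setT (f : TG -> U) -> measurable_fun setT f.
Proof.
move=> mf _ A mA; apply: subG.
by have := mf measurableT A mA.
Qed.

Import HBNNSimple.

(** The level sets of [h] lie in the sub-sigma-algebra, and [delta] has integral 0 over each of
    them. *)
Let orthogonal_nnsfun (delta : T -> R) (h : {nnsfun TG >-> R}) :
  mu.-integrable setT (EFin \o delta) ->
  (forall A, <<s G >> A -> \int[mu]_(x in A) delta x = 0) ->
  \int[mu]_x (h x * delta x) = 0.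
Proof.
move=> idelta delta0.
pose A r : set T := h @^-1` [set r].
have mA r : <<s G>> (A r).
  by have := @measurable_sfunP _ _ _ _ h [set r] (measurable_set1 r).
transitivity (\int[mu]_x (\sum_(r <- fset_set (range h)) r * (delta \_ (A r)) x)).
  apply: eq_Rintegral => x _; rewrite {1}fimfunE fsbig_finite//= mulr_suml.
  apply: eq_bigr => r _; rewrite -mulrA; congr (_ * _).
  rewrite indicE /patch; case: ifPn => _; first by rewrite mul1r.
  by rewrite mul0r.
have hid r : mu.-integrable setT (EFin \o (delta \_ (A r))).
  have mhr : measurable (A r) by exact: subG.
  have : mu.-integrable (A r) (EFin \o delta) by exact: integrableS idelta.
  rewrite integrable_mkcond//; apply: eq_integrable => // x _.
  by rewrite restrict_EFin.
rewrite Rintegral_sum//; last by move=> i _; apply: RintegrableZl.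
rewrite big1// => i _; rewrite RintegralZl//.
by rewrite -Rintegral_mkcond delta0 ?mulr0.
Qed.

(** Simple functions increasing to [xi] reduce this to the previous case by dominated convergence,
    [|xi * delta|] dominating all the products. *)
Let orthogonal_ge0 (delta xi : T -> R) :
  mu.-integrable setT (EFin \o delta) ->
  (forall A, <<s G >> A -> \int[mu]_(x in A) delta x = 0) ->
  measurable_fun setT (xi : TG -> R) -> (forall x, 0 <= xi x) ->
  mu.-integrable setT (EFin \o (fun x => xi x * delta x)) ->
  \int[mu]_x (xi x * delta x) = 0.
Proof.
move=> idelta delta0 mxi xi0 ixi.
have mexi : measurable_fun setT (EFin \o xi : TG -> \bar R) by exact/measurable_EFinP.
pose h := nnsfun_approx (@measurableT _ TG) mexi.
have hE x : EFin \o h^~ x @ \oo --> (xi x)%:E.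
  by have := @cvg_nnsfun_approx _ TG R setT measurableT _ mexi
    (fun x _ => xi0 x) x I.
have hle n x : h n x <= xi x.
  have nd m k : (m <= k)%N -> h m x <= h k x.
    move=> mk.
    by have /lefP/(_ x) := nd_nnsfun_approx (@measurableT _ TG) mexi mk.
  have := hE x => hEx; rewrite -lee_fin -(cvg_lim _ hEx)//.
  apply: lime_ge; first by apply/cvg_ex; exists (xi x)%:E.
  by near=> k; rewrite /= lee_fin; apply: nd; near: k; exact: nbhs_infty_ge.
have mh n : measurable_fun setT (h n : T -> R).
  by apply: measurable_fun_sub_sigma; exact: measurable_funPT.
have mdelta := Rintegrable_measurable idelta.
have mxi' := measurable_fun_sub_sigma mxi.
have cvgh : (\int[mu]_x (h n x * delta x)%:E)%E @[n --> \oo] -->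
    (\int[mu]_x (xi x * delta x)%:E)%E.
  apply: (@dominated_cvg _ T R mu setT measurableT _ _
    (fun x => `|xi x * delta x|%:E)) => //.
  - by move=> n; apply/measurable_EFinP; exact: measurable_funM.
  - move=> x _; apply: cvg_EFin; first exact: nearW.
    apply: cvgM; last exact: cvg_cst.
    exact: (fine_cvg (hE x)).
  - by have := integrable_norm ixi.
  - move=> n x _; rewrite lee_fin !normrM ler_wpM2r//.
    by rewrite !ger0_norm.
rewrite /Rintegral -(cvg_lim _ cvgh)//.
rewrite (_ : (fun n => _) = cst 0%E) ?lim_cst//.
apply/funext => n /=; rewrite Rintegral_EFin//.
  by rewrite orthogonal_nnsfun.
apply: (@Rintegrable_le _ _ _ _ _ _ (fun x => `|xi x * delta x|)) => //.
- exact: measurable_funM.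
- by move=> x _; rewrite !normrM ler_wpM2r// !ger0_norm.
- by have := integrable_norm ixi.
Unshelve. all: by end_near. Qed.

(** This one principle yields the rules for conditional expectations ([delta] a difference [g - f]),
    independence ([delta] a centred indicator) and the moments of increments given the past ([delta]
    an increment, or its square minus its variance). Besides [delta], only the product is asked to
    be integrable, so [xi] may be unbounded. *)
Lemma Rintegral_orthogonal (delta xi : T -> R) :
  mu.-integrable setT (EFin \o delta) ->
  (forall A, <<s G >> A -> \int[mu]_(x in A) delta x = 0) ->
  measurable_fun setT (xi : TG -> R) ->
  mu.-integrable setT (EFin \o (fun x => xi x * delta x)) ->
  \int[mu]_x (xi x * delta x) = 0.
Proof.
move=> idelta delta0 mxi ixi.
have mxip : measurable_fun setT (xi^\+ : TG -> R) by exact: measurable_funrpos.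
have mxin : measurable_fun setT (xi^\- : TG -> R) by exact: measurable_funrneg.
have mdelta := Rintegrable_measurable idelta.
have lep x : `|xi^\+ x * delta x| <= `|xi x * delta x|.
  rewrite !normrM ler_wpM2r// -[leRHS]/((Num.norm \o xi) x) -funrposDneg.
  by rewrite ger0_norm ?funrpos_ge0// lerDl funrneg_ge0.
have len x : `|xi^\- x * delta x| <= `|xi x * delta x|.
  rewrite !normrM ler_wpM2r// -[leRHS]/((Num.norm \o xi) x) -funrposDneg.
  by rewrite ger0_norm ?funrneg_ge0// lerDr funrpos_ge0.
have ip : mu.-integrable setT (EFin \o (fun x => xi^\+ x * delta x)).
  apply: (@Rintegrable_le _ _ _ _ _ _ (fun x => `|xi x * delta x|)) => //.
    by apply: measurable_funM => //; exact: measurable_fun_sub_sigma.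
  by have := integrable_norm ixi.
have im : mu.-integrable setT (EFin \o (fun x => xi^\- x * delta x)).
  apply: (@Rintegrable_le _ _ _ _ _ _ (fun x => `|xi x * delta x|)) => //.
    by apply: measurable_funM => //; exact: measurable_fun_sub_sigma.
  by have := integrable_norm ixi.
have -> : \int[mu]_x (xi x * delta x) =
    \int[mu]_x (xi^\+ x * delta x - xi^\- x * delta x).
  by apply: eq_Rintegral => x _; rewrite -mulrBl -[in LHS](funrposBneg xi).
by rewrite RintegralB// !orthogonal_ge0 ?subr0//.
Qed.

(** The set where [g > K] belongs to the sub-sigma-algebra; on it [g - f] is positive but has
    integral 0, so the set is null. *)
Let cond_exp_le (f g : T -> R) K :
  mu.-integrable setT (EFin \o f) -> mu.-integrable setT (EFin \o g) ->
  measurable_fun setT (g : TG -> R) ->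
  (forall A, <<s G >> A -> \int[mu]_(x in A) g x = \int[mu]_(x in A) f x) ->
  (forall x, f x <= K) -> {ae mu, forall x, g x <= K}.
Proof.
move=> iF ig mg gf fK.
pose A : set T := [set x | K < g x].
have GA : <<s G>> A.
  have : measurable `]K, +oo[ by exact: measurable_itv.
  move=> /(mg measurableT); rewrite setTI; congr (<<s G>> _).
  by apply/seteqP; split => x; rewrite /A /= in_itv/= andbT.
have mA := subG GA.
have iFA : mu.-integrable A (EFin \o f) by exact: integrableS iF.
have igA : mu.-integrable A (EFin \o g) by exact: integrableS ig.
have igf := RintegrableB mA igA iFA.
have gf0 x : A x -> f x < g x.
  exact: le_lt_trans.
have : (\int[mu]_(x in A) `|(g x - f x)%:E| = 0)%E.
  under eq_integral => x /set_mem Ax.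
    by rewrite /= ger0_norm ?subr_ge0 ?(ltW (gf0 _ Ax))//; over.
  by rewrite Rintegral_EFin// RintegralB// gf// subrr.
move=> /(ae_eq_integral_abs mu mA _).
have mgf : measurable_fun A (EFin \o (fun x => g x - f x)).
  by case/integrableP : igf.
move=> /(_ mgf); apply: filterS => x Ax.
rewrite leNgt; apply/negP => Kg.
have : A x by [].
move=> /[dup] /gf0 + /Ax [] /eqP; rewrite subr_eq0 => + /eqP gfE.
by rewrite gfE ltxx.
Qed.

Lemma cond_exp_bounded (f g : T -> R) K :
  mu.-integrable setT (EFin \o f) -> mu.-integrable setT (EFin \o g) ->
  measurable_fun setT (g : TG -> R) ->
  (forall A, <<s G >> A -> \int[mu]_(x in A) g x = \int[mu]_(x in A) f x) ->
  (forall x, `|f x| <= K) -> {ae mu, forall x, `|g x| <= K}.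
Proof.
move=> iF ig mg gf fK.
have h1 : {ae mu, forall x, g x <= K}.
  by apply: cond_exp_le gf _ => // x; rewrite (le_trans (ler_norm _)).
have h2 : {ae mu, forall x, - g x <= K}.
  apply: (@cond_exp_le (fun x => - f x) (fun x => - g x)).
  - by have := RintegrableZl (-1) measurableT iF; apply: eq_integrable => // x _ /=; rewrite mulN1r.
  - by have := RintegrableZl (-1) measurableT ig; apply: eq_integrable => // x _ /=; rewrite mulN1r.
  - exact: measurable_funN.
  - move=> A GA; have mA := subG GA.
    have iFA : mu.-integrable A (EFin \o f) by exact: integrableS iF.
    have igA : mu.-integrable A (EFin \o g) by exact: integrableS ig.
    under eq_Rintegral do rewrite -mulN1r.
    under [RHS]eq_Rintegral do rewrite -mulN1r.
    by rewrite !RintegralZl// gf.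
  - by move=> x; rewrite (le_trans (ler_norm _))// normrN.
by apply: filterS2 h1 h2 => x g1 g2; rewrite ler_norml g1 andbT lerNl.
Qed.

(** A bounded [f] makes [g] almost surely bounded, so that an integrable [xi] suffices; later [xi]
    is a product of two square-integrable variables, which need not be square-integrable itself. *)
Lemma cond_exp_mul (f g xi : T -> R) K :
  mu.-integrable setT (EFin \o f) -> mu.-integrable setT (EFin \o g) ->
  measurable_fun setT (g : TG -> R) ->
  (forall A, <<s G >> A -> \int[mu]_(x in A) g x = \int[mu]_(x in A) f x) ->
  (forall x, `|f x| <= K) ->
  measurable_fun setT (xi : TG -> R) -> mu.-integrable setT (EFin \o xi) ->
  mu.-integrable setT (EFin \o (fun x => xi x * g x)) /\
  \int[mu]_x (xi x * g x) = \int[mu]_x (xi x * f x).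
Proof.
move=> iF ig mg gf fK mxi ixi.
have gK := cond_exp_bounded iF ig mg gf fK.
have mf := Rintegrable_measurable iF.
have mxi' := measurable_fun_sub_sigma mxi.
have mg' := measurable_fun_sub_sigma mg.
have inorm : mu.-integrable setT (EFin \o (fun x => K * `|xi x|)).
  by apply: RintegrableZl => //; have := integrable_norm ixi.
have ixg : mu.-integrable setT (EFin \o (fun x => xi x * g x)).
  apply: Rintegrable_ae_le inorm => //; first exact: measurable_funM.
  by apply: filterS gK => x gK _; rewrite normrM mulrC ler_wpM2r.
have ixf : mu.-integrable setT (EFin \o (fun x => xi x * f x)).
  apply: Rintegrable_le inorm => //; first exact: measurable_funM.
  by move=> x _; rewrite normrM mulrC ler_wpM2r.
split => //; apply/eqP; rewrite -subr_eq0 -RintegralB//; apply/eqP.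
under eq_Rintegral do rewrite -mulrBr.
apply: Rintegral_orthogonal => //.
- exact: RintegrableB.
- move=> A GA; have mA := subG GA.
  have iFA : mu.-integrable A (EFin \o f) by exact: integrableS iF.
  have igA : mu.-integrable A (EFin \o g) by exact: integrableS ig.
  by rewrite RintegralB// gf// subrr.
- have := RintegrableB measurableT ixg ixf.
  by apply: eq_integrable => // x _ /=; rewrite mulrBr.
Qed.

End sub_sigma_algebra.

(** * Brownian increments *)

Section normal_moments.
Context {R : realType}.
Variable s : R.
Hypothesis s_gt0 : 0 < s.
Notation mu := (@lebesgue_measure R).
Notation p := (normal_pdf 0 s).
Notation N := (normal_prob 0 s).

Let s_neq0 : s != 0. Proof. by rewrite gt_eqF. Qed.

Let pE x : p x = normal_peak s * expR (- (2 * s ^+ 2)^-1 * x ^+ 2).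
Proof.
rewrite normal_pdfE// /normal_fun subr0; congr (_ * expR _).
by rewrite !mulNr mulrC mulr_natl.
Qed.

Let is_derive_p (x : R) : is_derive x 1 p (- (s ^+ 2)^-1 * x * p x).
Proof.
rewrite (_ : p = fun x => normal_peak s * expR (- (2 * s ^+ 2)^-1 * x ^+ 2)); last first.
  by apply/funext => y; exact: pE.
apply: is_derive_eq.
rewrite /GRing.scale/=.
by field.
Qed.

Let is_derive_G (x : R) : is_derive x 1 (fun x => - s ^+ 2 * p x) (x * p x).
Proof.
have := is_derive_p x => h.
apply: is_derive_eq; rewrite /GRing.scale/=.
by field.
Qed.

Let mp : measurable_fun setT p. Proof. exact: measurable_normal_pdf. Qed.

Let continuous_p : continuous p. Proof. exact: continuous_normal_pdf. Qed.

(** [x ^+ 2 * p x] is read as [x] times the derivative of [- s ^+ 2 * p x]; as [p] is even, the two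
    boundary terms add up. *)
Let by_parts (a : R) : 0 < a ->
  (\int[mu]_(x in `[(- a)%R, a]) (x ^+ 2 * p x)%:E =
   (- 2 * s ^+ 2 * (a * p a))%:E +
   (s ^+ 2)%:E * \int[mu]_(x in `[(- a)%R, a]) (p x)%:E)%E.
Proof.
move=> a0.
under eq_integral do rewrite expr2 -mulrA.
have cG : continuous (fun x : R => - s ^+ 2 * p x).
  by move=> x; apply: cvgM; [exact: cvg_cst|exact: continuous_p].
rewrite (@integration_by_parts R id (fun x => - s ^+ 2 * p x) (cst 1)
  (fun x => x * p x))//.
- have -> : p (- a) = p a by rewrite !pE sqrrN.
  under eq_integral do rewrite /= mul1r EFinM.
  rewrite integralZl//; last first.
    by apply: (integrableS _ _ (subsetT _)) => //; exact: integrable_normal_pdf.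
  rewrite EFinN mulNe oppeK; congr (_%:E + _)%E; ring.
- by rewrite gtrN.
- by apply: continuous_subspaceT; exact: cst_continuous.
- split => //.
  + have := @cvg_at_right_filter R R (@id R) (- a) (- a); apply; exact: cvg_id.
  + have := @cvg_at_left_filter R R (@id R) a a; apply; exact: cvg_id.
- by move=> x _; rewrite derive1E derive_id.
- apply: continuous_subspaceT => x.
  by apply: cvgM; [exact: cvg_id|exact: continuous_p].
- split => //.
  + by move=> x _; have [] := is_derive_G x.
  + exact: (@cvg_at_right_filter R R (fun x : R => - s ^+ 2 * p x) (- a) _ (cG (- a))).
  + exact: (@cvg_at_left_filter R R (fun x : R => - s ^+ 2 * p x) a _ (cG a)).
- by move=> x _; rewrite derive1E; have [_ ->] := is_derive_G x.
Qed.

Let cvg_boundary : (- 2 * s ^+ 2 * (n.+1%:R * p n.+1%:R)) @[n --> \oo] --> (0 : R).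
Proof.
(* The constant comes from [expR (- u) <= u^-1] with [u] the square of [n.+1] divided by
   [2 * s ^+ 2]: after multiplication by [n.+1], a multiple of [n.+1^-1] remains. *)
pose c := normal_peak s * (2 * s ^+ 2).
have le1 n : n.+1%:R * p n.+1%:R <= c * n.+1%:R^-1.
  have n0 : 0 < n.+1%:R :> R by [].
  have s20 : 0 < 2 * s ^+ 2 by rewrite mulr_gt0// exprn_gt0.
  have hexp : expR (- (2 * s ^+ 2)^-1 * n.+1%:R ^+ 2) <= 2 * s ^+ 2 / n.+1%:R ^+ 2.
    rewrite mulNr expRN -[leRHS]invrK lef_pV2 ?posrE ?expR_gt0//; last first.
      by rewrite invr_gt0 divr_gt0// exprn_gt0.
    by rewrite invf_div mulrC (le_trans _ (expR_ge1Dx _))// lerDr.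
  rewrite pE (_ : c / _ = n.+1%:R * (normal_peak s * (2 * s ^+ 2 / n.+1%:R ^+ 2))).
    by rewrite !ler_wpM2l// normal_peak_ge0.
  by rewrite /c; field; rewrite gt_eqF.
have le0 n : 0 <= n.+1%:R * p n.+1%:R by rewrite mulr_ge0// normal_pdf_ge0.
have cvg0 : (n.+1%:R * p n.+1%:R) @[n --> \oo] --> (0 : R).
  apply: (@squeeze_cvgr _ _ _ _ (cst 0) (fun n => c * n.+1%:R^-1)).
  - by apply: nearW => n; rewrite le0 le1.
  - exact: cvg_cst.
  - rewrite -[X in _ --> X](mulr0 c); apply: cvgM; first exact: cvg_cst.
    exact: cvg_harmonic.
by rewrite -[X in _ --> X](mulr0 (- 2 * s ^+ 2)); apply: cvgM => //; exact: cvg_cst.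
Qed.

Let bigcup_sym : \bigcup_n `[(- n.+1%:R)%R, n.+1%:R]%classic = [set: R].
Proof.
apply/seteqP; split => // x _.
have [n xn] : exists n, `|x| <= n.+1%:R.
  exists (Num.truncn `|x|); apply/ltW/truncnS_gt.
by exists n => //=; rewrite in_itv/= -ler_norml.
Qed.

Let nd_sym : nondecreasing_seq (fun n => `[(- n.+1%:R)%R, n.+1%:R]%classic : set R).
Proof.
move=> m n mn; apply/subsetPset => x /=; rewrite !in_itv/= => /andP[h1 h2].
by apply/andP; split; [apply: le_trans h1; rewrite lerN2|apply: le_trans h2 _];
   rewrite ler_nat ltnS.
Qed.

Let second_moment_lebesgue :
  (\int[mu]_x (x ^+ 2 * p x)%:E = (s ^+ 2)%:E)%E.
Proof.
have c1 : (\int[mu]_(x in `[(- n.+1%:R)%R, n.+1%:R]) (x ^+ 2 * p x)%:E)%E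
    @[n --> \oo] --> (\int[mu]_x (x ^+ 2 * p x)%:E)%E.
  rewrite -bigcup_sym; apply: ge0_nondecreasing_set_cvg_integral => //.
  - move=> n; apply/measurable_EFinP; apply: measurable_funTS.
    by apply: measurable_funM => //; exact: measurable_funX.
  - by move=> n x _; rewrite lee_fin mulr_ge0 ?sqr_ge0 ?normal_pdf_ge0.
have c2 : (\int[mu]_(x in `[(- n.+1%:R)%R, n.+1%:R]) (p x)%:E)%E
    @[n --> \oo] --> (\int[mu]_x (p x)%:E)%E.
  rewrite -bigcup_sym; apply: ge0_nondecreasing_set_cvg_integral => //.
  - by move=> n; apply/measurable_EFinP; apply: measurable_funTS.
  - by move=> n x _; rewrite lee_fin normal_pdf_ge0.
rewrite integral_normal_pdf in c2.
rewrite -(cvg_lim _ c1)//; apply/cvg_lim => //.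
have -> : (fun n : nat => \int[mu]_(x in `[(- n.+1%:R)%R, n.+1%:R]) (x ^+ 2 * p x)%:E)%E =
    (fun n : nat => (- 2 * s ^+ 2 * (n.+1%:R * p n.+1%:R))%:E +
   (s ^+ 2)%:E * \int[mu]_(x in `[(- n.+1%:R)%R, n.+1%:R]) (p x)%:E)%E.
  by apply/funext => n; rewrite by_parts.
rewrite -[X in _ --> X]add0e; apply: cvgeD => //.
  by apply: cvg_EFin; [exact: nearW|exact: cvg_boundary].
by rewrite -[X in _ --> X]mule1; apply: cvgeZl.
Qed.

(** The Radon-Nikodym derivative of the normal law agrees almost everywhere with its density, since
    both have the same integral over every measurable set. *)
Let RN (f : R -> \bar R) : (forall x, 0 <= f x)%E -> measurable_fun setT f ->
  (\int[N]_x f x = \int[mu]_x (f x * (p x)%:E))%E.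
Proof.
move=> f0 mf.
have dom := @normal_prob_dominates R 0 s.
rewrite -(Radon_Nikodym_SigmaFinite.change_of_variables dom)//.
apply: ae_eq_integral => //.
- apply: emeasurable_funM => //.
  by apply: measurable_int; exact: Radon_Nikodym_SigmaFinite.f_integrable.
- by apply: emeasurable_funM => //; exact/measurable_EFinP.
- apply: ae_eqe_mul2l; apply: integral_ae_eq => //.
  + exact: Radon_Nikodym_SigmaFinite.f_integrable.
  + exact/measurable_EFinP.
  + by move=> E _ mE; rewrite -Radon_Nikodym_SigmaFinite.f_integral.
Qed.

Lemma normal_prob_second_moment : (\int[N]_x (x ^+ 2)%:E = (s ^+ 2)%:E)%E.
Proof.
rewrite RN.
- by under eq_integral do rewrite -EFinM; rewrite second_moment_lebesgue.
- by move=> x; rewrite lee_fin sqr_ge0.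
- by apply/measurable_EFinP; exact: measurable_funX.
Qed.

Lemma normal_prob_integrable_sqr :
  N.-integrable setT (EFin \o (fun x : R => x ^+ 2)).
Proof.
apply/ge0_Rintegrable => //.
- by move=> x _; exact: sqr_ge0.
- by rewrite normal_prob_second_moment ltry.
Qed.

Lemma normal_prob_integrable_id : N.-integrable setT (EFin \o (fun x : R => x)).
Proof.
have i1 : N.-integrable setT (EFin \o (fun _ : R => 1)).
  exact: finite_measure_integrable_cst.
apply: (Rintegrable_le measurableT _ _
  (RintegrableD measurableT i1 normal_prob_integrable_sqr)) => //.
by move=> x _; rewrite -[x ^+ 2]real_normK ?num_real//; have := sqr_ge0 (`|x| - 1); nra.
Qed.

(** Reflection preserves the centred law, so its mean equals its own opposite and no integral has to
    be computed. *)
Let normal_probN (A : set R) : measurable A ->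
  pushforward N (-%R : measurableTypeR R -> measurableTypeR R) A = N A.
Proof.
move=> mA; rewrite /pushforward /normal_prob.
have mN : measurable_fun setT (-%R : measurableTypeR R -> measurableTypeR R).
  exact: measurable_funN.
transitivity (\int[mu]_(x in -%R @^-1` A) (p (- x))%:E)%E.
  by apply: eq_integral => x _; rewrite !pE sqrrN.
rewrite -(@ge0_integral_pushforward _ _ (measurableTypeR R) (measurableTypeR R)
  R _ mN mu A (EFin \o p))//.
- by apply: eq_measure_integral => B mB _; exact: lebesgue_measureN.
- exact/measurable_EFinP/measurable_funTS.
- by move=> x; rewrite lee_fin normal_pdf_ge0.
Qed.

Lemma normal_prob_mean : \int[N]_x x = 0.
Proof.
have mN : measurable_fun setT (-%R : measurableTypeR R -> measurableTypeR R).
  exact: measurable_funN.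
have iN : N.-integrable setT ((EFin \o (fun x : R => x)) \o (-%R : measurableTypeR R -> measurableTypeR R)).
  have := RintegrableZl (-1) measurableT normal_prob_integrable_id.
  by apply: eq_integrable => // x _ /=; rewrite mulN1r.
have : \int[N]_x x = - \int[N]_x x.
  rewrite -mulN1r -RintegralZl//; last exact: normal_prob_integrable_id.
  rewrite {1}/Rintegral.
  have -> : (\int[N]_x x%:E)%E = (\int[pushforward N (-%R : measurableTypeR R -> measurableTypeR R)]_x x%:E)%E.
    by apply: eq_measure_integral => A mA _; exact/esym/normal_probN.
  rewrite integral_pushforward//.
  by congr fine; apply: eq_integral => x _; rewrite /= mulN1r.
by move=> /eqP; rewrite -addr_eq0 -mulr2n mulrn_eq0/= => /eqP.
Qed.

End normal_moments.

(** * Increments of the Brownian motion given the past *)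

Section brownian_increments.
Context {R : realType} {d : measure_display} {Omega : measurableType d}.
Variables (P : probability Omega R) (W : R -> Omega -> R).
Hypothesis cP : measure_is_complete P.
Hypothesis bW : brownian_motion P W.
Notation F := (brownian_filtration P W).
Notation OF t := (g_sigma_algebraType (F t)).
Implicit Types (a b c s t : R) (xi eta : Omega -> R).

Lemma brownian_filtrationK t : <<s F t >> = F t.
Proof. by apply: sigma_algebra_id; exact: smallest_sigma_algebra. Qed.

(** The negligible sets adjoined by the augmentation are measurable because [P] is complete. *)
Lemma brownian_filtration_measurable t : F t `<=` measurable.
Proof.
apply: smallest_sub; first exact: sigma_algebra_measurable.
rewrite subUset; split; last exact: cP.
move=> A [s /=]; rewrite in_itv/= => /andP[s0 _] [B mB <-].
exact: (bm_measurable bW s0 measurableT mB).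
Qed.

Lemma brownian_filtration_sigma_measurable t : <<s F t >> `<=` measurable.
Proof. by rewrite brownian_filtrationK; exact: brownian_filtration_measurable. Qed.

Lemma brownian_filtration_mono s t : s <= t -> F s `<=` F t.
Proof.
move=> st; apply: sub_sigma_algebra2; apply: setSU => A [r /=].
rewrite in_itv/= => /andP[r0 rs] FA; exists r => //=.
by rewrite in_itv/= r0 (le_trans rs).
Qed.

Lemma measurable_fun_filtration_mono s t (f : Omega -> R) : s <= t ->
  measurable_fun setT (f : OF s -> R) -> measurable_fun setT (f : OF t -> R).
Proof.
move=> st mf _ A mA; have := mf measurableT A mA.
have h : <<s F s >> `<=` <<s F t >>.
  by rewrite !brownian_filtrationK; exact: brownian_filtration_mono.
exact: h.
Qed.

Lemma measurable_fun_filtration t {d'} {U : measurableType d'} (f : Omega -> U) :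
  measurable_fun setT (f : OF t -> U) -> measurable_fun setT f.
Proof.
by move=> mf; apply: measurable_fun_sub_sigma mf; exact: brownian_filtration_sigma_measurable.
Qed.

Lemma measurable_brownian s t : 0 <= s -> s <= t ->
  measurable_fun setT (W s : OF t -> R).
Proof.
move=> s0 st _ A mA; apply: sub_sigma_algebra.
apply: sub_sigma_algebra; left; exists s => /=; first by rewrite in_itv/= s0.
by exists A => //; rewrite setTI.
Qed.

Lemma measurable_increment s t u : 0 <= s -> s <= t -> t <= u ->
  measurable_fun setT (increment W s t : OF u -> R).
Proof.
move=> s0 st tu; apply: measurable_funB.
- by apply: measurable_brownian => //; rewrite (le_trans s0).
- by apply: measurable_brownian => //; rewrite (le_trans st).
Qed.

Let mincr s t : 0 <= s -> s <= t ->
  measurable_fun setT (increment W s t : Omega -> R).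
Proof.
by move=> s0 st; apply: (@measurable_fun_filtration t); exact: measurable_increment.
Qed.

Let law_ge0 s t (f : R -> \bar R) : 0 <= s -> s < t ->
  measurable_fun setT f -> (forall x, 0 <= f x)%E ->
  (\int[normal_prob 0 (Num.sqrt (t - s))]_x f x =
   \int[P]_w f (increment W s t w))%E.
Proof.
move=> s0 st mf f0; have mW := mincr s0 (ltW st).
rewrite -(@ge0_integral_pushforward _ _ Omega (measurableTypeR R) R _ mW P setT f)//.
by apply: eq_measure_integral => A mA _; exact/esym/(bm_gaussian bW).
Qed.

Let law s t (f : R -> R) : 0 <= s -> s < t ->
  measurable_fun setT f ->
  P.-integrable setT (EFin \o (fun w => f (increment W s t w))) ->
  \int[normal_prob 0 (Num.sqrt (t - s))]_x f x =
  \int[P]_w f (increment W s t w).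
Proof.
move=> s0 st mf iF; have mW := mincr s0 (ltW st); congr fine.
rewrite -(@integral_pushforward _ _ Omega (measurableTypeR R) R _ mW P setT (EFin \o f))//.
  by apply: eq_measure_integral => A mA _; exact/esym/(bm_gaussian bW).
exact/measurable_EFinP.
Qed.

Let sqrt_gt0 s t : s < t -> 0 < Num.sqrt (t - s).
Proof. by move=> st; rewrite sqrtr_gt0 subr_gt0. Qed.

(** The Gaussian law and the independence are given for [s < t], while simple processes may have
    equal consecutive times; the empty increment is therefore treated apart below. *)
Let increment_id s : increment W s s = cst 0.
Proof. by apply/funext => w; rewrite /increment subrr. Qed.

Let second_moment s t : 0 <= s -> s <= t ->
  (\int[P]_w (increment W s t w ^+ 2)%:E = (t - s)%:E)%E.
Proof.
move=> s0; rewrite le_eqVlt => /predU1P[<-|st].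
  rewrite subrr integral0_eq// => w _.
  by rewrite increment_id expr0n.
have := normal_prob_second_moment (sqrt_gt0 st).
rewrite law_ge0// ?sqr_sqrtr ?subr_ge0 ?ltW//.
- by apply/measurable_EFinP; exact: measurable_funX.
- by move=> x; rewrite lee_fin sqr_ge0.
Qed.

Lemma increment_sqr_integrable s t : 0 <= s -> s <= t ->
  P.-integrable setT (EFin \o (fun w => increment W s t w ^+ 2)).
Proof.
move=> s0 st; apply/ge0_Rintegrable => //.
- by apply: measurable_funX; exact: mincr.
- by move=> w _; exact: sqr_ge0.
- by rewrite second_moment// ltry.
Qed.

Lemma Rintegrable_of_sqr (xi : Omega -> R) : measurable_fun setT xi ->
  P.-integrable setT (EFin \o (fun w => xi w ^+ 2)) ->
  P.-integrable setT (EFin \o xi).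
Proof.
move=> mxi ixi.
have i1 : P.-integrable setT (EFin \o (fun _ : Omega => (1 : R) ^+ 2)).
  exact: finite_measure_integrable_cst.
have := Rintegrable_mul_sqr measurableT mxi (measurable_cst (1 : R)) ixi i1.
by apply: eq_integrable => // x _ /=; rewrite mulr1.
Qed.

Let mean s t : 0 <= s -> s <= t -> \int[P]_w increment W s t w = 0.
Proof.
move=> s0; rewrite le_eqVlt => /predU1P[<-|st].
  by rewrite increment_id Rintegral_cst// mul0r.
have := normal_prob_mean (sqrt_gt0 st).
rewrite (@law s t id)//; apply: Rintegrable_of_sqr; first exact/mincr/ltW.
by apply: increment_sqr_integrable => //; exact/ltW.
Qed.

(* Applies the orthogonality lemma to the sigma-algebra generated by the
   increment and to the centred indicator of [A]. *)
Let indep_integral s t A (f : R -> R) : 0 <= s -> s < t -> F s A ->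
  measurable_fun setT f ->
  P.-integrable setT (EFin \o (fun w => f (increment W s t w))) ->
  \int[P]_(w in A) f (increment W s t w) =
  fine (P A) * \int[P]_w f (increment W s t w).
Proof.
move=> s0 st FA mf iF.
have mA := brownian_filtration_measurable FA.
have mW : measurable_fun setT (increment W s t : Omega -> R) by exact/mincr/ltW.
pose G : set (set Omega) := preimage_set_system setT (increment W s t) measurable.
have GK : <<s G >> = G.
  by apply/sigma_algebra_id/sigma_algebra_preimage/sigma_algebra_measurable.
have subG : <<s G >> `<=` measurable.
  by rewrite GK => _ [B mB <-]; exact: mW.
have iind B : measurable B -> P.-integrable setT (EFin \o (\1_B : Omega -> R)).
  by move=> mB; exact: integrable_indic.
have ic (r : R) D : measurable D -> P.-integrable D (EFin \o (fun _ : Omega => r)).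
  by move=> mD; exact: finite_measure_integrable_cst.
pose delta w : R := \1_A w - fine (P A).
have idelta : P.-integrable setT (EFin \o delta).
  by apply: RintegrableB => //; [exact: iind|exact: ic].
have intind D : measurable D -> \int[P]_(w in D) (\1_A w : R) = fine (P (A `&` D)).
  by move=> mD; rewrite /Rintegral integral_indic.
have delta0 D : <<s G >> D -> \int[P]_(w in D) delta w = 0.
  move=> GD; have mD := subG _ GD; move: GD; rewrite GK => -[B mB BD].
  rewrite RintegralB//; [|exact: integrableS (iind _ mA)|exact: ic].
  rewrite intind// Rintegral_cst// -BD setTI (bm_indep bW)// fineM ?subrr//.
  - exact: fin_num_measure.
  - by apply: fin_num_measure; rewrite -[X in measurable X]setTI; exact: mW.
have ifA : P.-integrable setT (EFin \o (fun w => \1_A w * f (increment W s t w))).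
  apply: Rintegrable_le (integrable_norm iF) => //.
    by apply: measurable_funM => //; exact: measurableT_comp.
  move=> w _; rewrite normrM ler_piMl// indicE.
  by case: (_ \in _); rewrite ?normr1 ?normr0.
have : \int[P]_w (f (increment W s t w) * delta w) = 0.
  apply: (Rintegral_orthogonal subG idelta delta0).
    move=> _ B mB; apply: sub_sigma_algebra; exists (f @^-1` B) => //.
    by rewrite -[X in measurable X]setTI; exact: mf.
  have := RintegrableB measurableT ifA (RintegrableZl (fine (P A)) measurableT iF).
  by apply: eq_integrable => // w _ /=; rewrite /delta mulrBr mulrC [X in _ - X]mulrC.
under eq_Rintegral do rewrite mulrBr mulrC (mulrC _ (fine _)).
rewrite RintegralB//; last exact: RintegrableZl.
rewrite RintegralZl// => /eqP; rewrite subr_eq0 => /eqP <-.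
rewrite Rintegral_mkcond; apply: eq_Rintegral => w _.
by rewrite /patch indicE; case: ifP => _; rewrite ?mul1r ?mul0r.
Qed.

Lemma increment_mean s t A : 0 <= s -> s <= t -> F s A ->
  \int[P]_(w in A) increment W s t w = 0.
Proof.
move=> s0; rewrite le_eqVlt => /predU1P[<-|st] FA.
  have mA := brownian_filtration_measurable FA.
  by rewrite increment_id Rintegral_cst// mul0r.
rewrite (@indep_integral s t A id)// ?mean ?mulr0//; first exact/ltW.
apply: Rintegrable_of_sqr; first exact/mincr/ltW.
by apply: increment_sqr_integrable => //; exact/ltW.
Qed.

Lemma increment_var s t A : 0 <= s -> s <= t -> F s A ->
  \int[P]_(w in A) (increment W s t w ^+ 2) = (t - s) * fine (P A).
Proof.
move=> s0; rewrite le_eqVlt => /predU1P[<-|st] FA.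
  have mA := brownian_filtration_measurable FA.
  rewrite increment_id.
  under eq_Rintegral do rewrite expr0n/=.
  by rewrite Rintegral_cst// subrr !mul0r.
rewrite (@indep_integral s t A (fun x => x ^+ 2))//.
- by rewrite mulrC /Rintegral second_moment// ltW.
- by apply: increment_sqr_integrable => //; exact/ltW.
Qed.

Lemma Rintegral_mul_increment s t xi : 0 <= s -> s <= t ->
  measurable_fun setT (xi : OF s -> R) ->
  P.-integrable setT (EFin \o (fun w => xi w ^+ 2)) ->
  P.-integrable setT (EFin \o (fun w => xi w * increment W s t w)) /\
  \int[P]_w (xi w * increment W s t w) = 0.
Proof.
move=> s0 st mxi ixi.
have mxi' := measurable_fun_filtration mxi.
have iW := increment_sqr_integrable s0 st.
have ixW : P.-integrable setT (EFin \o (fun w => xi w * increment W s t w)).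
  by apply: Rintegrable_mul_sqr => //; exact: mincr.
split => //.
apply: (Rintegral_orthogonal (@brownian_filtration_sigma_measurable s)) => //.
- by apply: Rintegrable_of_sqr => //; exact: mincr.
- by move=> A; rewrite brownian_filtrationK; exact: increment_mean.
Qed.

Lemma Rintegrable_bounded_mul xi (f : Omega -> R) K :
  measurable_fun setT xi -> (forall w, `|xi w| <= K) ->
  P.-integrable setT (EFin \o f) -> P.-integrable setT (EFin \o (fun w => xi w * f w)).
Proof.
move=> mxi xiK iF; have mf := Rintegrable_measurable iF.
apply: (Rintegrable_le (g := fun w => K * `|f w|)) => //.
- exact: measurable_funM.
- by move=> w _; rewrite normrM ler_wpM2r.
- by apply: RintegrableZl => //; have := integrable_norm iF.
Qed.

Lemma Rintegral_mul_increment_sqr s t xi K : 0 <= s -> s <= t ->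
  measurable_fun setT (xi : OF s -> R) -> (forall w, `|xi w| <= K) ->
  \int[P]_w (xi w * increment W s t w ^+ 2) = (t - s) * \int[P]_w xi w.
Proof.
move=> s0 st mxi xiK.
have mxi' := measurable_fun_filtration mxi.
have iW := increment_sqr_integrable s0 st.
have ic (r : R) D : measurable D -> P.-integrable D (EFin \o (fun _ : Omega => r)).
  by move=> mD; exact: finite_measure_integrable_cst.
have ixi : P.-integrable setT (EFin \o xi).
  have := Rintegrable_bounded_mul mxi' xiK (ic 1 _ measurableT).
  by apply: eq_integrable => // w _ /=; rewrite mulr1.
have ixW := Rintegrable_bounded_mul mxi' xiK iW.
apply/eqP; rewrite -subr_eq0 -RintegralZl// -RintegralB//; last exact: RintegrableZl.
apply/eqP; under eq_Rintegral do rewrite (mulrC (t - s)) -mulrBr.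
apply: (Rintegral_orthogonal (@brownian_filtration_sigma_measurable s)) => //.
- by apply: RintegrableB => //; exact: ic.
- move=> A; rewrite brownian_filtrationK => FA.
  have mA := brownian_filtration_measurable FA.
  rewrite RintegralB//; last exact: ic.
    by rewrite increment_var// Rintegral_cst// subrr.
  exact: integrableS iW.
- have := RintegrableB measurableT ixW (RintegrableZl (t - s) measurableT ixi).
  by apply: eq_integrable => // w _ /=; rewrite mulrBr (mulrC _ (t - s)).
Qed.

End brownian_increments.

(** * Ito integrals *)

Section prod_integral_domain.
Context {d1 d2} {T1 : measurableType d1} {T2 : measurableType d2} {R : realType}.
Variable m1 : {sigma_finite_measure set T1 -> \bar R}.
Variable m2 : {sigma_finite_measure set T2 -> \bar R}.
Variables (A : set T1) (B : set T2).
Hypotheses (mA : measurable A) (mB : measurable B).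

Let mAB : measurable (A `*` B). Proof. exact: measurableX. Qed.

Let patchE (f : T1 * T2 -> \bar R) x :
  (\int[m2]_y (f \_ (A `*` B)) (x, y) =
  ((fun x => \int[m2]_(y in B) f (x, y)) \_ A) x)%E.
Proof.
rewrite /patch; case: ifPn => [Ax|nAx].
  rewrite [RHS]integral_mkcond; apply: eq_integral => y _.
  by rewrite /patch in_setX/= Ax.
by rewrite integral0_eq// => y _; rewrite in_setX/= (negbTE nAx).
Qed.

Lemma tonelli_prod_domain (f : T1 * T2 -> \bar R) :
  measurable_fun (A `*` B) f -> (forall z, 0 <= f z)%E ->
  (\int[(m1 \x m2)%E]_(z in A `*` B) f z =
   \int[m1]_(x in A) \int[m2]_(y in B) f (x, y))%E.
Proof.
move=> mf f0; have mp : measurable_fun setT (f \_ (A `*` B)).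
  by apply/(measurable_restrictT _ mAB).
have p0 z : (0 <= (f \_ (A `*` B)) z)%E by rewrite /patch; case: ifP.
rewrite integral_mkcond fubini_tonelli1// [RHS]integral_mkcond.
by apply: eq_integral => x _; rewrite /fubini_F patchE.
Qed.

Lemma Rintegral_prod_domain (f : T1 * T2 -> R) :
  (m1 \x m2)%E.-integrable (A `*` B) (EFin \o f) ->
  \int[(m1 \x m2)%E]_(z in A `*` B) f z =
  \int[m1]_(x in A) \int[m2]_(y in B) f (x, y).
Proof.
move=> iF; rewrite /Rintegral integral_mkcond.
move: (iF); rewrite integrable_mkcond// => iFT.
rewrite -integral12_prod_meas1// integral_mkcond; congr fine.
apply: ae_eq_integral => //.
- exact: (measurable_fubini_F iFT).
- apply/(measurable_restrictT _ mA)/measurable_EFinP.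
  by apply: measurable_Rintegral_section => //; exact: Rintegrable_measurable iF.
apply: filterS (ae_integrable_section mA mB iF) => x ix _.
rewrite /fubini_F patchE /patch; case: ifPn => // /set_mem Ax.
exact: (Rintegral_EFin mB (ix Ax)).
Qed.

End prod_integral_domain.

(** * Limits of pairings in L2 *)

Section L2_convergence.
Context {d} {T : measurableType d} {R : realType}.
Variable mu : {measure set T -> \bar R}.
Variable D : set T.
Hypothesis mD : measurable D.

Definition sqr_integrable (f : T -> R) :=
  measurable_fun D f /\ mu.-integrable D (EFin \o (fun x => f x ^+ 2)).

Lemma sqr_integrableM f g : sqr_integrable f -> sqr_integrable g ->
  mu.-integrable D (EFin \o (fun x => f x * g x)).
Proof. by move=> [mf iF] [mg ig]; exact: Rintegrable_mul_sqr. Qed.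

Lemma sqr_integrableD f g : sqr_integrable f -> sqr_integrable g ->
  sqr_integrable (fun x => f x + g x).
Proof.
move=> [mf iF] [mg ig]; split; first exact: measurable_funD.
have := RintegrableZl 2 mD (RintegrableD mD iF ig).
apply: Rintegrable_le => //; first by apply: measurable_funX; exact: measurable_funD.
move=> x _; rewrite ger0_norm ?sqr_ge0//.
by have := sqr_ge0 (f x - g x); nra.
Qed.

Lemma sqr_integrableZ f (r : R) : sqr_integrable f ->
  sqr_integrable (fun x => r * f x).
Proof.
move=> [mf iF]; split; first exact: measurable_funM.
have := RintegrableZl (r ^+ 2) mD iF.
by apply: eq_integrable => // x _ /=; rewrite exprMn.
Qed.

Lemma sqr_integrableB f g : sqr_integrable f -> sqr_integrable g ->
  sqr_integrable (fun x => f x - g x).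
Proof.
move=> sf sg; have := sqr_integrableD sf (sqr_integrableZ (-1) sg).
by under eq_fun do rewrite mulN1r.
Qed.

Lemma sqr_integrable_sum (I : Type) (s : seq I) (h : I -> T -> R) :
  (forall i, sqr_integrable (h i)) ->
  sqr_integrable (fun x => \sum_(i <- s) h i x).
Proof.
move=> ih; elim: s => [|i s IH].
  under eq_fun do rewrite big_nil; split; first exact: measurable_cst.
  apply: (eq_integrable mD (cst 0%E)); last exact: integrable0.
  by move=> x _ /=; rewrite expr0n.
by under eq_fun do rewrite big_cons; exact: sqr_integrableD.
Qed.

(** Convergence to 0 in the extended reals forces some distance to be finite; [f] is then the sum of
    [f - g n] and [g n]. *)
Lemma sqr_integrable_of_dist (f : T -> R) (g : nat -> T -> R) :
  measurable_fun D f -> (forall n, sqr_integrable (g n)) ->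
  (fun n => \int[mu]_(x in D) ((f x - g n x) ^+ 2)%:E)%E @ \oo --> 0%E ->
  sqr_integrable f.
Proof.
move=> mf sg cg.
have [n fing] : exists n, (\int[mu]_(x in D) ((f x - g n x) ^+ 2)%:E < +oo)%E.
  have /fine_cvgP[[N _ /(_ N (leqnn N)) fN] _] := cg.
  by exists N; rewrite ltey_eq fN.
have sfg : sqr_integrable (fun x => f x - g n x).
  have mfg : measurable_fun D (fun x => f x - g n x).
    by apply: measurable_funB => //; case: (sg n).
  split => //; apply/ge0_Rintegrable => //; first exact: measurable_funX.
  by move=> x _; exact: sqr_ge0.
have := sqr_integrableD sfg (sg n).
by under eq_fun do rewrite subrK.
Qed.

(** Young's inequality with a free weight [e], which replaces Cauchy-Schwarz once [e] is adapted to
    the size of [f]. *)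
Let int_mul_le f g (e : R) : 0 < e -> sqr_integrable f -> sqr_integrable g ->
  `|\int[mu]_(x in D) (f x * g x)| <=
  e * \int[mu]_(x in D) (g x ^+ 2) + e^-1 * \int[mu]_(x in D) (f x ^+ 2).
Proof.
move=> e0 sf sg; have ifg := sqr_integrableM sf sg.
have [_ if2] := sf; have [_ ig2] := sg.
rewrite (le_trans (le_normr_Rintegral mD ifg))//.
rewrite -!RintegralZl// -RintegralD//; [|exact: RintegrableZl..].
apply: le_Rintegral => //.
- by have := integrable_norm ifg.
- by apply: RintegrableD => //; exact: RintegrableZl.
move=> x _; rewrite normrM -[g x ^+ 2]real_normK ?num_real//.
rewrite -[f x ^+ 2]real_normK ?num_real//.
rewrite -(ler_pM2l e0) mulrDr mulVKf ?gt_eqF// .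
have := sqr_ge0 (`|f x| - e * `|g x|).
have : 0 <= e * `|g x| * `|f x| by rewrite !mulr_ge0// ltW.
nra.
Qed.

(** The difference of the products is [(f - f_ n) * (g - g_ n)] minus two mixed terms, each with one
    factor small in L2. *)
Lemma L2_cvg_Rintegral (f_ g_ : nat -> T -> R) f g :
  (forall n, sqr_integrable (f_ n)) -> (forall n, sqr_integrable (g_ n)) ->
  sqr_integrable f -> sqr_integrable g ->
  (fun n => \int[mu]_(x in D) ((f x - f_ n x) ^+ 2)%:E)%E @ \oo --> 0%E ->
  (fun n => \int[mu]_(x in D) ((g x - g_ n x) ^+ 2)%:E)%E @ \oo --> 0%E ->
  (fun n => \int[mu]_(x in D) (f_ n x * g_ n x)) @ \oo -->
  \int[mu]_(x in D) (f x * g x).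
Proof.
move=> sf_ sg_ sf sg cf cg.
pose a n := \int[mu]_(x in D) ((f x - f_ n x) ^+ 2).
pose b n := \int[mu]_(x in D) ((g x - g_ n x) ^+ 2).
have sa n : sqr_integrable (fun x => f x - f_ n x) by exact: sqr_integrableB.
have sb n : sqr_integrable (fun x => g x - g_ n x) by exact: sqr_integrableB.
have a0 : a @ \oo --> (0 : R) by exact: (fine_cvg cf).
have b0 : b @ \oo --> (0 : R) by exact: (fine_cvg cg).
have a_ge0 n : 0 <= a n by apply: Rintegral_ge0 => x _; exact: sqr_ge0.
have b_ge0 n : 0 <= b n by apply: Rintegral_ge0 => x _; exact: sqr_ge0.
(* The weight for Young's inequality: of the order of the square root of [c n], so that [c n]
   divided by it still tends to 0, with [n.+1^-1] added to keep it positive where [c n] vanishes. *)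
pose u (c : nat -> R) n := Num.sqrt (c n) + n.+1%:R^-1.
have u0 c : c @ \oo --> (0 : R) -> u c @ \oo --> (0 : R).
  move=> c0; rewrite -[X in _ --> X]addr0; apply: cvgD; last exact: cvg_harmonic.
  by rewrite -(sqrtr0 R); apply: (cvg_comp _ _ c0); exact: sqrt_continuous.
have uP (c : nat -> R) n : 0 <= c n -> (u c n)^-1 * c n <= u c n.
  move=> c0; have up : 0 < u c n by rewrite /u ltr_wpDl// ?sqrtr_ge0// invr_gt0.
  rewrite ler_pdivrMl// -expr2 -{1}[c n]sqr_sqrtr// lerXn2r ?nnegrE ?sqrtr_ge0 ?(ltW up)//.
  by rewrite /u lerDl invr_ge0.
have up (c : nat -> R) n : 0 < u c n by rewrite /u ltr_wpDl// ?sqrtr_ge0// invr_gt0.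
pose G := \int[mu]_(x in D) (g x ^+ 2).
pose H := \int[mu]_(x in D) (f x ^+ 2).
pose e n := a n + b n + (u a n * G + u a n) + (u b n * H + u b n).
have e0 : e @ \oo --> (0 : R).
  have uM (c : nat -> R) k : c @ \oo --> (0 : R) -> (fun n => u c n * k + u c n) @ \oo --> (0 : R).
    move=> c0; rewrite -(addr0 0) -{1}(mul0r k).
    exact: (cvgD (cvgM (u0 _ c0) (cvg_cst k)) (u0 _ c0)).
  rewrite -(addr0 0) -{1}(addr0 0) -{1}(addr0 0).
  exact: (cvgD (cvgD (cvgD a0 b0) (uM a G a0)) (uM b H b0)).
apply: (@squeeze_cvgr _ _ _ _ (fun n => \int[mu]_(x in D) (f x * g x) - e n)
  (fun n => \int[mu]_(x in D) (f x * g x) + e n)).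
- apply: nearW => n.
  rewrite -ler_distlC distrC.
  have i1 := sqr_integrableM (sf_ n) (sg_ n).
  have i2 := sqr_integrableM sf sg.
  have i3 := sqr_integrableM (sa n) (sb n).
  have i4 := sqr_integrableM (sa n) sg.
  have i5 := sqr_integrableM (sb n) sf.
  have -> : \int[mu]_(x in D) (f_ n x * g_ n x) - \int[mu]_(x in D) (f x * g x) =
    \int[mu]_(x in D) ((f x - f_ n x) * (g x - g_ n x))
    - \int[mu]_(x in D) ((f x - f_ n x) * g x)
    - \int[mu]_(x in D) ((g x - g_ n x) * f x).
    rewrite -!RintegralB//; last exact: RintegrableB.
    by apply: eq_Rintegral => x _; ring.
  rewrite (le_trans (ler_normB _ _))// lerD//; last first.
    rewrite (le_trans (int_mul_le (up b n) (sb n) sf))// lerD//.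
    exact: uP.
  rewrite (le_trans (ler_normB _ _))// lerD//; last first.
    rewrite (le_trans (int_mul_le (up a n) (sa n) sg))// lerD//.
    exact: uP.
  rewrite (le_trans (int_mul_le ltr01 (sa n) (sb n)))//.
  by rewrite invr1 !mul1r addrC.
- by rewrite -[X in _ --> X]subr0; exact: (cvgB (cvg_cst _) e0).
- by rewrite -[X in _ --> X]addr0; exact: (cvgD (cvg_cst _) e0).
Qed.

End L2_convergence.

(** * Means of products of weighted increments *)

Section ito_isometry.
Context {R : realType} {d : measure_display} {Omega : measurableType d}.
Variables (P : probability Omega R) (W : R -> Omega -> R).
Hypothesis cP : measure_is_complete P.
Hypothesis bW : brownian_motion P W.
Notation F := (brownian_filtration P W).
Notation OF t := (g_sigma_algebraType (F t)).
Notation mu := (@lebesgue_measure R).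
Implicit Types (a b c e s t : R) (xi eta : Omega -> R).

Lemma sqr_integrable_bounded_mul D xi (f : Omega -> R) K : measurable D ->
  measurable_fun setT xi -> (forall w, `|xi w| <= K) ->
  sqr_integrable P D f -> sqr_integrable P D (fun w => xi w * f w).
Proof.
move=> mD mxi xiK [mf iF]; split.
  by apply: measurable_funM => //; exact: measurable_funTS.
apply: Rintegrable_le (RintegrableZl (K ^+ 2) mD iF) => //.
  by apply: measurable_funX; apply: measurable_funM => //; exact: measurable_funTS.
move=> w _; rewrite ger0_norm ?sqr_ge0// exprMn ler_wpM2r ?sqr_ge0//.
by rewrite -(real_normK (num_real (xi w))) lerXn2r ?nnegrE// (le_trans _ (xiK w)).
Qed.

Lemma sqr_integrable_increment s t : 0 <= s -> s <= t ->
  sqr_integrable P setT (increment W s t).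
Proof.
move=> s0 st; split; last exact: increment_sqr_integrable.
by apply: (@measurable_fun_filtration _ _ _ P W cP bW t); exact: measurable_increment.
Qed.

Let mul_increment0 s t u xi : 0 <= s -> s <= t -> t <= u ->
  measurable_fun setT (xi : OF t -> R) -> sqr_integrable P setT xi ->
  \int[P]_w (xi w * increment W t u w) = 0.
Proof.
move=> s0 st tu mxi [_ ixi].
by have [] := Rintegral_mul_increment cP bW (le_trans s0 st) tu mxi ixi.
Qed.

Let overlap a b c e : R := fine (mu (`]a, b] `&` `]c, e])).

Let overlapE a b c e : a <= c -> c <= e ->
  overlap a b c e = if b <= c then 0 else Num.min b e - c.
Proof.
move=> ac ce; rewrite /overlap.
have -> : `]a, b] `&` `]c, e] = `]c, (Num.min b e)]%classic :> set R.
  apply/seteqP; split => x /=; rewrite !in_itv/= le_min.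
    by move=> [/andP[_ ->] /andP[-> ->]].
  by move=> /andP[cx /andP[-> ->]]; rewrite cx (le_lt_trans ac).
rewrite lebesgue_measure_itv/= lte_fin lt_min.
case: leP => bc /=; first by [].
move: ce; rewrite le_eqVlt => /predU1P[<-|ce]; last by rewrite ce.
by rewrite ltxx /= (min_idPr (ltW bc)) subrr.
Qed.

(** If the intervals are disjoint, the increment over []c, e]] is orthogonal to everything else,
    which is known at time [c]. Otherwise the increments are cut at [c] and at [f = min b e], and
    only the square of the increment over []c, f]] contributes. *)
Let increment_prod_le a b c e xi eta K L : 0 <= a -> a <= b -> a <= c -> c <= e ->
  measurable_fun setT (xi : OF a -> R) -> (forall w, `|xi w| <= K) ->
  measurable_fun setT (eta : OF c -> R) -> (forall w, `|eta w| <= L) ->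
  \int[P]_w ((xi w * increment W a b w) * (eta w * increment W c e w)) =
  overlap a b c e * \int[P]_w (xi w * eta w).
Proof.
move=> a0 ab ac ce mxi xiK meta etaL; rewrite overlapE//.
have c0 := le_trans a0 ac.
have mxic : measurable_fun setT (xi : OF c -> R).
  exact: measurable_fun_filtration_mono mxi.
have mxi' := measurable_fun_filtration cP bW mxi.
have meta' := measurable_fun_filtration cP bW meta.
have Hmul u v : 0 <= u -> u <= v ->
    sqr_integrable P setT (fun w => xi w * (eta w * increment W u v w)).
  move=> u0 uv; apply: (sqr_integrable_bounded_mul (K := K)) => //.
  apply: (sqr_integrable_bounded_mul (K := L)) => //.
  exact: sqr_integrable_increment.
case: leP => bc.
  rewrite mul0r.
  under eq_Rintegral do rewrite mulrA -(mulrA (xi _)) [X in _ * X * _]mulrC.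
  apply: (@mul_increment0 0) => //.
  apply: measurable_funM => //; apply: measurable_funM => //.
    exact: measurable_increment.
  exact: Hmul.
pose f := Num.min b e.
have cf : c <= f by rewrite le_min (ltW bc).
have fb : f <= b by rewrite ge_min lexx.
have fe : f <= e by rewrite ge_min lexx orbT.
have f0 := le_trans c0 cf.
(* [f] is [b] or [e], so one of the two leftover increments is trivial. The other four products are
   [T1] against []c, e]], [T2] times the square over []c, f]], and [T3] against each leftover
   increment. *)
have bfe w : increment W f b w * increment W f e w = 0.
  by rewrite /f /increment minElt; case: ifP => _; rewrite subrr ?mul0r ?mulr0.
pose T1 w := xi w * (eta w * increment W a c w).
pose T2 w := xi w * eta w.
pose T3 w := xi w * (eta w * increment W c f w).
have sT1 : sqr_integrable P setT T1 by exact: Hmul.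
have sT3 : sqr_integrable P setT T3 by exact: Hmul.
have mT3 : measurable_fun setT (T3 : OF f -> R).
  apply: measurable_funM; first exact: measurable_fun_filtration_mono mxic.
  apply: measurable_funM; first exact: measurable_fun_filtration_mono meta.
  exact: measurable_increment.
have [i1 e1] : P.-integrable setT (EFin \o (fun w => T1 w * increment W c e w)) /\
    \int[P]_w (T1 w * increment W c e w) = 0.
  apply: Rintegral_mul_increment => //; last by case: sT1.
  do 2?[apply: measurable_funM => //]; exact: measurable_increment.
have [i3 e3] : P.-integrable setT (EFin \o (fun w => T3 w * increment W f e w)) /\
    \int[P]_w (T3 w * increment W f e w) = 0.
  by apply: Rintegral_mul_increment => //; case: sT3.
have [i4 e4] : P.-integrable setT (EFin \o (fun w => T3 w * increment W f b w)) /\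
    \int[P]_w (T3 w * increment W f b w) = 0.
  by apply: Rintegral_mul_increment => //; case: sT3.
have T2K w : `|T2 w| <= K * L.
  by rewrite normrM ler_pM.
have mT2 : measurable_fun setT (T2 : OF c -> R) by exact: measurable_funM.
have e2 := Rintegral_mul_increment_sqr cP bW c0 cf mT2 T2K.
have i2 : P.-integrable setT (EFin \o (fun w => T2 w * increment W c f w ^+ 2)).
  apply: (Rintegrable_bounded_mul _ T2K); first exact: measurable_funM.
  exact: increment_sqr_integrable.
rewrite -/f -e2 -[RHS]add0r -e1 -[RHS]addr0 -e3 -[RHS]addr0 -e4.
rewrite -!RintegralD//; do ?[exact: RintegrableD|apply: RintegrableD => //].
apply: eq_Rintegral => w _; rewrite /T1 /T2 /T3.
have := bfe w; rewrite /increment => h.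
rewrite -[LHS]subr0 -[X in _ - X](mulr0 (xi w * eta w)) -h; ring.
Qed.

Lemma Rintegral_increment_prod a b c e xi eta K L :
  0 <= a -> a <= b -> 0 <= c -> c <= e ->
  measurable_fun setT (xi : OF a -> R) -> (forall w, `|xi w| <= K) ->
  measurable_fun setT (eta : OF c -> R) -> (forall w, `|eta w| <= L) ->
  \int[P]_w ((xi w * increment W a b w) * (eta w * increment W c e w)) =
  fine (mu (`]a, b] `&` `]c, e])) * \int[P]_w (xi w * eta w).
Proof.
move=> a0 ab c0 ce mxi xiK meta etaL; have [ac|/ltW ca] := leP a c.
  exact: (increment_prod_le a0 ab ac ce mxi xiK meta etaL).
rewrite setIC; under eq_Rintegral do rewrite mulrC.
under [in RHS]eq_Rintegral do rewrite mulrC.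
exact: (increment_prod_le c0 ce ca ab meta etaL mxi xiK).
Qed.

End ito_isometry.

Section processes.
Context {R : realType} {d : measure_display} {Omega : measurableType d}.
Variable P : probability Omega R.
Notation mu := (@lebesgue_measure R).

Lemma measurable_fun_prod_sub_sigma {d1 d2} {S : measurableType d1}
    {U : measurableType d2} (G : set (set Omega)) (D : set (S * Omega))
    (f : S * Omega -> U) : <<s G >> `<=` measurable -> measurable D ->
  measurable (D : set (S * g_sigma_algebraType G)) ->
  @measurable_fun _ _ (S * g_sigma_algebraType G)%type U D f -> measurable_fun D f.
Proof.
move=> subG mD mDG mf.
apply: (@measurable_comp _ _ _ (S * Omega)%type (S * g_sigma_algebraType G)%type
  U D f D (fun z : S * Omega => z : S * g_sigma_algebraType G)) => //.
  by move=> _ [z Dz <-].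
apply: measurable_funTS.
apply: (proj2 (@measurable_fun_pairP _ _ _ (S * Omega)%type S
  (g_sigma_algebraType G) (fun z : S * Omega => z))).
split; first exact: measurable_fst.
by move=> _ A mA; apply: measurable_snd => //; exact: subG.
Qed.

Lemma dotvv_ge0 {n} (x : 'cV[R]_n) : 0 <= dotv x x.
Proof. by apply: sumr_ge0 => i _; rewrite -expr2 sqr_ge0. Qed.

Lemma sqr_le_dotv {n} (x : 'cV[R]_n) i : x i ord0 ^+ 2 <= dotv x x.
Proof.
rewrite /dotv (bigD1 i)//= -expr2 lerDl.
by apply: sumr_ge0 => j _; rewrite -expr2 sqr_ge0.
Qed.

Lemma measurable_dotv {d'} {S : measurableType d'} {n} (D : set S)
    (f g : S -> 'cV[R]_n) : mx_measurable D f -> mx_measurable D g ->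
  measurable_fun D (fun x => dotv (f x) (g x)).
Proof. by move=> mf mg; apply: measurable_sum => i; exact: measurable_funM. Qed.

Lemma sqr_integrable_component {d'} {S : measurableType d'} {n}
    (nu : {measure set S -> \bar R}) (D : set S) (f : S -> 'cV[R]_n) i :
  measurable D -> mx_measurable D f ->
  (\int[nu]_(x in D) (dotv (f x) (f x))%:E < +oo)%E ->
  sqr_integrable nu D (fun x => f x i ord0).
Proof.
move=> mD mf foo; have md := measurable_dotv mf mf.
split => //; have id : nu.-integrable D (EFin \o (fun x => dotv (f x) (f x))).
  by apply/ge0_Rintegrable => // x _; exact: dotvv_ge0.
apply: Rintegrable_le id => //; first exact: measurable_funX.
by move=> x _; rewrite ger0_norm ?sqr_ge0// sqr_le_dotv.
Qed.

Lemma L2_measurable {n} (G : set (set Omega)) a b (X : R -> Omega -> 'cV[R]_n) :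
  <<s G >> `<=` measurable -> L2 P G a b X ->
  mx_measurable (`[a, b] `*` setT) (fun p : measurableTypeR R * Omega => X p.1 p.2).
Proof.
move=> subG [mX _] i j.
apply: (measurable_fun_prod_sub_sigma subG) (mX i j); exact: measurableX.
Qed.

Lemma L2_sqr_integrable {n} (G : set (set Omega)) a b (X : R -> Omega -> 'cV[R]_n) i :
  <<s G >> `<=` measurable -> L2 P G a b X ->
  sqr_integrable (P \x mu)%E (setT `*` `[a, b])
    (fun p => X p.2 p.1 i ord0).
Proof.
move=> subG LX; have mX := L2_measurable subG LX.
have mA : measurable (`[a, b]%classic : set R) by exact: measurable_itv.
have mX' : mx_measurable (setT `*` `[a, b]) (fun p : Omega * R => X p.2 p.1).
  by move=> k j; have := measurable_fun_swap_domain mA measurableT (mX k j).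
apply: (@sqr_integrable_component _ _ _ (P \x mu)%E _ (fun p : Omega * R => X p.2 p.1)) => //.
  exact: measurableX.
rewrite (@tonelli_prod_domain _ _ _ _ _ P mu setT `[a, b]%classic measurableT mA
  (fun p : Omega * R => (dotv (X p.2 p.1) (X p.2 p.1))%:E)) //=.
- by case: LX.
- by apply/measurable_EFinP; exact: measurable_dotv.
- by move=> p; rewrite lee_fin dotvv_ge0.
Qed.

End processes.

(** * Isometry and orthogonality, from simple processes to Ito integrals *)

Section ito.
Context {R : realType} {d : measure_display} {Omega : measurableType d}.
Variables (P : probability Omega R) (W : R -> Omega -> R).
Hypothesis cP : measure_is_complete P.
Hypothesis bW : brownian_motion P W.
Notation F := (brownian_filtration P W).
Notation OF t := (g_sigma_algebraType (F t)).
Notation mu := (@lebesgue_measure R).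
Variables (n : nat) (a b : R).
Hypothesis a_ge0 : 0 <= a.
Implicit Types (H : simple_process F n a b).

Let sp_time_mono H i j : (i <= j)%N -> (j <= sp_size H)%N ->
  sp_time H i <= sp_time H j.
Proof.
elim: j => [|j IH]; first by rewrite leqn0 => /eqP ->.
rewrite leq_eqVlt => /predU1P[->//|]; rewrite ltnS => ij jH.
by rewrite (le_trans (IH ij (ltnW jH)))// sp_time_le.
Qed.

Let sp_time_ge H i : (i <= sp_size H)%N -> a <= sp_time H i.
Proof. by move=> iH; have := sp_time_mono (leq0n i) iH; rewrite sp_time0. Qed.

Let sp_time_leb H i : (i <= sp_size H)%N -> sp_time H i <= b.
Proof. by move=> iH; have := sp_time_mono iH (leqnn _); rewrite sp_timeN. Qed.

Let stepset H (k : nat) : set R := `]sp_time H k, sp_time H k.+1]%classic.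

Let sp_processE H t w i : sp_process H t w i ord0 =
  \sum_(k < sp_size H) \1_(stepset H k) t * sp_val H k w i ord0.
Proof. by rewrite /sp_process summxE; apply: eq_bigr => k _; rewrite !mxE. Qed.

Let sp_integralE H w i : sp_integral W H w i ord0 =
  \sum_(k < sp_size H) sp_val H k w i ord0 *
    increment W (sp_time H k) (sp_time H k.+1) w.
Proof.
by rewrite /sp_integral summxE; apply: eq_bigr => k _; rewrite !mxE mulrC.
Qed.

Let mval H (k : 'I_(sp_size H)) i :
  measurable_fun setT ((fun w => sp_val H k w i ord0) : OF (sp_time H k) -> R).
Proof. exact: (sp_val_measurable (ltn_ord k)). Qed.

Let mval' H (k : 'I_(sp_size H)) i :
  measurable_fun setT ((fun w => sp_val H k w i ord0) : Omega -> R).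
Proof. exact: (measurable_fun_filtration cP bW (@mval H k i)). Qed.

Let val_bounded H : exists K : R, forall (k : 'I_(sp_size H)) w i,
  `|sp_val H k w i ord0| <= K.
Proof. by have [K HK] := sp_val_bounded H; exists K => k w i; exact: HK. Qed.

Let sqr_integrable_val_increment H (k : 'I_(sp_size H)) i :
  sqr_integrable P setT (fun w => sp_val H k w i ord0 *
    increment W (sp_time H k) (sp_time H k.+1) w).
Proof.
have [K HK] := val_bounded H.
apply: (sqr_integrable_bounded_mul (K := K)) => //.
apply: sqr_integrable_increment => //.
  by rewrite (le_trans a_ge0)// sp_time_ge// ltnW.
by rewrite sp_time_le.
Qed.

Lemma sqr_integrable_sp_integral H i :
  sqr_integrable P setT (fun w => sp_integral W H w i ord0).
Proof.
under eq_fun do rewrite sp_integralE.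
by apply: sqr_integrable_sum => // k.
Qed.

Let mab : measurable (`[a, b]%classic : set (measurableTypeR R)). Proof. exact: measurable_itv. Qed.

Let sqr_integrable_bounded (f : Omega * R -> R) K :
  measurable_fun (setT `*` `[a, b]) f -> (forall z, `|f z| <= K) ->
  sqr_integrable (P \x mu)%E (setT `*` `[a, b]) f.
Proof.
move=> mf fK.
have mD : measurable (setT `*` `[a, b] : set (Omega * measurableTypeR R)) by exact: measurableX.
split => //; apply: measurable_bounded_integrable => //.
- apply: (@le_lt_trans _ _ (P setT * mu `[a, b])%E).
    rewrite le_eqVlt; apply/orP; left; apply/eqP.
    exact: (@product_measure1E _ _ _ _ R P mu setT `[a, b]%classic).
  by rewrite probability_setT mul1e /= lebesgue_measure_itv/=; case: ifP => // _; rewrite ltry.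
- exact: measurable_funX.
- exists (K ^+ 2); split; first exact: num_real.
  move=> x Kx z _ /=; rewrite ger0_norm ?sqr_ge0// (le_trans _ (ltW Kx))//.
  by rewrite -(real_normK (num_real (f z))) lerXn2r ?nnegrE// (le_trans _ (fK z)).
Qed.

Lemma measurable_sp_process H i : measurable_fun setT
  (fun p : Omega * R => sp_process H p.2 p.1 i ord0).
Proof.
under eq_fun do rewrite sp_processE.
apply: measurable_sum => k; apply: measurable_funM.
  by apply: measurableT_comp => //; apply: measurable_indic; exact: measurable_itv.
exact: (measurableT_comp (@mval' H k i)).
Qed.

Lemma sqr_integrable_sp_process H i : sqr_integrable (P \x mu)%E
  (setT `*` `[a, b]) (fun p => sp_process H p.2 p.1 i ord0).
Proof.
have [K HK] := val_bounded H.
apply: (@sqr_integrable_bounded _ (\sum_(k < sp_size H) K)).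
  by apply: measurable_funTS; exact: measurable_sp_process.
move=> z; rewrite sp_processE (le_trans (ler_norm_sum _ _ _))//.
apply: ler_sum => k _; rewrite normrM -[leRHS]mul1r ler_pM//.
by rewrite indicE; case: (_ \in _); rewrite ?normr1 ?normr0.
Qed.

Let Rintegral_step H1 H2 (k : 'I_(sp_size H1)) (l : 'I_(sp_size H2)) :
  mu.-integrable `[a, b] (EFin \o (fun t => \1_(stepset H1 k) t * \1_(stepset H2 l) t)) /\
  \int[mu]_(t in `[a, b]) (\1_(stepset H1 k) t * \1_(stepset H2 l) t) =
  fine (mu (stepset H1 k `&` stepset H2 l)).
Proof.
have mst : measurable (stepset H1 k `&` stepset H2 l).
  by apply: measurableI; exact: measurable_itv.
split.
  apply/ge0_Rintegrable => //.
    by apply: measurable_funM; apply: measurable_indic; exact: measurable_itv.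
  rewrite -[X in (\int[_]_(x in _) (X x)%:E)%E]indicI integral_indic//.
  apply: (@le_lt_trans _ _ (mu `[a, b])).
    by apply: le_measure => //; apply/mem_set => //; exact: measurableI.
  by rewrite /= lebesgue_measure_itv/=; case: ifP => // _; rewrite ltry.
have -> : (fun t => \1_(stepset H1 k) t * \1_(stepset H2 l) t) =
    \1_(stepset H1 k `&` stepset H2 l) :> (R -> R) by rewrite indicI.
rewrite /Rintegral integral_indic//; congr (fine (mu _)).
apply/setIidPl => t [+ _]; rewrite /stepset/= !in_itv/= => /andP[h1 h2].
have kn := ltn_ord k.
rewrite (le_trans (@sp_time_ge H1 k (ltnW kn)) (ltW h1))/=.
exact: le_trans h2 (@sp_time_leb H1 k.+1 kn).
Qed.

Lemma simple_isometry H1 H2 i :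
  \int[P]_w (sp_integral W H1 w i ord0 * sp_integral W H2 w i ord0) =
  \int[P]_w \int[mu]_(t in `[a, b])
    (sp_process H1 t w i ord0 * sp_process H2 t w i ord0).
Proof.
have [K1 HK1] := val_bounded H1.
have [K2 HK2] := val_bounded H2.
have ivv (k : 'I_(sp_size H1)) (l : 'I_(sp_size H2)) :
    P.-integrable setT (EFin \o (fun w => sp_val H1 k w i ord0 * sp_val H2 l w i ord0)).
  apply: (Rintegrable_bounded_mul _ (fun w => HK1 k w i)) => //.
  apply: (@eq_integrable _ _ _ _ _ measurableT
    (EFin \o (fun w => sp_val H2 l w i ord0 * 1))) => //.
    by move=> w _ /=; rewrite mulr1.
  apply: (Rintegrable_bounded_mul _ (fun w => HK2 l w i)) => //.
  exact: finite_measure_integrable_cst.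
transitivity (\sum_(k < sp_size H1) \sum_(l < sp_size H2)
    fine (mu (stepset H1 k `&` stepset H2 l)) *
    \int[P]_w (sp_val H1 k w i ord0 * sp_val H2 l w i ord0)).
  under eq_Rintegral do rewrite !sp_integralE mulr_suml.
  have iprod (k : 'I_(sp_size H1)) (l : 'I_(sp_size H2)) := sqr_integrableM measurableT
    (@sqr_integrable_val_increment H1 k i) (@sqr_integrable_val_increment H2 l i).
  rewrite Rintegral_sum//; last first.
    move=> k _; under eq_fun do rewrite mulr_sumr.
    by apply: Rintegrable_sum => // l _; exact: iprod.
  apply: eq_bigr => k _.
  under eq_Rintegral do rewrite mulr_sumr.
  rewrite Rintegral_sum//; apply: eq_bigr => l _.
  apply: (Rintegral_increment_prod cP bW _ _ _ _ _ (fun w => HK1 k w i) _ (fun w => HK2 l w i)).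
  - by rewrite (le_trans a_ge0)// sp_time_ge// ltnW.
  - by rewrite sp_time_le.
  - by rewrite (le_trans a_ge0)// sp_time_ge// ltnW.
  - by rewrite sp_time_le.
  - exact: mval.
  - exact: mval.
transitivity (\int[P]_w (\sum_(k < sp_size H1) \sum_(l < sp_size H2)
    fine (mu (stepset H1 k `&` stepset H2 l)) *
    (sp_val H1 k w i ord0 * sp_val H2 l w i ord0))).
  rewrite Rintegral_sum//; last first.
    by move=> k _; apply: Rintegrable_sum => // l _; exact: RintegrableZl.
  apply: eq_bigr => k _; rewrite Rintegral_sum//; last by move=> l _; exact: RintegrableZl.
  by apply: eq_bigr => l _; rewrite RintegralZl.
apply: eq_Rintegral => w _.
under eq_Rintegral => t _.
  rewrite !sp_processE mulr_suml.
  under eq_bigr => k _.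
    rewrite mulr_sumr.
    under eq_bigr => l _ do rewrite mulrACA mulrC.
    over.
  over.
have iint (k : 'I_(sp_size H1)) (l : 'I_(sp_size H2)) := (@Rintegral_step H1 H2 k l).1.
rewrite Rintegral_sum//; last first.
  by move=> k _; apply: Rintegrable_sum => // l _; exact: RintegrableZl.
apply: eq_bigr => k _; rewrite Rintegral_sum//; last by move=> l _; exact: RintegrableZl.
apply: eq_bigr => l _; rewrite RintegralZl// (@Rintegral_step H1 H2 k l).2.
by rewrite mulrC.
Qed.

Let cvg_component {d'} {S : measurableType d'} (nu : {measure set S -> \bar R})
    (D : set S) (f : S -> 'cV[R]_n) (g : nat -> S -> 'cV[R]_n) i :
  measurable D -> mx_measurable D f -> (forall k, mx_measurable D (g k)) ->
  (fun k => \int[nu]_(x in D) (dotv (f x - g k x) (f x - g k x))%:E)%E @ \oo --> 0%E ->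
  (fun k => \int[nu]_(x in D) ((f x i ord0 - g k x i ord0) ^+ 2)%:E)%E @ \oo --> 0%E.
Proof.
move=> mD mf mg cfg.
have mfg k : mx_measurable D (fun x => f x - g k x).
  move=> p q; apply: (eq_measurable_fun (fun x => f x p q - g k x p q)).
    by move=> x _; rewrite !mxE.
  by apply: measurable_funB; [exact: mf|exact: mg].
apply: (squeeze_cvge _ (cvg_cst _) cfg); apply: nearW => k.
rewrite integral_ge0/=; last by move=> x _; rewrite lee_fin sqr_ge0.
apply: ge0_le_integral => //.
- by move=> x _; rewrite lee_fin sqr_ge0.
- apply/measurable_EFinP; apply: measurable_funX.
  by apply: measurable_funB; [exact: mf|exact: mg].
- by apply/measurable_EFinP; exact: measurable_dotv.
- move=> x _; rewrite lee_fin; apply: le_trans (sqr_le_dotv _ i).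
  by rewrite !mxE.
Qed.

(** One component of an Ito integral, with the iterated integral over samples and times turned into
    an integral over their product: this is the form to which [L2_cvg_Rintegral] applies. *)
Variant ito_approx (z : R -> Omega -> 'cV[R]_n) (I : Omega -> 'cV[R]_n) i : Prop :=
  ItoApprox (H : nat -> simple_process F n a b) of
  sqr_integrable (P \x mu)%E (setT `*` `[a, b]) (fun p => z p.2 p.1 i ord0) &
  sqr_integrable P setT (fun w => I w i ord0) &
  (fun k => \int[(P \x mu)%E]_(p in setT `*` `[a, b])
    ((z p.2 p.1 i ord0 - sp_process (H k) p.2 p.1 i ord0) ^+ 2)%:E)%E @ \oo --> 0%E &
  (fun k => \int[P]_w
    ((I w i ord0 - sp_integral W (H k) w i ord0) ^+ 2)%:E)%E @ \oo --> 0%E.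

Lemma ito_approxP z I i : is_ito_integral P F W a b z I -> ito_approx z I i.
Proof.
move=> [Lz _ mI [H [cz cI]]].
have subm : <<s @measurable _ Omega >> `<=` measurable.
  by apply: smallest_sub => //; exact: sigma_algebra_measurable.
have mJ k : mx_measurable setT (fun w => sp_integral W (H k) w).
  by move=> p q; rewrite (ord1 q); have [] := sqr_integrable_sp_integral (H k) p.
have cI' := cvg_component i measurableT mI mJ cI.
have mD : measurable (setT `*` `[a, b] : set (Omega * measurableTypeR R)) by exact: measurableX.
have mz : mx_measurable (setT `*` `[a, b]) (fun p : Omega * R => z p.2 p.1).
  by move=> k j; have := measurable_fun_swap_domain mab measurableT (L2_measurable subm Lz k j).
have mH k : mx_measurable (setT `*` `[a, b]) (fun p : Omega * R => sp_process (H k) p.2 p.1).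
  by move=> p q; rewrite (ord1 q); apply: measurable_funTS; exact: measurable_sp_process.
apply: (@ItoApprox _ _ _ H) => //.
- exact: L2_sqr_integrable Lz.
- apply: sqr_integrable_of_dist cI' => //.
  by move=> k; exact: sqr_integrable_sp_integral.
- apply: (@cvg_component _ _ (P \x mu)%E _ (fun p : Omega * R => z p.2 p.1)
    (fun k p => sp_process (H k) p.2 p.1)) => //.
  rewrite [X in X @ _ --> _](_ : _ = (fun k => \int[P]_w \int[mu]_(t in `[a, b])
       (dotv (z t w - sp_process (H k) t w)
             (z t w - sp_process (H k) t w))%:E)%E)//.
  apply/funext => k.
  rewrite (@tonelli_prod_domain _ _ _ _ _ P mu setT `[a, b]%classic measurableT mab
    (fun p : Omega * R => (dotv (z p.2 p.1 - sp_process (H k) p.2 p.1)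
      (z p.2 p.1 - sp_process (H k) p.2 p.1))%:E)) //=.
  + apply/measurable_EFinP; apply: measurable_dotv => p q.
      apply: (eq_measurable_fun (fun x : Omega * R => z x.2 x.1 p q - sp_process (H k) x.2 x.1 p q)).
        by move=> x _; rewrite !mxE.
      by apply: measurable_funB; [exact: mz|exact: mH].
    apply: (eq_measurable_fun (fun x : Omega * R => z x.2 x.1 p q - sp_process (H k) x.2 x.1 p q)).
      by move=> x _; rewrite !mxE.
    by apply: measurable_funB; [exact: mz|exact: mH].
  + by move=> p; rewrite lee_fin dotvv_ge0.
Qed.

(** The isometry of simple processes is already bilinear, so both pairings pass to the limit
    directly, without polarisation. *)
Lemma ito_isometry (z1 z2 : R -> Omega -> 'cV[R]_n) (I1 I2 : Omega -> 'cV[R]_n) (i : 'I_n) :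
  is_ito_integral P F W a b z1 I1 -> is_ito_integral P F W a b z2 I2 ->
  \int[P]_w (I1 w i ord0 * I2 w i ord0) =
  \int[P]_w \int[mu]_(t in `[a, b]) (z1 t w i ord0 * z2 t w i ord0).
Proof.
move=> /(@ito_approxP _ _ i)[H1 sz1 sI1 cz1 cI1].
move=> /(@ito_approxP _ _ i)[H2 sz2 sI2 cz2 cI2].
have mD : measurable (setT `*` `[a, b] : set (Omega * measurableTypeR R)) by exact: measurableX.
have cI := L2_cvg_Rintegral measurableT
  (fun k => sqr_integrable_sp_integral (H1 k) i)
  (fun k => sqr_integrable_sp_integral (H2 k) i) sI1 sI2 cI1 cI2.
have cz := L2_cvg_Rintegral mD
  (fun k => sqr_integrable_sp_process (H1 k) i)
  (fun k => sqr_integrable_sp_process (H2 k) i) sz1 sz2 cz1 cz2.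
rewrite -(Rintegral_prod_domain measurableT mab (sqr_integrableM mD sz1 sz2)).
rewrite -(cvg_lim _ cI)// -(cvg_lim _ cz)//.
rewrite (_ : (fun k => \int[P]_w _) = (fun k => \int[(P \x mu)%E]_(p in setT `*` `[a, b])
    (sp_process (H1 k) p.2 p.1 i ord0 * sp_process (H2 k) p.2 p.1 i ord0)))//.
apply/funext => k; rewrite simple_isometry.
have := sqr_integrableM mD (sqr_integrable_sp_process (H1 k) i)
  (sqr_integrable_sp_process (H2 k) i).
by move=> /(Rintegral_prod_domain measurableT mab) ->.
Qed.

(** In each step of a simple process, [xi] times the value is known at the start of the step and
    multiplies a later increment, hence mean 0. In the passage to the limit [xi] is approximated by
    the constant sequence. *)
Lemma ito_orthogonal (z : R -> Omega -> 'cV[R]_n) (I : Omega -> 'cV[R]_n) (i : 'I_n)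
    (xi : Omega -> R) :
  is_ito_integral P F W a b z I ->
  measurable_fun setT (xi : OF a -> R) -> sqr_integrable P setT xi ->
  \int[P]_w (xi w * I w i ord0) = 0.
Proof.
move=> /(@ito_approxP _ _ i)[H _ sI _ cI] mxi sxi.
have cxi : (fun k : nat => \int[P]_w ((xi w - xi w) ^+ 2)%:E)%E @ \oo --> 0%E.
  rewrite (_ : (fun _ => _) = cst 0%E); first exact: cvg_cst.
  apply/funext => k; rewrite integral0_eq// => w _.
  by rewrite subrr expr0n.
have := L2_cvg_Rintegral measurableT (fun k => sxi)
  (fun k => sqr_integrable_sp_integral (H k) i) sxi sI cxi cI.
move=> c; rewrite -(cvg_lim _ c)//.
rewrite (_ : (fun _ => _) = cst 0) ?lim_cst//.
apply/funext => k.
under eq_Rintegral do rewrite sp_integralE mulr_sumr.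
have [K HK] := val_bounded (H k).
have key (l : 'I_(sp_size (H k))) :
    P.-integrable setT (EFin \o (fun w => xi w * (sp_val (H k) l w i ord0 *
      increment W (sp_time (H k) l) (sp_time (H k) l.+1) w))) /\
    \int[P]_w (xi w * (sp_val (H k) l w i ord0 *
      increment W (sp_time (H k) l) (sp_time (H k) l.+1) w)) = 0.
  split; first exact: (sqr_integrableM measurableT sxi (@sqr_integrable_val_increment (H k) l i)).
  under eq_Rintegral do rewrite mulrA.
  apply: (Rintegral_mul_increment cP bW _ _ _ _).2.
  - by rewrite (le_trans a_ge0)// sp_time_ge// ltnW.
  - by rewrite sp_time_le.
  - apply: measurable_funM => //; apply: (measurable_fun_filtration_mono _ mxi).
    by rewrite sp_time_ge// ltnW.
  - have [_] := sqr_integrable_bounded_mul measurableT (@mval' (H k) l i) (fun w => HK l w i) sxi.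
    by apply: eq_integrable => // w _ /=; rewrite mulrC.
rewrite Rintegral_sum//; last by move=> l _; exact: (key l).1.
by rewrite big1// => l _; exact: (key l).2.
Qed.

End ito.

(** * The completed product space *)

Section completed_product.
Context {R : realType} {d : measure_display} {Omega : measurableType d}.
Variable P : probability Omega R.
Notation Q := (PxP P).

Let Q_fin A : measurable A -> (Q A <= 1)%E.
Proof.
move=> mA; have h : (Q setT = 1)%E.
  have := @product_measure1E _ _ Omega Omega R P P setT setT measurableT measurableT.
  rewrite setXTT => h; rewrite -[RHS](mule1 1%E) -[X in (X * _)%E](probability_setT P).
  by rewrite -[X in (_ * X)%E](probability_setT P).
by rewrite -h; apply: le_measure => //; exact/mem_set.
Qed.

(** Countable covers of [X] exceeding its outer measure by at most [k.+1^-1] are intersected over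
    [k]; they exist because the outer measure is finite. *)
Lemma PxP_hull (X : set (Omega * Omega)) : exists A : set (Omega * Omega),
  [/\ measurable A, X `<=` A & Q A = (Q^*)%mu X].
Proof.
have fX : (Q^*)%mu X \is a fin_num.
  rewrite ge0_fin_numE ?mu_ext_ge0//.
  apply: (@le_lt_trans _ _ ((Q^*)%mu setT)); first exact: le_mu_ext.
  by rewrite measurable_mu_extE// (le_lt_trans (Q_fin measurableT))// ltry.
have cov k : exists B : set (Omega * Omega),
    [/\ measurable B, X `<=` B & (Q B <= (Q^*)%mu X + (k.+1%:R^-1)%:E)%E].
  have := lb_ereal_inf_adherent (e := k.+1%:R^-1) _ fX.
  rewrite invr_gt0 ltr0n => /(_ isT)[_ [G [mG XG] <-] hG].
  exists (\bigcup_j G j); split => //; first exact: bigcupT_measurable.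
  rewrite (le_trans _ (ltW hG))//.
  by apply: measure_sigma_subadditive => //; exact: bigcupT_measurable.
have [B HB] := choice cov.
exists (\bigcap_k B k); split.
- by apply: bigcapT_measurable => k; have [] := HB k.
- by move=> x Xx k _; have [_ /(_ _ Xx)] := HB k.
have mB : measurable (\bigcap_k B k) by apply: bigcapT_measurable => k; have [] := HB k.
apply/eqP; rewrite eq_le; apply/andP; split.
  apply/lee_addgt0Pr => e e0.
  have [k ke] : exists k, k.+1%:R^-1 <= e.
    exists (Num.truncn e^-1); rewrite -[leRHS]invrK lef_pV2 ?posrE ?invr_gt0//.
    exact/ltW/truncnS_gt.
  have [mBk _ Bk] := HB k.
  apply: (@le_trans _ _ (Q (B k))).
    by apply: le_measure; [exact/mem_set|exact/mem_set|exact: bigcap_inf].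
  by rewrite (le_trans Bk)// leeD2l// lee_fin.
rewrite -(measurable_mu_extE _ mB); apply: le_mu_ext => x Xx k _.
by have [_ /(_ _ Xx)] := HB k.
Qed.

(** Cutting a hull [A] of [C] by the Caratheodory set [C] shows, by finiteness, that [A] minus [C]
    has outer measure 0. Off a hull [N] of this difference, [C] and [A] coincide. *)
Let caratheodory_version (C : set (Omega2 P)) : measurable C ->
  exists N : set (Omega * Omega),
    [/\ measurable N, Q N = 0%E & measurable (C `&` ~` N : set (Omega * Omega))].
Proof.
move=> mC; have [A [mA CA QA]] := PxP_hull C.
have [N [mN AN QN]] := PxP_hull (A `\` C).
have Q0 : ((Q^*)%mu (A `\` C) = 0)%E.
  have h : (Q A = (Q^*)%mu C + (Q^*)%mu (A `\` C))%E.
    by rewrite -[LHS](measurable_mu_extE _ mA) [LHS](mC A) (setIidr CA) -setDE.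
  rewrite QA in h.
  have f : (Q^*)%mu C \is a fin_num.
    by rewrite -QA ge0_fin_numE// (le_lt_trans (Q_fin mA))// ltry.
  by rewrite -(addeK ((Q^*)%mu (A `\` C)) f) [X in (X - _)%E]addeC -h subee.
exists N; split => //; first by rewrite QN.
have -> : C `&` ~` N = A `&` ~` N.
  apply/seteqP; split => x [h nN]; split => //; first exact: CA.
  by apply: contrapT => nC; apply: nN; exact: AN.
by apply: measurableI => //; exact: measurableC.
Qed.

Section version.
Context {d' : measure_display} {S : measurableType d'}.

(** The null set is the same for every point of [S], which later lets it serve all times at once.
    The sets with this property form a sigma-algebra, a countable union using the union of the null
    sets, and rectangles reduce to the preceding lemma. *)
Let set_version (E : set (S * Omega2 P)) : measurable E ->
  exists N : set (Omega * Omega),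
    [/\ measurable N, Q N = 0%E &
        measurable (E `&` (setT `*` ~` N) : set (S * (Omega * Omega)))].
Proof.
rewrite measurable_prod_measurableType.
pose K (E : set (S * (Omega * Omega))) := exists N : set (Omega * Omega),
    [/\ measurable N, Q N = 0%E & measurable (E `&` (setT `*` ~` N))].
suff : <<s [set A `*` B | A in @measurable _ S & B in @measurable _ (Omega2 P)] >> `<=` K.
  by apply.
have mX (N : set (Omega * Omega)) : measurable N ->
    measurable (setT `*` ~` N : set (S * (Omega * Omega))).
  by move=> mN; apply: measurableX => //; exact: measurableC.
apply: smallest_sub; first split.
- by exists set0; split => //; rewrite set0I.
- move=> A [N [mN QN mAN]]; exists N; split => //.
  rewrite (_ : _ `&` _ = (setT `*` ~` N) `\` (A `&` (setT `*` ~` N))).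
    by apply: measurableD => //; exact: mX.
  apply/seteqP; split=> x.
    by move=> [[_ nA] xN]; split => // -[].
  by move=> [xN nAx]; split => //; split => // Ax; apply: nAx.
- move=> A HA; have [N HN] := choice HA.
  exists (\bigcup_k N k); split.
  + by apply: bigcupT_measurable => k; have [] := HN k.
  + apply/(@negligibleP _ _ _ Q); first by apply: bigcupT_measurable => k; have [] := HN k.
    apply: negligible_bigcup => k; have [mNk QNk _] := HN k.
    exact/negligibleP.
  + rewrite (_ : _ `&` _ = (\bigcup_k (A k `&` (setT `*` ~` N k))) `&`
        (setT `*` ~` (\bigcup_k N k))).
      apply: measurableI; last first.
        by apply: mX; apply: bigcupT_measurable => k; have [] := HN k.
      by apply: bigcupT_measurable => k; have [] := HN k.
    apply/seteqP; split=> x.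
      move=> [[k _ Akx] [_ nN]]; split => //; exists k => //; split => //.
      by split => // Nk; apply: nN; exists k.
    by move=> [[k _ [Akx _]] xN]; split => //; exists k.
- move=> _ [A mA [B mB <-]]; have [N [mN QN mBN]] := caratheodory_version mB.
  exists N; split => //.
  rewrite (_ : _ `&` _ = A `*` (B `&` ~` N)); first exact: measurableX.
  by apply/seteqP; split=> x; [move=> [[? ?] [_ ?]]|move=> [? [? ?]]].
Qed.

Lemma Omega2_version (D0 : set S) (f : S * Omega2 P -> R) : measurable D0 ->
  measurable_fun (D0 `*` setT) f ->
  exists (f0 : S * (Omega * Omega) -> R) (N : set (Omega * Omega)),
    [/\ measurable N, Q N = 0%E, measurable_fun (D0 `*` setT) f0,
        forall z, `|f0 z| <= `|f z| &
        forall s w, ~ N w -> f0 (s, w) = f (s, w)].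
Proof.
move=> mD0 mf.
(* Rational levels keep the exceptional null sets countable in number and suffice to recover every
   superlevel set of [f] off [N]. *)
pose E (q : rat) : set (S * Omega2 P) := (D0 `*` setT) `&` f @^-1` `]ratr q, +oo[.
have mD2 : measurable (D0 `*` setT : set (S * Omega2 P)) by exact: measurableX.
have mE q : measurable (E q) by apply: mf => //; exact: measurable_itv.
have [N0 HN] := choice (fun q => set_version (mE q)).
pose N := \bigcup_q N0 q.
have mN : measurable N.
  by apply: bigcupT_measurable_rat => q; have [] := HN q.
have QN : Q N = 0%E.
  apply/(@negligibleP _ _ _ Q) => //.
  (* The union over the rationals is rewritten over the naturals, with the empty set at numbers that
     encode no rational. *)
  have -> : N = \bigcup_k (if choice.unpickle k is Some q then N0 (q : rat) else set0).
    apply/seteqP; split => x.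
      by move=> [q _ Nqx]; exists (choice.pickle q); [exact: I|rewrite choice.pickleK; exact: Nqx].
    by move=> [k _]; case: choice.unpickle => // q Nqx; exists q.
  apply: negligible_bigcup => k; case: choice.unpickle => [q|]; last exact: negligible_set0.
  by have [mNq QNq _] := HN q; exact/negligibleP.
have mDN : measurable (D0 `*` ~` N : set (S * (Omega * Omega))).
  by apply: measurableX => //; exact: measurableC.
have mfN : measurable_fun (D0 `*` ~` N : set (S * (Omega * Omega))) f.
  apply: (measurability _ (RGenOInfty.measurableE R)) => // _ [_ [x ->] <-].
  rewrite (_ : _ `&` _ = (\bigcup_(q in [set q : rat | x < ratr q])
      (E q `&` (setT `*` ~` N0 q))) `&` (setT `*` ~` N)).
    apply: measurableI; last by apply: measurableX => //; exact: measurableC.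
    rewrite bigcup_mkcond; apply: bigcupT_measurable_rat => q.
    by case: ifP => // _; have [] := HN q.
  apply/seteqP; split => -[s w].
    move=> [[D0s /= nN]]; rewrite in_itv/= andbT => xf.
    have [q] := rat_in_itvoo xf; rewrite in_itv/= => /andP[xq qf].
    split => //; exists q => //; split.
      by split => //=; rewrite in_itv/= qf.
    by split => // Nq; apply: nN; exists q.
  move=> [[q /= xq [[[D0s _] /=]]]]; rewrite in_itv/= andbT => qf _ [_ /= nN].
  by split => //=; rewrite in_itv/= andbT (lt_trans xq).
(* The value 0 on the null set keeps the bounds of [f] valid everywhere. *)
pose f0 : S * (Omega * Omega) -> R := f \_ (setT `*` ~` N).
exists f0, N; split => //.
- apply/(measurable_restrict (E := D0 `*` setT)) => //.
  + by apply: measurableX => //; exact: measurableC.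
  + exact: measurableX.
  + by rewrite -setXI setIT setTI.
- by move=> z; rewrite /f0 /patch; case: ifP => // _; rewrite normr0.
- by move=> s w nN; rewrite /f0 /patch mem_set.
Qed.

End version.

End completed_product.

Section complete_probability.
Context {R : realType} {d : measure_display} {Omega : measurableType d}.
Variable P : probability Omega R.
Hypothesis cP : measure_is_complete P.

Lemma ae_complete_measurable (f g : Omega -> R) : measurable_fun setT g ->
  {ae P, forall w, f w = g w} -> measurable_fun setT f.
Proof.
move=> mg fg; apply/measurable_EFinP.
apply: (@ae_measurable_fun _ _ _ P cP setT (EFin \o g)); last exact/measurable_EFinP.
by apply: filterS fg => w fg _ /=; rewrite fg.
Qed.

(** The measurability of [f] is a conclusion here: [f] will be built on kernels that are measurable
    for the completed product, and [g] on their versions. *)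
Lemma ae_complete_Rintegral (f g : Omega -> R) : measurable_fun setT g ->
  {ae P, forall w, f w = g w} -> \int[P]_w f w = \int[P]_w g w.
Proof.
move=> mg fg; apply: ae_eq_Rintegral => //; first exact: ae_complete_measurable fg.
by apply: filterS fg.
Qed.

End complete_probability.

(** * Null sets of a product and their sections *)

Section product_null_section.
Context {d1 d2} {T1 : measurableType d1} {T2 : measurableType d2} {R : realType}.
Variable m1 : {sigma_finite_measure set T1 -> \bar R}.
Variable m2 : {sigma_finite_measure set T2 -> \bar R}.

Let ae_eq0_integral {d} {T : measurableType d} (m : {measure set T -> \bar R})
    (f : T -> \bar R) : measurable_fun setT f ->
  (forall w, 0 <= f w)%E -> (\int[m]_w f w = 0)%E -> {ae m, forall w, f w = 0%E}.
Proof.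
move=> mf f0 If.
have : (\int[m]_w `|f w| = 0)%E.
  by rewrite -[RHS]If; apply: eq_integral => w _; rewrite gee0_abs.
by move=> /(ae_eq_integral_abs m measurableT mf); apply: filterS => w /(_ I).
Qed.

Lemma ae_section_null (N : set (T1 * T2)) :
  measurable N -> (m1 \x m2)%E N = 0%E ->
  {ae m1, forall x, {ae m2, forall y, ~ N (x, y)}} /\
  {ae m2, forall y, {ae m1, forall x, ~ N (x, y)}}.
Proof.
move=> mN QN.
pose f z : \bar R := (\1_N z : R)%:E.
have mf : measurable_fun setT f.
  by apply/measurable_EFinP; exact: measurable_indic.
have f0 z : (0 <= f z)%E by rewrite lee_fin.
have I0 : (\int[(m1 \x m2)%E]_z f z = 0)%E by rewrite integral_indic// setIT.
have fN z : f z = 0%E -> ~ N z.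
  by move=> + Nz; rewrite /f indicE mem_set// => -[] /eqP; rewrite oner_eq0.
split.
- have : {ae m1, forall x, (\int[m2]_y f (x, y) = 0)%E}.
    apply: ae_eq0_integral.
    + exact: (@measurable_fun_fubini_tonelli_F _ _ _ _ _ m2 f mf f0).
    + by move=> w; exact: integral_ge0.
    + by rewrite -I0 fubini_tonelli1.
  apply: filterS => x /ae_eq0_integral h.
  have : {ae m2, forall y, f (x, y) = 0%E}.
    by apply: h => //; exact: measurableT_comp.
  by apply: filterS => y /fN.
- have : {ae m2, forall y, (\int[m1]_x f (x, y) = 0)%E}.
    apply: ae_eq0_integral.
    + exact: (@measurable_fun_fubini_tonelli_G _ _ _ _ _ m1 f mf f0).
    + by move=> w; exact: integral_ge0.
    + by rewrite -I0 fubini_tonelli2.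
  apply: filterS => y /ae_eq0_integral h.
  have : {ae m1, forall x, f (x, y) = 0%E}.
    by apply: h => //; exact: measurableT_comp.
  by apply: filterS => x /fN.
Qed.

Lemma ae_prod_fst (p : T1 -> Prop) :
  {ae m1, forall x, p x} -> {ae (m1 \x m2)%E, forall z, p z.1}.
Proof.
move=> [N [mN N0 pN]]; exists (N `*` setT); split.
- exact: measurableX.
- transitivity (m1 N * m2 setT)%E; last by rewrite N0 mul0e.
  exact: product_measure1E.
- by move=> [x y] /= np; split => //; apply: pN.
Qed.

Lemma ae_prod_snd (p : T2 -> Prop) :
  {ae m2, forall y, p y} -> {ae (m1 \x m2)%E, forall z, p z.2}.
Proof.
move=> [N [mN N0 pN]]; exists (setT `*` N); split.
- exact: measurableX.
- transitivity (m1 setT * m2 N)%E; last by rewrite N0 mule0.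
  exact: product_measure1E.
- by move=> [x y] /= np; split => //; apply: pN.
Qed.

Lemma ae_prod_sections (p : T1 * T2 -> Prop) : {ae (m1 \x m2)%E, forall z, p z} ->
  {ae m1, forall x, {ae m2, forall y, p (x, y)}} /\
  {ae m2, forall y, {ae m1, forall x, p (x, y)}}.
Proof.
move=> [N [mN N0 pN]]; have [h1 h2] := ae_section_null mN N0.
have pE z : ~ N z -> p z by move=> nN; apply: contrapT => np; apply/nN/pN.
split; [move: h1; apply: filterS => x|move: h2; apply: filterS => y].
  by apply: filterS => y /pE.
by apply: filterS => x /pE.
Qed.

Lemma integrable_comp_fst (A : set T1) (B : set T2) (f : T1 -> R) :
  measurable A -> measurable B -> (m2 B < +oo)%E ->
  m1.-integrable A (EFin \o f) ->
  (m1 \x m2)%E.-integrable (A `*` B) (EFin \o (fun z => f z.1)).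
Proof.
move=> mA mB B0 iF; have mf := Rintegrable_measurable iF.
have mf1 : measurable_fun (A `*` B) (fun z : T1 * T2 => f z.1).
  apply: (measurable_comp (F := A)) => //.
    by move=> _ [[x y] [/= Ax _] <-].
  exact: measurable_funTS.
apply/(integrable_domainP m1 m2 mA mB mf1) => /=.
under eq_integral do rewrite integral_cst//.
rewrite ge0_integralZr//=.
- apply: lte_mul_pinfty => //; first exact: integral_ge0.
  rewrite ge0_fin_numE//; last exact: integral_ge0.
  by have /integrableP[] := iF.
- by apply/measurable_EFinP; exact: measurableT_comp.
Qed.

End product_null_section.

Section product_null_sets.
Context {R : realType} {d : measure_display} {Omega : measurableType d}.
Variable P : probability Omega R.
Notation Q := (PxP P).

Lemma PxP_section_null (N : set (Omega * Omega)) : measurable N -> Q N = 0%E ->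
  {ae P, forall w, {ae P, forall w', ~ N (w, w')}} /\
  {ae P, forall w', {ae P, forall w, ~ N (w, w')}}.
Proof. by rewrite /PxP => mN QN; exact: (@ae_section_null _ _ _ _ _ P P N mN QN). Qed.

Lemma P2_null (N : set (Omega * Omega)) : measurable N -> Q N = 0%E ->
  {ae P2 P, forall z, ~ N z}.
Proof.
move=> mN QN; exists N; split.
- exact: caratheodory_measurable_mu_ext.
- exact: (etrans (measurable_mu_extE Q mN) QN).
- by move=> z /= nn; exact: contrapT.
Qed.

(** The exceptional set is merely Caratheodory measurable; its hull is a null set of the plain
    product, to whose sections Tonelli applies. *)
Lemma P2_null_ae (p : Omega * Omega -> Prop) : {ae P2 P, forall z, p z} ->
  exists N : set (Omega * Omega), [/\ measurable N, Q N = 0%E &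
    forall z, ~ N z -> p z].
Proof.
move=> [C [mC C0 pC]].
have [N [mN CN QN]] := @PxP_hull _ _ _ P C.
exists N; split => //; first by rewrite QN.
by move=> z nN; apply: contrapT => np; apply/nN/CN/pC.
Qed.

End product_null_sets.

(** * Integrals against the completed product measure *)

Section P2_integral.
Context {R : realType} {d : measure_display} {Omega : measurableType d}.
Variable P : probability Omega R.
Notation Q := (PxP P).

(** The identity, seen as a map from the completed space to the product space: [Q] is the image of
    [P2 P] under it, so integrals are transferred by change of variables. *)
Let id2 : Omega2 P -> Omega * Omega := fun z => z.

Let measurable_id2 : measurable_fun setT id2.
Proof. by move=> _ A mA; rewrite setTI; exact: caratheodory_measurable_mu_ext. Qed.

Lemma measurable_fun_Omega2 {d'} {U : measurableType d'} (f : Omega * Omega -> U) :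
  measurable_fun setT f -> measurable_fun setT (f : Omega2 P -> U).
Proof. by move=> mf; exact: (measurableT_comp mf measurable_id2). Qed.

Let pushforward_id2 A : measurable A -> Q A = pushforward (P2 P) id2 A.
Proof. by move=> mA; rewrite /pushforward; exact/esym/measurable_mu_extE. Qed.

Lemma integrable_P2 (f : Omega * Omega -> R) : Q.-integrable setT (EFin \o f) ->
  (P2 P).-integrable setT (EFin \o (f : Omega2 P -> R)).
Proof.
move=> /integrableP[mf iF]; apply/integrableP; split.
  exact: (measurableT_comp mf measurable_id2).
move: iF; rewrite (eq_measure_integral (pushforward (P2 P) id2)); last first.
  by move=> A mA _; exact: pushforward_id2.
rewrite ge0_integral_pushforward//.
exact: measurableT_comp.
Qed.

Lemma Rintegral_P2 (f : Omega * Omega -> R) : Q.-integrable setT (EFin \o f) ->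
  \int[P2 P]_z f z = \int[Q]_z f z.
Proof.
move=> iF; have iF2 := integrable_P2 iF; have /integrableP[mf _] := iF.
rewrite /Rintegral; congr fine; apply/esym.
rewrite (eq_measure_integral (pushforward (P2 P) id2)); last first.
  by move=> A mA _; exact: pushforward_id2.
by rewrite (integral_pushforward measurable_id2 mf)//.
Qed.

End P2_integral.

(** * Mean-field terms and duality at fixed times *)

Section measurable_block_mx.
Context {R : realType} {d : measure_display} {T : measurableType d}.
Variable D : set T.

Lemma mx_measurable_row_mx m n1 n2 (f : T -> 'M[R]_(m, n1)) (g : T -> 'M[R]_(m, n2)) :
  mx_measurable D f -> mx_measurable D g ->
  mx_measurable D (fun x => row_mx (f x) (g x)).
Proof.
move=> mf mg i j; case: (split_ordP j) => k ->.
  by apply: eq_measurable_fun (mf i k) => x _; rewrite row_mxEl.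
by apply: eq_measurable_fun (mg i k) => x _; rewrite row_mxEr.
Qed.

Lemma mx_measurable_col_mx m1 m2 n (f : T -> 'M[R]_(m1, n)) (g : T -> 'M[R]_(m2, n)) :
  mx_measurable D f -> mx_measurable D g ->
  mx_measurable D (fun x => col_mx (f x) (g x)).
Proof.
move=> mf mg i j; case: (split_ordP i) => k ->.
  by apply: eq_measurable_fun (mf k j) => x _; rewrite col_mxEu.
by apply: eq_measurable_fun (mg k j) => x _; rewrite col_mxEd.
Qed.

Lemma mx_measurable_trmx m n (f : T -> 'M[R]_(m, n)) :
  mx_measurable D f -> mx_measurable D (fun x => (f x)^T).
Proof. by move=> mf i j; apply: eq_measurable_fun (mf j i) => x _; rewrite mxE. Qed.

Lemma mx_measurable_mulmx m n p (f : T -> 'M[R]_(m, n)) (g : T -> 'M[R]_(n, p)) :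
  mx_measurable D f -> mx_measurable D g -> mx_measurable D (fun x => f x *m g x).
Proof.
move=> mf mg i j.
apply: (eq_measurable_fun (fun x => \sum_k f x i k * g x k j)).
  by move=> x _; rewrite mxE.
by apply: measurable_sum => k; apply: measurable_funM; [exact: mf|exact: mg].
Qed.

End measurable_block_mx.

(** * The mean-field operator and its pairings *)

Section mean_field_term.
Context {R : realType} {d : measure_display} {Omega : measurableType d}.
Variable P : probability Omega R.
Notation Q := (PxP P).

Lemma Rintegral_cst_probability (r : R) : \int[P]_w r = r.
Proof.
rewrite Rintegral_cst//; have e : P setT = 1%E by exact: probability_setT.
by rewrite (_ : fine _ = fine 1%E) ?mulr1//; congr fine; exact: e.
Qed.

Lemma integrable_prod_mul (f g : Omega -> R) :
  P.-integrable setT (EFin \o f) -> P.-integrable setT (EFin \o g) ->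
  Q.-integrable setT (EFin \o (fun z => f z.1 * g z.2)).
Proof.
move=> iF ig; have mf := Rintegrable_measurable iF.
have mg := Rintegrable_measurable ig.
have mfg : measurable_fun setT (fun z : Omega * Omega => f z.1 * g z.2).
  by apply: measurable_funM; exact: measurableT_comp.
rewrite /PxP -setXTT; rewrite -setXTT in mfg.
apply/(integrable_domainP P P measurableT measurableT mfg) => /=.
have ing : P.-integrable setT (EFin \o (fun w => `|g w|)) by exact: integrable_norm.
have inf : P.-integrable setT (EFin \o (fun w => `|f w|)) by exact: integrable_norm.
rewrite (eq_integral (fun w => (\int[P]_w' `|g w'| * `|f w|)%:E)).
  by rewrite Rintegral_EFin ?ltry//; exact: RintegrableZl.
move=> w _; rewrite mulrC -RintegralZl// -Rintegral_EFin//; last exact: RintegrableZl.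
by apply: eq_integral => w' _; rewrite normrM.
Qed.

Variables (n m : nat) (A : Omega -> 'M[R]_(n, m)) (B : Omega * Omega -> 'M[R]_(n, m)).
Variables (K : R) (y : Omega -> 'cV[R]_m).
Hypothesis mA : mx_measurable setT A.
Hypothesis AK : forall w i j, `|A w i j| <= K.
Hypothesis mB : mx_measurable setT B.
Hypothesis BK : forall z i j, `|B z i j| <= K.
Hypothesis sy : forall j, sqr_integrable P setT (fun w => y w j ord0).

(** Rectangular matrices are allowed so that, with [A0] and [C0] side by side acting on [Y] stacked
    over [Z], the backward drift is a single such term; the forward drift and the diffusion are
    instances with square matrices. *)
Definition mean_field_term (w : Omega) : 'cV[R]_n :=
  A w *m y w + vint P setT (fun w' => B (w, w') *m y w').

Let iy j : P.-integrable setT (EFin \o (fun w => y w j ord0)).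
Proof. by apply: Rintegrable_of_sqr; case: (sy j). Qed.

Let my j : measurable_fun setT (fun w => y w j ord0). Proof. by case: (sy j). Qed.

Let mBs w i j : measurable_fun setT (fun w' => B (w, w') i j).
Proof. exact: (measurable_fun_pair2 _ (@mB i j)). Qed.

Let iBy w i j : P.-integrable setT (EFin \o (fun w' => B (w, w') i j * y w' j ord0)).
Proof. exact: (Rintegrable_bounded_mul (mBs w i j) (fun w' => BK (w, w') i j)). Qed.

Let E i j w := \int[P]_w' (B (w, w') i j * y w' j ord0).

Lemma mean_field_termE w i : mean_field_term w i ord0 =
  \sum_j (A w i j * y w j ord0 + \int[P]_w' (B (w, w') i j * y w' j ord0)).
Proof.
rewrite /mean_field_term !mxE big_split/=; congr (_ + _).
under eq_Rintegral do rewrite mxE.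
by rewrite Rintegral_sum// => j _; exact: iBy.
Qed.

Let mE i j : measurable_fun setT (E i j).
Proof.
apply: (measurable_Rintegral_section P measurableT measurableT
  (f := fun z => B z i j * y z.2 j ord0)).
by rewrite setXTT; apply: measurable_funM => //; exact: (measurableT_comp (my j)).
Qed.

Lemma measurable_mean_field_term i :
  measurable_fun setT (fun w => mean_field_term w i ord0).
Proof.
under eq_fun do rewrite mean_field_termE.
apply: measurable_sum => j; apply: measurable_funD; last exact: mE.
by apply: measurable_funM.
Qed.

Section pairing.
Variable xi : Omega -> R.
Hypothesis sxi : sqr_integrable P setT xi.

Let ixi : P.-integrable setT (EFin \o xi).
Proof. by apply: Rintegrable_of_sqr; case: sxi. Qed.

Let i1 i j : P.-integrable setT (EFin \o (fun w => xi w * (A w i j * y w j ord0))).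
Proof.
apply: sqr_integrableM => //.
by apply: (sqr_integrable_bounded_mul measurableT (@mA i j) (fun w => AK w i j)).
Qed.

Let iQ i j : Q.-integrable setT
  (EFin \o (fun z => xi z.1 * (B z i j * y z.2 j ord0))).
Proof.
have h := RintegrableZl K measurableT (integrable_norm (integrable_prod_mul ixi (iy j))).
apply: Rintegrable_le h => //.
  apply: measurable_funM; first by apply: measurableT_comp => //; case: sxi.
  by apply: measurable_funM => //; exact: (measurableT_comp (my j)).
by move=> z _ /=; rewrite mulrCA !normrM ler_wpM2r// ?BK//.
Qed.

Let EM i j w : xi w * E i j w = \int[P]_w' (xi w * (B (w, w') i j * y w' j ord0)).
Proof. by rewrite RintegralZl//; exact: iBy. Qed.

Let i2 i j : P.-integrable setT (EFin \o (fun w => xi w * E i j w)).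
Proof.
have := iQ i j; rewrite /PxP -setXTT => h.
have := integrable_Rintegral_section measurableT measurableT h.
by apply: eq_integrable => // w _ /=; rewrite EM.
Qed.

Let e2 i j : \int[P]_w (xi w * E i j w) =
  \int[Q]_z (xi z.1 * (B z i j * y z.2 j ord0)).
Proof.
have := iQ i j; rewrite /PxP -setXTT => h.
rewrite (Rintegral_prod_domain measurableT measurableT h).
by apply: eq_Rintegral => w _; rewrite EM.
Qed.

Lemma Rintegral_mean_field_term i :
  \int[P]_w (xi w * mean_field_term w i ord0) =
  \sum_j (\int[P]_w (xi w * (A w i j * y w j ord0)) +
          \int[Q]_z (xi z.1 * (B z i j * y z.2 j ord0))).
Proof.
under eq_Rintegral do rewrite mean_field_termE mulr_sumr.
rewrite Rintegral_sum//.
  apply: eq_bigr => j _; rewrite -e2 -RintegralD//.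
  by apply: eq_Rintegral => w _; rewrite mulrDr.
move=> j _; have := RintegrableD measurableT (i1 i j) (i2 i j).
by apply: eq_integrable => // w _ /=; rewrite mulrDr.
Qed.

Lemma integrable_mean_field_term i :
  P.-integrable setT (EFin \o (fun w => xi w * mean_field_term w i ord0)).
Proof.
under eq_fun do rewrite mean_field_termE mulr_sumr.
apply: Rintegrable_sum => // j _.
have := RintegrableD measurableT (i1 i j) (i2 i j).
by apply: eq_integrable => // w _ /=; rewrite mulrDr.
Qed.

Let mul_le (a b : R) : `|a| * `|b| <= a ^+ 2 + b ^+ 2.
Proof.
rewrite -[a ^+ 2]real_normK ?num_real// -[b ^+ 2]real_normK ?num_real//.
by have := sqr_ge0 (`|a| - `|b|); nra.
Qed.

(** The inequality [|a| * |b| <= a ^+ 2 + b ^+ 2] is used twice, for the local term and under the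
    mean over the second sample point, whence the factor 2. Only second moments remain on the right;
    for processes these are integrable in time, which provides the domination in the time
    integrals. *)
Lemma Rintegral_norm_mean_field_term_le i :
  \int[P]_w `|xi w * mean_field_term w i ord0| <=
  \sum_j (2 * K * (\int[P]_w (xi w ^+ 2) + \int[P]_w (y w j ord0 ^+ 2))).
Proof.
have K0 (j : 'I_m) : 0 <= K.
  by have := AK point i j; exact: le_trans.
have [mxi ixi2] := sxi.
have iE j : P.-integrable setT (EFin \o (fun w => xi w ^+ 2 + \int[P]_w' (y w' j ord0 ^+ 2))).
  by apply: RintegrableD => //; exact: finite_measure_integrable_cst.
have Eval j : \int[P]_w (xi w ^+ 2 + \int[P]_w' (y w' j ord0 ^+ 2)) =
    \int[P]_w (xi w ^+ 2) + \int[P]_w (y w j ord0 ^+ 2).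
  rewrite RintegralD//; last exact: finite_measure_integrable_cst.
  by rewrite Rintegral_cst_probability.
have iE' j : P.-integrable setT (EFin \o (fun w => xi w ^+ 2 + y w j ord0 ^+ 2)).
  by apply: RintegrableD => //; case: (sy j).
have Eval' j : \int[P]_w (xi w ^+ 2 + y w j ord0 ^+ 2) =
    \int[P]_w (xi w ^+ 2) + \int[P]_w (y w j ord0 ^+ 2).
  by rewrite RintegralD//; case: (sy j).
pose bnd j w := K * (xi w ^+ 2 + y w j ord0 ^+ 2) +
   K * (xi w ^+ 2 + \int[P]_w' (y w' j ord0 ^+ 2)).
have ibnd j : P.-integrable setT (EFin \o bnd j).
  by apply: RintegrableD => //; exact: RintegrableZl.
have EE j w : `|xi w * E i j w| <= K * (xi w ^+ 2 + \int[P]_w' (y w' j ord0 ^+ 2)).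
  rewrite EM; have ixBy : P.-integrable setT (EFin \o (fun w' => xi w * (B (w, w') i j * y w' j ord0))).
    exact: RintegrableZl.
  rewrite (le_trans (le_normr_Rintegral measurableT ixBy))//.
  have [_ iy2] := sy j.
  have -> : K * (xi w ^+ 2 + \int[P]_w' (y w' j ord0 ^+ 2)) =
      \int[P]_w' (K * (xi w ^+ 2 + y w' j ord0 ^+ 2)).
    rewrite RintegralZl//; last first.
      by apply: RintegrableD => //; exact: finite_measure_integrable_cst.
    rewrite RintegralD//; last exact: finite_measure_integrable_cst.
    by rewrite Rintegral_cst_probability.
  apply: le_Rintegral => //.
  - by have := integrable_norm ixBy.
  - apply: RintegrableZl => //; apply: RintegrableD => //.
    exact: finite_measure_integrable_cst.
  - by move=> w' _; rewrite mulrCA !normrM ler_pM ?mulr_ge0 ?BK ?mul_le.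
apply: (@le_trans _ _ (\int[P]_w (\sum_j bnd j w))).
  apply: le_Rintegral => //.
  - by have := integrable_norm (integrable_mean_field_term i).
  - by apply: Rintegrable_sum => // j _.
  move=> w _; rewrite mean_field_termE mulr_sumr (le_trans (ler_norm_sum _ _ _))//.
  apply: ler_sum => j _; rewrite mulrDr (le_trans (ler_normD _ _))// lerD//; last exact: EE.
  by rewrite mulrCA !normrM ler_pM ?mulr_ge0 ?AK ?mul_le.
rewrite Rintegral_sum//; apply: ler_sum => j _.
rewrite RintegralD//; [|exact: RintegrableZl..].
rewrite !RintegralZl// Eval Eval'.
by rewrite -mulrA mulr_natl mulr2n.
Qed.

End pairing.

End mean_field_term.

Section ae_P2.
Context {R : realType} {d : measure_display} {Omega : measurableType d}.
Variable P : probability Omega R.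

Instance ae_P2_filter : Filter (nbhs (almost_everywhere (P2 P))).
Proof. exact: (@ae_filter_ringOfSetsType _ (Omega2 P) R (P2 P)). Qed.

End ae_P2.
#[local] Existing Instance ae_P2_filter.

Section filtration2.
Context {R : realType} {d : measure_display} {Omega : measurableType d}.
Variables (P : probability Omega R) (W : R -> Omega -> R).
Hypothesis cP : measure_is_complete P.
Hypothesis bW : brownian_motion P W.
Notation F := (brownian_filtration P W).
Notation OF t := (g_sigma_algebraType (F t)).
Notation F2 := (filtration2 P F).
Notation Q := (PxP P).

Lemma filtration2K t : <<s F2 t >> = F2 t.
Proof. by apply: sigma_algebra_id; exact: smallest_sigma_algebra. Qed.

(** The adjoined null sets are measurable because the Caratheodory sigma-algebra is complete. *)
Lemma filtration2_sigma_measurable t : <<s F2 t >> `<=` measurable.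
Proof.
rewrite filtration2K; apply: smallest_sub; first exact: sigma_algebra_measurable.
rewrite subUset; split.
  move=> _ [A FA [B FB <-]]; apply: caratheodory_measurable_mu_ext.
  by apply: measurableX; [exact: (brownian_filtration_measurable cP bW FA)|exact: (brownian_filtration_measurable cP bW FB)].
move=> C [D [mD D0 CD]].
apply: (@measure_is_complete_caratheodory _ _ (Q^*)%mu).
by exists D.
Qed.

(** Such products are the test variables for conditioning on pairs of sample points; each factor is
    handled by cylinders. *)
Lemma measurable_fun_filtration2 t (f g : Omega -> R) :
  measurable_fun setT (f : OF t -> R) -> measurable_fun setT (g : OF t -> R) ->
  measurable_fun setT
    ((fun z => f z.1 * g z.2) : g_sigma_algebraType (F2 t) -> R).
Proof.
move=> mf mg; have FT : F t setT.
  by rewrite -brownian_filtrationK; exact: (@measurableT _ (OF t)).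
apply: measurable_funM.
- move=> _ B mB; apply: sub_sigma_algebra; apply: sub_sigma_algebra; left.
  exists (f @^-1` B).
    by rewrite -brownian_filtrationK; have := mf measurableT B mB; rewrite setTI.
  by exists setT => //; rewrite setTI; apply/seteqP; split => [[w w'] []|[w w']].
- move=> _ B mB; apply: sub_sigma_algebra; apply: sub_sigma_algebra; left.
  exists setT => //; exists (g @^-1` B).
    by rewrite -brownian_filtrationK; have := mg measurableT B mB; rewrite setTI.
  by rewrite setTI; apply/seteqP; split => [[w w'] []|[w w']].
Qed.

End filtration2.

Section truncation.
Context {R : realType}.

(** Turns the almost sure bound of a conditional expectation into one valid everywhere, at the price
    of a change on a null set. *)
Definition truncation (K r : R) : R := if `|r| <= K then r else 0.

Lemma truncation_bounded K r : 0 <= K -> `|truncation K r| <= K.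
Proof. by move=> K0; rewrite /truncation; case: ifP => // _; rewrite normr0. Qed.

Lemma truncation_id K r : `|r| <= K -> truncation K r = r.
Proof. by rewrite /truncation => ->. Qed.

Lemma measurable_truncation K : measurable_fun setT (truncation K).
Proof.
apply: measurable_fun_ifT => //.
by apply: measurable_fun_ler => //; exact: measurableT_comp.
Qed.

End truncation.

(** * Duality at a fixed pair of times *)

Section duality_fixed_time.
Context {R : realType} {d : measure_display} {Omega : measurableType d}.
Variables (P : probability Omega R) (W : R -> Omega -> R).
Hypothesis cP : measure_is_complete P.
Hypothesis bW : brownian_motion P W.
Notation F := (brownian_filtration P W).
Notation OF t := (g_sigma_algebraType (F t)).
Notation F2 := (filtration2 P F).
Notation Q := (PxP P).

Lemma vint_ae_eq (n m : nat) (B B0 : Omega -> 'M[R]_(n, m)) (y : Omega -> 'cV[R]_m) :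
  {ae P, forall w, B w = B0 w} -> mx_measurable setT B0 -> mx_measurable setT y ->
  vint P setT (fun w => B w *m y w) = vint P setT (fun w => B0 w *m y w).
Proof.
move=> BB0 mB0 my; apply/matrixP => i j; rewrite mxE [RHS]mxE.
apply: (ae_complete_Rintegral cP); last by apply: filterS BB0 => w ->.
exact: (mx_measurable_mulmx mB0 my).
Qed.

Lemma Rintegral_PxP_swap (f : Omega * Omega -> R) : Q.-integrable setT (EFin \o f) ->
  \int[Q]_z f z = \int[Q]_z f (z.2, z.1).
Proof.
rewrite /PxP -setXTT => iF.
have iFs := integrable_swap_domain measurableT measurableT iF.
rewrite (Rintegral_prod_domain measurableT measurableT iF).
by rewrite (Rintegral_prod_domain measurableT measurableT iFs) Rfubini.
Qed.

Let Rintegrable_bounded_mul_Q (xi k : Omega * Omega -> R) K :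
  Q.-integrable setT (EFin \o xi) -> measurable_fun setT k ->
  (forall z, `|k z| <= K) -> Q.-integrable setT (EFin \o (fun z => xi z * k z)).
Proof.
move=> ixi mk kK; have mxi := Rintegrable_measurable ixi.
have := RintegrableZl K measurableT (integrable_norm ixi).
apply: Rintegrable_le => //; first exact: measurable_funM.
by move=> z _ /=; rewrite normrM mulrC ler_wpM2r.
Qed.

(** The product [f1 * f2] is integrable and measurable for [F t], so [g] may be exchanged with [c]
    against it; the truncation is almost surely invisible. *)
Let cond_exp_Omega t (c g : Omega -> R) (f1 f2 : Omega -> R) K :
  measurable_fun setT (f1 : OF t -> R) -> measurable_fun setT (f2 : OF t -> R) ->
  sqr_integrable P setT f1 -> sqr_integrable P setT f2 ->
  P.-integrable setT (EFin \o c) -> P.-integrable setT (EFin \o g) ->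
  measurable_fun setT (g : OF t -> R) ->
  (forall A, F t A -> \int[P]_(w in A) (g w)%:E = \int[P]_(w in A) (c w)%:E)%E ->
  (forall w, `|c w| <= K) ->
  \int[P]_w (f1 w * (truncation K (g w) * f2 w)) = \int[P]_w (f2 w * (c w * f1 w)).
Proof.
move=> mf1 mf2 sf1 sf2 ic ig mg gc cK.
have subF := brownian_filtration_sigma_measurable cP bW (t := t).
have gcR A : <<s F t >> A -> \int[P]_(w in A) g w = \int[P]_(w in A) c w.
  by rewrite brownian_filtrationK => FA; rewrite /Rintegral gc.
have gK := cond_exp_bounded subF ic ig mg gcR cK.
have mf12 : measurable_fun setT ((fun w => f1 w * f2 w) : OF t -> R).
  exact: measurable_funM.
have [i e] := cond_exp_mul subF ic ig mg gcR cK mf12 (sqr_integrableM measurableT sf1 sf2).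
transitivity (\int[P]_w (f1 w * f2 w * g w)).
  apply: (ae_complete_Rintegral cP); first exact: Rintegrable_measurable i.
  by apply: filterS gK => w gw; rewrite truncation_id//; ring.
by rewrite e; apply: eq_Rintegral => w _; ring.
Qed.

(** The same exchange on pairs. The two sample points are swapped, the integral is moved to the
    completed measure, where the conditioning takes place, and it is moved back once [c] has been
    replaced by its version [c0]. *)
Let cond_exp_Omega2 t (c g c0 g0 : Omega * Omega -> R) (f1 f2 : Omega -> R) K :
  measurable_fun setT (f1 : OF t -> R) -> measurable_fun setT (f2 : OF t -> R) ->
  sqr_integrable P setT f1 -> sqr_integrable P setT f2 ->
  (P2 P).-integrable setT (EFin \o c) -> (P2 P).-integrable setT (EFin \o g) ->
  measurable_fun setT (g : g_sigma_algebraType (F2 t) -> R) ->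
  (forall A, F2 t A -> \int[P2 P]_(w in A) (g w)%:E = \int[P2 P]_(w in A) (c w)%:E)%E ->
  (forall w, `|c w| <= K) ->
  measurable_fun setT g0 -> (forall z, `|g0 z| <= K) ->
  {ae P2 P, forall z, g0 z = g z} ->
  measurable_fun setT c0 -> (forall z, `|c0 z| <= K) ->
  {ae P2 P, forall z, c0 z = c z} ->
  \int[Q]_z (f2 z.1 * (g0 (z.2, z.1) * f1 z.2)) = \int[Q]_z (f1 z.1 * (c0 z * f2 z.2)).
Proof.
move=> mf1 mf2 sf1 sf2 ic ig mg gc cK mg0 g0K g0g mc0 c0K c0c.
have subF := filtration2_sigma_measurable cP bW (t := t).
have gcR A : <<s F2 t >> A -> \int[P2 P]_(w in A) g w = \int[P2 P]_(w in A) c w.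
  by rewrite filtration2K => FA; rewrite /Rintegral gc.
have if1 : P.-integrable setT (EFin \o f1) by apply: Rintegrable_of_sqr; case: sf1.
have if2 : P.-integrable setT (EFin \o f2) by apply: Rintegrable_of_sqr; case: sf2.
have iff := integrable_prod_mul if1 if2.
have mff := Rintegrable_measurable iff.
have [i e] := cond_exp_mul subF ic ig mg gcR cK (measurable_fun_filtration2 mf1 mf2)
  (integrable_P2 iff).
have ig0 := Rintegrable_bounded_mul_Q iff mg0 g0K.
have ic0 := Rintegrable_bounded_mul_Q iff mc0 c0K.
transitivity (\int[Q]_z (f1 z.1 * f2 z.2 * g0 z)).
  rewrite [RHS]Rintegral_PxP_swap//; apply: eq_Rintegral => z _ /=; ring.
transitivity (\int[P2 P]_z (f1 z.1 * f2 z.2 * g z)).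
  rewrite -(Rintegral_P2 ig0); apply: ae_eq_Rintegral.
  - exact: measurableT.
  - exact: (Rintegrable_measurable (integrable_P2 ig0)).
  - exact: Rintegrable_measurable i.
  - by apply: filterS g0g => z ->.
rewrite e; transitivity (\int[P2 P]_z (f1 z.1 * f2 z.2 * c0 z)).
  apply: ae_eq_Rintegral.
  - exact: measurableT.
  - apply: measurable_funM; first exact: measurable_fun_Omega2.
    exact: Rintegrable_measurable ic.
  - exact: (Rintegrable_measurable (integrable_P2 ic0)).
  - by apply: filterS c0c => z ->.
rewrite Rintegral_P2//; apply: eq_Rintegral => z _; ring.
Qed.

Lemma Rintegral_dotv_mean_field_term n m (x : Omega -> 'cV[R]_n) (A : Omega -> 'M[R]_(n, m))
    (B : Omega * Omega -> 'M[R]_(n, m)) (y : Omega -> 'cV[R]_m) K :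
  mx_measurable setT A -> (forall w i j, `|A w i j| <= K) ->
  mx_measurable setT B -> (forall z i j, `|B z i j| <= K) ->
  (forall j, sqr_integrable P setT (fun w => y w j ord0)) ->
  (forall i, sqr_integrable P setT (fun w => x w i ord0)) ->
  \int[P]_w dotv (x w) (mean_field_term P A B y w) =
  \sum_i \sum_j (\int[P]_w (x w i ord0 * (A w i j * y w j ord0)) +
          \int[Q]_z (x z.1 i ord0 * (B z i j * y z.2 j ord0))).
Proof.
move=> mA AK mB BK sy sx; rewrite Rintegral_sum//; last first.
  by move=> i _; apply: (integrable_mean_field_term mA AK mB BK sy).
by apply: eq_bigr => i _; rewrite (Rintegral_mean_field_term mA AK mB BK sy).
Qed.

(** Here [t] is the earlier of the two times. Transposing a kernel and exchanging its two sample
    points turns each term on the left into one on the right. The [C] terms also change from kernel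
    to conditional expectation, as [x] and [z] are known at time [t]; [y], taken at the later time,
    faces the [A] terms alone. *)
Lemma duality_fixed_time n t (A0 C0 D0 : Omega -> 'M[R]_n)
    (C1 D1 A1' C1' : Omega * Omega -> 'M[R]_n) (x y z : Omega -> 'cV[R]_n) K N :
  0 <= K ->
  mx_measurable setT A0 -> (forall w i j, `|A0 w i j| <= K) ->
  mx_measurable setT C0 -> (forall w i j, `|C0 w i j| <= K) ->
  mx_measurable setT A1' -> (forall w i j, `|A1' w i j| <= K) ->
  mx_measurable setT C1' -> (forall w i j, `|C1' w i j| <= K) ->
  (forall w i j, `|C1 w i j| <= K) ->
  measurable N -> Q N = 0%E -> (forall w, ~ N w -> C1' w = C1 w) ->
  is_cond_exp P (F t) (fun w => (C0 w)^T) D0 ->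
  is_cond_exp (P2 P) (F2 t) (fun w => (C1 w)^T) D1 ->
  (forall i, measurable_fun setT ((fun w => x w i ord0) : OF t -> R)) ->
  (forall i, measurable_fun setT ((fun w => z w i ord0) : OF t -> R)) ->
  (forall i, sqr_integrable P setT (fun w => x w i ord0)) ->
  (forall i, sqr_integrable P setT (fun w => y w i ord0)) ->
  (forall i, sqr_integrable P setT (fun w => z w i ord0)) ->
  \int[P]_w dotv (x w) (mean_field_term P (fun w => row_mx (A0 w) (C0 w))
    (fun p => row_mx (A1' p) (C1' p)) (fun w => col_mx (y w) (z w)) w) =
  \int[P]_w dotv (y w) (mean_field_term P (fun w => (A0 w)^T)
    (fun p => (A1' (p.2, p.1))^T) x w) +
  \int[P]_w dotv (z w) (D0 w *m x w + vint P setT (fun w' => D1 (w', w) *m x w')).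
Proof.
move=> K0 mA0 A0K mC0 C0K mA1 A1K mC1 C1K C1bK mN QN C1N [mD0 ceD0] [mD1 ceD1].
move=> mx mz sx sy sz.
have mD0' i j : measurable_fun setT (fun w => D0 w i j).
  exact: (measurable_fun_filtration cP bW (mD0 i j)).
have mD1' i j : measurable_fun setT ((fun w => D1 w i j) : Omega2 P -> R).
  apply: (@measurable_fun_sub_sigma _ _ (F2 t) (@filtration2_sigma_measurable _ _ _ _ _ cP bW t)).
  exact: mD1.
pose E0 w := map_mx (truncation K) (D0 w).
(* [Omega2_version] carries a parameter space; as the times are fixed, a one-point space is
   taken. *)
have [D1v HD1v] := choice (fun ij : 'I_n * 'I_n =>
  @Omega2_version _ _ _ P _ unit setT (fun p : unit * Omega2 P => D1 p.2 ij.1 ij.2)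
   measurableT (measurable_funTS (measurableT_comp (mD1' ij.1 ij.2) measurable_snd))).
pose E1 p : 'M[R]_n := \matrix_(i, j) truncation K (D1v (i, j) (tt, p)).
have mE0 : mx_measurable setT E0.
  move=> i j; under eq_fun do rewrite mxE.
  by apply: measurableT_comp; [exact: measurable_truncation|exact: mD0'].
have mE1 : mx_measurable setT E1.
  move=> i j; under eq_fun do rewrite mxE.
  have [N' [_ _ mv _ _]] := HD1v (i, j).
  apply: measurableT_comp; first exact: measurable_truncation.
  by rewrite setXTT in mv; exact: (measurable_fun_pair2 _ mv).
have E0K w i j : `|E0 w i j| <= K by rewrite mxE truncation_bounded.
have E1K w i j : `|E1 w i j| <= K by rewrite mxE truncation_bounded.
have D0K : {ae P, forall w, D0 w = E0 w}.
  have : {ae P, forall w, forall ij : 'I_n * 'I_n, `|D0 w ij.1 ij.2| <= K}.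
    apply: filter_forall => -[i j] /=; have [ic ig gc] := ceD0 i j.
    apply: (cond_exp_bounded (brownian_filtration_sigma_measurable cP bW (t := t)) ic ig (mD0 i j)).
      by move=> A; rewrite brownian_filtrationK => FA; rewrite /Rintegral gc.
    by move=> w; rewrite mxE.
  apply: filterS => w h; apply/matrixP => i j.
  by rewrite mxE truncation_id//; exact: (h (i, j)).
have D1K : {ae P2 P, forall w, D1 w = E1 w}.
  have h1 : {ae P2 P, forall w, forall ij : 'I_n * 'I_n, `|D1 w ij.1 ij.2| <= K}.
    apply: filter_forall => -[i j] /=; have [ic ig gc] := ceD1 i j.
    apply: (cond_exp_bounded (filtration2_sigma_measurable cP bW (t := t)) ic ig (mD1 i j)).
      by move=> A; rewrite filtration2K => FA; rewrite /Rintegral gc.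
    by move=> w; rewrite mxE.
  have h2 : {ae P2 P, forall w, forall ij : 'I_n * 'I_n, D1v ij (tt, w) = D1 w ij.1 ij.2}.
    apply: filter_forall => -[i j] /=; have [N' [mN' QN' _ _ eN']] := HD1v (i, j).
    by apply: filterS (P2_null mN' QN') => w /(eN' tt).
  apply: filterS2 h1 h2 => w h1 h2; apply/matrixP => i j.
  by rewrite mxE (h2 (i, j)) truncation_id//; exact: (h1 (i, j)).
have [N1 [mN1 QN1 D1N]] := P2_null_ae D1K.
have [_ D1s] := PxP_section_null mN1 QN1.
have mx_x : mx_measurable setT x.
  by move=> i j; rewrite (ord1 j); case: (sx i).
have mx_z : mx_measurable setT z.
  by move=> i j; rewrite (ord1 j); case: (sz i).
have mE0T : mx_measurable setT E0 by [].
(* The diffusion averages [D1] over its first sample point, [mean_field_term] averages over the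
   second. *)
pose E1s p := E1 (p.2, p.1).
have mE1s : mx_measurable setT E1s.
  move=> i j; apply: (measurableT_comp (mE1 i j)).
  exact: measurable_fun_pair.
(* For almost every [w] the sections of [D1] and [E1] agree almost surely, so under the outer
   expectation the diffusion becomes a term with measurable, bounded kernels. *)
have hE : \int[P]_w dotv (z w) (D0 w *m x w + vint P setT (fun w' => D1 (w', w) *m x w')) =
    \int[P]_w dotv (z w) (mean_field_term P E0 E1s x w).
  apply: (ae_complete_Rintegral cP).
    apply: measurable_dotv => // i j; rewrite (ord1 j).
    apply: (@measurable_mean_field_term _ _ _ P _ _ E0 E1s K) => //.
    by move=> p i' j'; exact: E1K.
  apply: filterS2 D0K D1s => w e0 e1; congr dotv; rewrite /mean_field_term -e0.
  congr (_ + _); apply: vint_ae_eq => //.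
    by apply: filterS e1 => w' nN; exact: D1N.
  by move=> i j; exact: (measurable_fun_pair2 _ (mE1s i j)).
have mAC := mx_measurable_row_mx mA0 mC0.
have mAC1 := mx_measurable_row_mx mA1 mC1.
have ACK w i j : `|row_mx (A0 w) (C0 w) i j| <= K.
  by case: (split_ordP j) => k ->; rewrite ?row_mxEl ?row_mxEr.
have AC1K w i j : `|row_mx (A1' w) (C1' w) i j| <= K.
  by case: (split_ordP j) => k ->; rewrite ?row_mxEl ?row_mxEr.
have syz j : sqr_integrable P setT (fun w => col_mx (y w) (z w) j ord0).
  case: (split_ordP j) => k ->.
    by under eq_fun do rewrite col_mxEu.
  by under eq_fun do rewrite col_mxEd.
have mA0T := mx_measurable_trmx mA0.
have mA1T : mx_measurable setT (fun p => (A1' (p.2, p.1))^T).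
  apply: mx_measurable_trmx => i j; apply: (measurableT_comp (mA1 i j)).
  exact: measurable_fun_pair.
rewrite hE (Rintegral_dotv_mean_field_term mAC ACK mAC1 AC1K syz sx).
rewrite (@Rintegral_dotv_mean_field_term _ _ _ _ _ _ K mA0T _ mA1T _ sx sy); last first.
- by move=> w i j; rewrite mxE.
- by move=> w i j; rewrite mxE.
rewrite (Rintegral_dotv_mean_field_term mE0 E0K mE1s _ sx sz); last first.
  by move=> p i j; exact: E1K.
(* The columns split into the [A] block, which faces [y], and the [C] block, which faces [z]; in
   each block, exchanging the two sums accounts for the transpose. *)
under eq_bigr => i _ do rewrite big_split_ord.
rewrite big_split/=; congr (_ + _).
  rewrite exchange_big; apply: eq_bigr => j _; apply: eq_bigr => i _; congr (_ + _).
    by apply: eq_Rintegral => w _; rewrite row_mxEl col_mxEu mxE; ring.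
  rewrite Rintegral_PxP_swap.
    by apply: eq_Rintegral => w _ /=; rewrite row_mxEl col_mxEu mxE; case: w => w w' /=; ring.
  under eq_fun do rewrite row_mxEl col_mxEu.
  have ix : P.-integrable setT (EFin \o (fun w => x w i ord0)).
    by apply: Rintegrable_of_sqr; case: (sx i).
  have iy : P.-integrable setT (EFin \o (fun w => y w j ord0)).
    by apply: Rintegrable_of_sqr; case: (sy j).
  have := Rintegrable_bounded_mul_Q (integrable_prod_mul ix iy) (mA1 i j) (fun w => A1K w i j).
  apply: eq_integrable; first exact: measurableT.
  by move=> w _ /=; rewrite -mulrA; congr (_ * _)%:E; exact: mulrC.
rewrite exchange_big; apply: eq_bigr => j _; apply: eq_bigr => i _; congr (_ + _).
  have [ic ig gc] := ceD0 j i.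
  under eq_Rintegral do rewrite row_mxEr col_mxEd.
  have h := cond_exp_Omega (mz j) (mx i) (sz j) (sx i) ic ig (mD0 j i) gc.
  transitivity (\int[P]_w (z w j ord0 * (truncation K (D0 w j i) * x w i ord0))).
    by rewrite h; [apply: eq_Rintegral => w _; rewrite mxE|move=> w; rewrite mxE].
  by apply: eq_Rintegral => w _; rewrite [E0 w j i]mxE.
have [ic ig gc] := ceD1 j i.
have bC w : `|(C1 w)^T j i| <= K by rewrite mxE.
have eC : {ae P2 P, forall p, C1' p i j = (C1 p)^T j i}.
  by apply: filterS (P2_null mN QN) => p /C1N ->; rewrite mxE.
have eE : {ae P2 P, forall p, E1 p j i = D1 p j i}.
  by apply: filterS D1K => p ->.
have h := cond_exp_Omega2 (mx i) (mz j) (sx i) (sz j) ic ig (mD1 j i) gc bC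
  (mE1 j i) (fun p => E1K p j i) eE (mC1 i j) (fun p => C1K p i j) eC.
rewrite [RHS]h; apply: eq_Rintegral => p _.
by rewrite row_mxEr col_mxEd.
Qed.

End duality_fixed_time.

(** * Integration in time *)

Section time_sections.
Context {R : realType} {d : measure_display} {Omega : measurableType d}.
Variable P : probability Omega R.

Section square_sections.
Context {d' : measure_display} {S : measurableType d'}.
Variable m : {sigma_finite_measure set S -> \bar R}.
Variable A : set S.
Hypothesis mA : measurable A.

Lemma sqr_integrable_section (f : S * Omega -> R) :
  sqr_integrable (m \x P)%E (A `*` setT) f ->
  {ae m, forall x, A x -> sqr_integrable P setT (fun w => f (x, w))} /\
  m.-integrable A (EFin \o (fun x => \int[P]_w (f (x, w) ^+ 2))).
Proof.
move=> [mf iF]; split; last exact: (integrable_Rintegral_section mA measurableT iF).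
apply: filterS (ae_integrable_section mA measurableT iF) => x ix Ax.
split; last exact: ix.
exact: (measurable_fun_section1 mA measurableT mf Ax).
Qed.

(** The inner mean integrates out the last coordinate of a triple made of a parameter and two sample
    points; the compositions regroup such triples to fit the domains of [G] and [y]. *)
Lemma measurable_mean_field_term_family {n k : nat}
    (F : S -> Omega -> 'M[R]_(n, k)) (G : S -> Omega * Omega -> 'M[R]_(n, k))
    (y : S -> Omega -> 'cV[R]_k) :
  mx_measurable (A `*` setT) (fun q : S * Omega => F q.1 q.2) ->
  mx_measurable (A `*` setT) (fun q : S * (Omega * Omega) => G q.1 q.2) ->
  mx_measurable (A `*` setT) (fun q : S * Omega => y q.1 q.2) ->
  mx_measurable (A `*` setT)
    (fun q : S * Omega => mean_field_term P (F q.1) (G q.1) (y q.1) q.2).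
Proof.
move=> mF mG my i j; rewrite (ord1 j).
have mAT : measurable (A `*` setT : set (S * Omega)) by exact: measurableX.
have mATT : measurable ((A `*` setT) `*` setT : set (S * Omega * Omega)) by exact: measurableX.
apply: (eq_measurable_fun (fun q : S * Omega => (F q.1 q.2 *m y q.1 q.2) i ord0 +
  \int[P]_w' ((G q.1 (q.2, w') *m y q.1 w') i ord0))).
  by move=> q _; rewrite /mean_field_term [RHS]mxE; congr (_ + _); rewrite mxE.
apply: measurable_funD; first exact: (mx_measurable_mulmx mF my).
apply: (@measurable_Rintegral_section _ _ (S * Omega)%type Omega R P (A `*` setT) setT
  mAT measurableT (fun z => (G z.1.1 (z.1.2, z.2) *m y z.1.1 z.2) i ord0)).
apply: (@mx_measurable_mulmx _ _ _ ((A `*` setT) `*` setT) n k 1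
  (fun z : S * Omega * Omega => G z.1.1 (z.1.2, z.2)) (fun z => y z.1.1 z.2)) => a b.
- apply: (@measurable_comp _ _ _ (S * Omega * Omega)%type (S * (Omega * Omega))%type R
    (A `*` setT) (fun q => G q.1 q.2 a b) _ (fun z => (z.1.1, (z.1.2, z.2)))).
  + exact: measurableX.
  + by move=> _ [z [[Az _] _] <-].
  + exact: mG.
  + apply: measurable_funTS; apply: measurable_fun_pair.
      exact: (measurableT_comp measurable_fst measurable_fst).
    apply: measurable_fun_pair; last exact: measurable_snd.
    exact: (measurableT_comp measurable_snd measurable_fst).
- apply: (@measurable_comp _ _ _ (S * Omega * Omega)%type (S * Omega)%type R
    (A `*` setT) (fun q => y q.1 q.2 a b) _ (fun z => (z.1.1, z.2))).
  + exact: measurableX.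
  + by move=> _ [z [[Az _] _] <-].
  + exact: my.
  + apply: measurable_funTS; apply: measurable_fun_pair; last exact: measurable_snd.
    exact: (measurableT_comp measurable_fst measurable_fst).
Qed.

(* [c * (E xi^2 + e s)] is the form of the bound of
   [Rintegral_norm_mean_field_term_le]; the case [xi = 1] is what makes [V]
   itself integrable. *)
Lemma Rintegral_mul_Rintegral (V : S -> Omega -> R) (c : R) (e : S -> R) :
  (m A < +oo)%E ->
  measurable_fun (A `*` setT) (fun q : S * Omega => V q.1 q.2) ->
  m.-integrable A (EFin \o e) ->
  {ae m, forall s, A s -> forall xi, sqr_integrable P setT xi ->
    P.-integrable setT (EFin \o (fun w => xi w * V s w)) /\
    \int[P]_w `|xi w * V s w| <= c * \int[P]_w (xi w ^+ 2) + e s} ->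
  forall xi, sqr_integrable P setT xi ->
  [/\ P.-integrable setT (EFin \o (fun w => xi w * \int[m]_(s in A) V s w)),
      m.-integrable A (EFin \o (fun s => \int[P]_w (xi w * V s w))) &
      \int[P]_w (xi w * \int[m]_(s in A) V s w) =
      \int[m]_(s in A) \int[P]_w (xi w * V s w)].
Proof.
move=> Afin mV ie HV.
have key xi : sqr_integrable P setT xi ->
    (m \x P)%E.-integrable (A `*` setT) (EFin \o (fun q : S * Omega => xi q.2 * V q.1 q.2)).
  move=> sxi; have mxV : measurable_fun (A `*` setT) (fun q : S * Omega => xi q.2 * V q.1 q.2).
    apply: measurable_funM => //; apply: measurable_funTS.
    by apply: measurableT_comp => //; case: sxi.
  apply/(integrable_domainP m P mA measurableT mxV) => /=.
  have ib : m.-integrable A (EFin \o (fun s => c * \int[P]_w (xi w ^+ 2) + e s)).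
    apply: RintegrableD => //; apply/integrableP; split.
      by apply/measurable_EFinP; exact: measurable_cst.
    rewrite /= integral_cst//.
    by apply: lte_mul_pinfty.
  have : (\int[m]_(s in A) `|(c * \int[P]_w (xi w ^+ 2) + e s)%:E| < +oo)%E.
    by have /integrableP[] := ib.
  apply: le_lt_trans; apply: ae_ge0_le_integral => //.
  - by move=> s _; exact: integral_ge0.
  - have mh : measurable_fun setT ((fun q : S * Omega => (`|xi q.2 * V q.1 q.2|%:E)) \_ (A `*` setT)).
      apply/(measurable_restrictT _ (measurableX mA measurableT))/measurable_EFinP.
      exact: measurableT_comp.
    apply/(measurable_restrictT _ mA).
    have h0 z : (0 <= ((fun q : S * Omega => (`|xi q.2 * V q.1 q.2|%:E)) \_ (A `*` setT)) z)%E.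
      by rewrite /patch; case: ifP => // _; rewrite lee_fin.
    have := @measurable_fun_fubini_tonelli_F _ _ _ _ _ P _ mh h0.
    apply: eq_measurable_fun => s _; rewrite /fubini_F /patch.
    case: ifPn => [As|nAs].
      by apply: eq_integral => w _; rewrite in_setX/= As in_setT.
    by rewrite integral0_eq// => w _; rewrite in_setX/= (negbTE nAs).
  - by apply: measurableT_comp => //; case/integrableP: ib.
  - apply: filterS HV => s HV As; have [i le] := HV As xi sxi.
    rewrite Rintegral_EFin//; last exact: integrable_norm.
    by rewrite lee_fin (le_trans le)// ler_norm.
move=> xi sxi; have ix := key _ sxi.
have s1 : sqr_integrable P setT (fun _ => 1 : R).
  by split; [exact: measurable_cst|exact: (@finite_measure_integrable_cst _ _ _ P setT (1 ^+ 2))].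
have iV : {ae P, forall w, m.-integrable A (EFin \o V ^~ w)}.
  have h := integrable_swap_domain mA measurableT (key _ s1).
  have := ae_integrable_section measurableT mA h.
  apply: filterS => w /(_ I); apply: eq_integrable => // s _ /=.
  by rewrite mul1r.
have ixs := integrable_swap_domain mA measurableT ix.
have iR := integrable_Rintegral_section measurableT mA ixs.
(* The factor [xi w] is constant in time, but moving it under the integral uses that [V] is
   integrable in time, which [iV] gives almost surely. *)
have E : {ae P, forall w, xi w * \int[m]_(s in A) V s w =
    \int[m]_(s in A) (xi w * V s w)}.
  by apply: filterS iV => w iV; rewrite RintegralZl.
have mVs : measurable_fun setT (fun w => \int[m]_(s in A) V s w).
  by have := measurable_Rintegral_section m measurableT mA
    (measurable_fun_swap_domain mA measurableT mV).
have mxVs : measurable_fun setT (fun w => xi w * \int[m]_(s in A) V s w).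
  by apply: measurable_funM => //; case: sxi.
split.
- apply: Rintegrable_ae_le (integrable_norm iR) => //.
  by apply: filterS E => w -> _.
- exact: (integrable_Rintegral_section mA measurableT ix).
- rewrite (Rfubini mA measurableT ix); apply: ae_eq_Rintegral => //.
  + exact: Rintegrable_measurable iR.
  + by apply: filterS E.
Qed.

End square_sections.

End time_sections.

Section vector_sections.
Context {R : realType} {d d' : measure_display} {Omega : measurableType d}.
Context {S : measurableType d'}.
Variable P : probability Omega R.
Variable m : {sigma_finite_measure set S -> \bar R}.
Variable A : set S.
Hypothesis mA : measurable A.

Lemma integrable_dotv {n : nat} (x y : Omega -> 'cV[R]_n) :
  (forall i, P.-integrable setT (EFin \o (fun w => x w i ord0 * y w i ord0))) ->
  P.-integrable setT (EFin \o (fun w => dotv (x w) (y w))).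
Proof. by move=> ixy; apply: Rintegrable_sum => // i _; exact: ixy. Qed.

Lemma Rintegral_dotv {n : nat} (x y : Omega -> 'cV[R]_n) :
  (forall i, P.-integrable setT (EFin \o (fun w => x w i ord0 * y w i ord0))) ->
  \int[P]_w dotv (x w) (y w) = \sum_i \int[P]_w (x w i ord0 * y w i ord0).
Proof. by move=> ixy; rewrite Rintegral_sum// => i _; exact: ixy. Qed.

Lemma Rintegral_dotv_vint {n : nat} (V : S -> Omega -> 'cV[R]_n) (c : R) (e : S -> R)
    (x : Omega -> 'cV[R]_n) :
  (m A < +oo)%E ->
  mx_measurable (A `*` setT) (fun q : S * Omega => V q.1 q.2) ->
  m.-integrable A (EFin \o e) ->
  {ae m, forall s, A s -> forall i xi, sqr_integrable P setT xi ->
    P.-integrable setT (EFin \o (fun w => xi w * V s w i ord0)) /\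
    \int[P]_w `|xi w * V s w i ord0| <= c * \int[P]_w (xi w ^+ 2) + e s} ->
  (forall i, sqr_integrable P setT (fun w => x w i ord0)) ->
  [/\ P.-integrable setT (EFin \o (fun w => dotv (x w) (vint m A (fun s => V s w)))),
      m.-integrable A (EFin \o (fun s => \int[P]_w dotv (x w) (V s w))) &
      \int[P]_w dotv (x w) (vint m A (fun s => V s w)) =
      \int[m]_(s in A) \int[P]_w dotv (x w) (V s w)].
Proof.
move=> Afin mV ie HV sx.
have key i : [/\ P.-integrable setT (EFin \o (fun w => x w i ord0 * \int[m]_(s in A) V s w i ord0)),
      m.-integrable A (EFin \o (fun s => \int[P]_w (x w i ord0 * V s w i ord0))) &
      \int[P]_w (x w i ord0 * \int[m]_(s in A) V s w i ord0) =
      \int[m]_(s in A) \int[P]_w (x w i ord0 * V s w i ord0)].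
  apply: (Rintegral_mul_Rintegral mA (c := c) (e := e) Afin (mV i ord0) ie _ (sx i)).
  by apply: filterS HV => s h As xi; exact: h.
have E1 : {ae m, forall s, A s -> \int[P]_w dotv (x w) (V s w) =
    \sum_i \int[P]_w (x w i ord0 * V s w i ord0)}.
  apply: filterS HV => s h As; apply: Rintegral_dotv => i.
  exact: (h As i _ (sx i)).1.
have ivint i : P.-integrable setT
    (EFin \o (fun w => x w i ord0 * vint m A (fun s => V s w) i ord0)).
  by have [+ _ _] := key i; apply: eq_integrable => // w _ /=; rewrite mxE.
have isum : m.-integrable A (EFin \o (fun s => \sum_i \int[P]_w (x w i ord0 * V s w i ord0))).
  by apply: Rintegrable_sum => // i _; case: (key i).
have mdot : measurable_fun A (fun s => \int[P]_w dotv (x w) (V s w)).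
  apply: (@measurable_Rintegral_section _ _ S Omega R P A setT mA measurableT
    (fun q => dotv (x q.2) (V q.1 q.2))).
  apply: measurable_dotv => // i j; rewrite (ord1 j); apply: measurable_funTS.
  by have [mx _] := sx i; exact: (measurableT_comp mx).
split.
- exact: integrable_dotv.
- apply: Rintegrable_ae_le (integrable_norm isum) => //.
  by apply: filterS E1 => s h As; rewrite h.
- rewrite Rintegral_dotv//.
  rewrite (ae_eq_Rintegral mA mdot (Rintegrable_measurable isum) E1).
  rewrite Rintegral_sum//; last by move=> i _; case: (key i).
  apply: eq_bigr => i _; have [_ _ <-] := key i.
  by apply: eq_Rintegral => w _; rewrite mxE.
Qed.

End vector_sections.

(** * Measurable versions of the coefficients *)

Section coefficients_and_processes.
Context {R : realType} {d : measure_display} {Omega : measurableType d}.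
Variables (P : probability Omega R) (T : R).
Notation Q := (PxP P).
Notation mu := (@lebesgue_measure R).
Notation mR := (measurableTypeR R).

Lemma measurable_Delta : measurable (Delta T : set (mR * mR)).
Proof.
rewrite (_ : Delta T = ([set p : mR * mR | 0 <= p.1] `&` [set p : mR * mR | p.1 <= p.2]) `&`
    [set p : mR * mR | p.2 <= T]); last first.
  by apply/seteqP; split => p; [move=> []|move=> [[]]].
have mf : measurable_fun setT (fst : mR * mR -> R) by exact: measurable_fst.
have ms : measurable_fun setT (snd : mR * mR -> R) by exact: measurable_snd.
have h (f g : mR * mR -> R) : measurable_fun setT f -> measurable_fun setT g ->
    measurable [set p | f p <= g p].
  move=> mf' mg'; have := measurable_fun_ler mf' mg' measurableT (Y := [set true]).
  by rewrite setTI; apply.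
apply: measurableI; last exact: (h snd (cst T)).
by apply: measurableI; [exact: (h (cst 0) fst)|exact: (h fst snd)].
Qed.

(** The exceptional set is common to all entries and all times, so that at almost every sample point
    a whole time integral can be rewritten at once. The comparison of absolute values passes the
    bound of the coefficient to its version. *)
Lemma coefficient_version {n : nat} (A : R -> R -> Omega * Omega -> 'M[R]_n) :
  mx_measurable (Delta T `*` setT)
    (fun p : (mR * mR) * Omega2 P => A p.1.1 p.1.2 p.2) ->
  exists (A' : mR * mR -> Omega * Omega -> 'M[R]_n) (N : set (Omega * Omega)),
  [/\ measurable N, Q N = 0%E,
      mx_measurable (Delta T `*` setT) (fun q : (mR * mR) * (Omega * Omega) => A' q.1 q.2),
      forall z p i j, `|A' z p i j| <= `|A z.1 z.2 p i j| &
      forall z p, ~ N p -> A' z p = A z.1 z.2 p].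
Proof.
move=> mA.
have [f Hf] := choice (fun ij : 'I_n * 'I_n => @Omega2_version _ _ _ P _ (mR * mR)%type
  (Delta T) (fun p => A p.1.1 p.1.2 p.2 ij.1 ij.2) measurable_Delta (mA ij.1 ij.2)).
have [N HN] := choice Hf.
have ae0 : {ae Q, forall p, forall ij, ~ N ij p}.
  apply: filter_forall => ij; have [mN QN _ _ _] := HN ij.
  by exists (N ij); split => // p /= nn; exact: contrapT.
have [M [mM QM MN]] := ae0.
exists (fun z p => \matrix_(i, j) f (i, j) (z, p)), M; split => //.
- move=> i j; have [_ _ mf _ _] := HN (i, j).
  by apply: eq_measurable_fun mf => -[z p] _; rewrite mxE.
- by move=> z p i j; rewrite mxE; have [_ _ _ fA _] := HN (i, j); exact: (fA (z, p)).
- move=> z p nM; apply/matrixP => i j; rewrite mxE.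
  have [_ _ _ _ fE] := HN (i, j); rewrite fE// => Np.
  by apply/nM/MN => /(_ (i, j)).
Qed.

Let mT : measurable (`[0, T]%classic : set mR). Proof. exact: measurable_itv. Qed.

Lemma L2_sqr_integrable_time {n} (G : set (set Omega)) (X : R -> Omega -> 'cV[R]_n) i :
  <<s G >> `<=` measurable -> L2 P G 0 T X ->
  sqr_integrable (mu \x P)%E (`[0, T] `*` setT) (fun q => X q.1 q.2 i ord0).
Proof.
move=> subG LX; split; first exact: (L2_measurable subG LX).
have [_ iX] := L2_sqr_integrable i subG LX.
exact: (integrable_swap_domain measurableT mT iX).
Qed.

End coefficients_and_processes.

Section ito_dotv.
Context {R : realType} {d : measure_display} {Omega : measurableType d}.
Variables (P : probability Omega R) (W : R -> Omega -> R).
Hypothesis cP : measure_is_complete P.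
Hypothesis bW : brownian_motion P W.
Notation F := (brownian_filtration P W).
Notation OF t := (g_sigma_algebraType (F t)).
Notation mu := (@lebesgue_measure R).
Notation mR := (measurableTypeR R).
Variables (n : nat) (a b : R).
Hypothesis a_ge0 : 0 <= a.

Lemma ito_sqr_integrable (z : R -> Omega -> 'cV[R]_n) (I : Omega -> 'cV[R]_n) i :
  is_ito_integral P F W a b z I ->
  sqr_integrable P setT (fun w => I w i ord0).
Proof. by move=> /(@ito_approxP _ _ _ _ _ cP bW _ _ _ a_ge0 _ _ i)[]. Qed.

(** The integrability clause will allow the diffusion pairing to be added to the drift pairing under
    one time integral. *)
Lemma ito_isometry_dotv (z1 z2 : R -> Omega -> 'cV[R]_n) (I1 I2 : Omega -> 'cV[R]_n) :
  is_ito_integral P F W a b z1 I1 -> is_ito_integral P F W a b z2 I2 ->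
  mu.-integrable `[a, b] (EFin \o (fun s => \int[P]_w dotv (z1 s w) (z2 s w))) /\
  \int[P]_w dotv (I1 w) (I2 w) =
  \int[mu]_(s in `[a, b]) \int[P]_w dotv (z1 s w) (z2 s w).
Proof.
move=> h1 h2.
have mab : measurable (`[a, b]%classic : set mR) by exact: measurable_itv.
have mD : measurable (setT `*` `[a, b] : set (Omega * mR)) by exact: measurableX.
have iz i : (P \x mu)%E.-integrable (setT `*` `[a, b])
    (EFin \o (fun p => z1 p.2 p.1 i ord0 * z2 p.2 p.1 i ord0)).
  have [_ s1 _ _ _] := @ito_approxP _ _ _ _ _ cP bW _ _ _ a_ge0 _ _ i h1.
  have [_ s2 _ _ _] := @ito_approxP _ _ _ _ _ cP bW _ _ _ a_ge0 _ _ i h2.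
  exact: sqr_integrableM.
have iz' i := integrable_swap_domain measurableT mab (iz i).
have iRz i : mu.-integrable `[a, b]
    (EFin \o (fun s => \int[P]_w (z1 s w i ord0 * z2 s w i ord0))).
  exact: (integrable_Rintegral_section mab measurableT (iz' i)).
have isum : mu.-integrable `[a, b]
    (EFin \o (fun s => \sum_i \int[P]_w (z1 s w i ord0 * z2 s w i ord0))).
  by apply: Rintegrable_sum => // i _.
have E : {ae mu, forall s, (`[a, b]%classic : set mR) s -> \int[P]_w dotv (z1 s w) (z2 s w) =
    \sum_i \int[P]_w (z1 s w i ord0 * z2 s w i ord0)}.
  have : {ae mu, forall s, forall i, (`[a, b]%classic : set mR) s ->
      P.-integrable setT (EFin \o (fun w => z1 s w i ord0 * z2 s w i ord0))}.
    by apply: filter_forall => i; exact: (ae_integrable_section mab measurableT (iz' i)).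
  by apply: filterS => s h sab; apply: Rintegral_dotv => i; exact: h.
have mdot : measurable_fun `[a, b] (fun s => \int[P]_w dotv (z1 s w) (z2 s w)).
  apply: (@measurable_Rintegral_section _ _ mR Omega R P `[a, b]%classic setT mab measurableT
    (fun q => dotv (z1 q.1 q.2) (z2 q.1 q.2))).
  by apply: measurable_sum => i; exact: (Rintegrable_measurable (iz' i)).
split.
  apply: Rintegrable_ae_le (integrable_norm isum) => //.
  by apply: filterS E => s h sab; rewrite h.
rewrite (ae_eq_Rintegral mab mdot (Rintegrable_measurable isum) E).
rewrite Rintegral_dotv; last first.
  move=> i; apply: sqr_integrableM => //; first exact: ito_sqr_integrable h1.
  exact: ito_sqr_integrable h2.
rewrite Rintegral_sum//; apply: eq_bigr => i _.
rewrite (ito_isometry cP bW a_ge0 i h1 h2).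
exact: (@Rfubini _ _ _ _ _ P mu setT `[a, b]%classic measurableT mab
  (fun p => z1 p.2 p.1 i ord0 * z2 p.2 p.1 i ord0) (iz i)).
Qed.

Lemma ito_orthogonal_dotv (z : R -> Omega -> 'cV[R]_n) (I xi : Omega -> 'cV[R]_n) :
  is_ito_integral P F W a b z I ->
  mx_measurable setT (xi : OF a -> 'cV[R]_n) ->
  (forall i, sqr_integrable P setT (fun w => xi w i ord0)) ->
  \int[P]_w dotv (xi w) (I w) = 0.
Proof.
move=> hI mxi sxi; rewrite Rintegral_dotv; last first.
  by move=> i; apply: sqr_integrableM => //; exact: ito_sqr_integrable hI.
by rewrite big1// => i _; have := @ito_orthogonal _ _ _ P W cP bW n a b a_ge0 z I i (fun w => xi w i ord0) hI (mxi i ord0) (sxi i).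
Qed.

End ito_dotv.

(* The library's instances do not let [\x] of two Lebesgue measures be inferred
   as a sigma-finite measure. *)
Definition lebesgue2 (R : realType) :
    {sigma_finite_measure set (measurableTypeR R * measurableTypeR R)%type -> \bar R} :=
  HB.pack (@lebesgue_measure R \x @lebesgue_measure R)%E
    (lebesgue_integral_fubini.measure_function_Measure_isSigmaFinite__to__measure_function_isSFinite
      (@lebesgue_measure R) (@lebesgue_measure R))
    (lebesgue_integral_fubini.measure_function_Measure_isSigmaFinite__to__measure_function_isSigmaFinite
      (@lebesgue_measure R) (@lebesgue_measure R)).

(** A set and its mirror image have equal measure because the product measure can be computed from
    the sections in either variable. This handles the exchanged time arguments of [Z]. *)
Lemma ae_prod_swap {d1 d2} {T1 : measurableType d1} {T2 : measurableType d2} {R : realType}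
    (m1 : {sigma_finite_measure set T1 -> \bar R})
    (m2 : {sigma_finite_measure set T2 -> \bar R}) (p : T1 * T2 -> Prop) :
  {ae (m1 \x m2)%E, forall z, p z} -> {ae (m2 \x m1)%E, forall z, p (z.2, z.1)}.
Proof.
move=> [N [mN N0 pN]].
have mN' : measurable [set z : T2 * T1 | N (z.2, z.1)].
  rewrite -[X in measurable X]setTI.
  have ms : measurable_fun setT (fun z : T2 * T1 => (z.2, z.1)).
    by apply: measurable_fun_pair; [exact: measurable_snd|exact: measurable_fst].
  exact: ms.
exists [set z | N (z.2, z.1)]; split => //; last by move=> [y x]; exact: pN.
rewrite -N0 (@product_measure_unique _ _ _ _ _ m1 m2 (m1 \x^ m2)%E _ _ mN); last first.
  by move=> A B mA mB; exact: product_measure2E.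
apply: eq_integral => y _ /=.
by congr (m1 _); apply/seteqP; split => x /=; rewrite /xsection/ysection/= !inE.
Qed.

Section dotv.
Context {R : realType} {n : nat}.
Implicit Types x y z : 'cV[R]_n.

Lemma dotvDr x y z : dotv x (y + z) = dotv x y + dotv x z.
Proof. by rewrite /dotv -big_split; apply: eq_bigr => i _; rewrite mxE mulrDr. Qed.

Lemma dotvDl x y z : dotv (x + y) z = dotv x z + dotv y z.
Proof. by rewrite /dotv -big_split; apply: eq_bigr => i _; rewrite mxE mulrDl. Qed.

Lemma dotvNr x y : dotv x (- y) = - dotv x y.
Proof. by rewrite /dotv -sumrN; apply: eq_bigr => i _; rewrite mxE mulrN. Qed.

Lemma dotvC x y : dotv x y = dotv y x.
Proof. by apply: eq_bigr => i _; rewrite mulrC. Qed.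

End dotv.

Section z_process.
Context {R : realType} {d : measure_display} {Omega : measurableType d}.
Variables (P : probability Omega R) (W : R -> Omega -> R) (T : R) (n : nat).
Hypothesis cP : measure_is_complete P.
Hypothesis bW : brownian_motion P W.
Notation F := (brownian_filtration P W).
Notation mu := (@lebesgue_measure R).
Notation mR := (measurableTypeR R).
Notation mu2 := (lebesgue2 R).
Variables (y : R -> Omega -> 'cV[R]_n) (z : R -> R -> Omega -> 'cV[R]_n).
Hypothesis hM2 : M2 P W T y z.

Let mT : measurable (`[0, T]%classic : set mR). Proof. exact: measurable_itv. Qed.

Let mTT : measurable (`[0, T]%classic `*` `[0, T]%classic : set (mR * mR)).
Proof. exact: measurableX. Qed.

Lemma M2_measurable : mx_measurable ((`[0, T] `*` `[0, T]) `*` setT)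
  (fun q : (mR * mR) * Omega => z q.1.1 q.1.2 q.2).
Proof.
move=> i j; apply: (measurable_fun_prod_sub_sigma _ _ _ (M2_z_measurable hM2 i j)).
- exact: (brownian_filtration_sigma_measurable cP bW).
- exact: measurableX.
- exact: measurableX.
Qed.

Lemma M2_sqr_integrable i : sqr_integrable (mu2 \x P)%E
  ((`[0, T] `*` `[0, T]) `*` setT) (fun q => z q.1.1 q.1.2 q.2 i ord0).
Proof.
have mz := M2_measurable.
pose f (q : (mR * mR) * Omega) : \bar R :=
  (dotv (z q.1.1 q.1.2 q.2) (z q.1.1 q.1.2 q.2))%:E.
have mf : measurable_fun ((`[0, T] `*` `[0, T]) `*` setT) f.
  by apply/measurable_EFinP; exact: measurable_dotv.
have f0 q : (0 <= f q)%E by rewrite lee_fin dotvv_ge0.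
apply: (@sqr_integrable_component _ _ _ n (mu2 \x P)%E _
  (fun q : (mR * mR) * Omega => z q.1.1 q.1.2 q.2)) => //.
  by apply: measurableX.
(* The product integral is iterated, the sample point is brought outside as in [M2_z_L2], and the
   pair of times is then separated. *)
rewrite (@tonelli_prod_domain _ _ (mR * mR)%type Omega R mu2 P _ setT mTT measurableT f mf f0).
rewrite (@tonelli_domain _ _ (mR * mR)%type Omega R mu2 P _ setT mTT measurableT f mf f0).
have := M2_z_L2 hM2; apply: le_lt_trans.
rewrite le_eqVlt; apply/orP; left; apply/eqP; apply: eq_integral => w _.
apply: (@tonelli_prod_domain _ _ mR mR _ mu mu _ _ mT mT (fun p => f (p, w))) => //.
exact: (measurable_fun_section2 mTT measurableT mf).
Qed.

End z_process.

(** * Pairing the two equations and integrating over the triangle *)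

Section duality.
Context {R : realType} {d : measure_display} {Omega : measurableType d}.
Variables (P : probability Omega R) (W : R -> Omega -> R) (T : R) (n : nat).
Hypothesis cP : measure_is_complete P.
Hypothesis bW : brownian_motion P W.
Notation F := (brownian_filtration P W).
Notation OF t := (g_sigma_algebraType (F t)).
Notation Q := (PxP P).
Notation mu := (@lebesgue_measure R).
Notation mR := (measurableTypeR R).
Notation mu2 := (lebesgue2 R).
Notation IT := (`[0, T]%classic : set mR).
Variables (A0 C0 : R -> R -> Omega -> 'M[R]_n).
Variables (A1' C1' : mR * mR -> Omega * Omega -> 'M[R]_n).
Variables (X Y : R -> Omega -> 'cV[R]_n) (Z : R -> R -> Omega -> 'cV[R]_n).
Variable K : R.
Hypothesis mA0 : mx_measurable (Delta T `*` setT) (fun q : (mR * mR) * Omega => A0 q.1.1 q.1.2 q.2).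
Hypothesis mC0 : mx_measurable (Delta T `*` setT) (fun q : (mR * mR) * Omega => C0 q.1.1 q.1.2 q.2).
Hypothesis mA1 : mx_measurable (Delta T `*` setT) (fun q : (mR * mR) * (Omega * Omega) => A1' q.1 q.2).
Hypothesis mC1 : mx_measurable (Delta T `*` setT) (fun q : (mR * mR) * (Omega * Omega) => C1' q.1 q.2).
Hypothesis A0K : forall t s w i j, Delta T (t, s) -> `|A0 t s w i j| <= K.
Hypothesis C0K : forall t s w i j, Delta T (t, s) -> `|C0 t s w i j| <= K.
Hypothesis A1K : forall z p i j, Delta T z -> `|A1' z p i j| <= K.
Hypothesis C1K : forall z p i j, Delta T z -> `|C1' z p i j| <= K.
Hypothesis mX : mx_measurable (IT `*` setT) (fun q : mR * Omega => X q.1 q.2).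
Hypothesis mY : mx_measurable (IT `*` setT) (fun q : mR * Omega => Y q.1 q.2).
Hypothesis mZ : mx_measurable ((IT `*` IT) `*` setT) (fun q : (mR * mR) * Omega => Z q.1.1 q.1.2 q.2).
Hypothesis sX : forall i, sqr_integrable (mu \x P)%E (IT `*` setT) (fun q => X q.1 q.2 i ord0).
Hypothesis sY : forall i, sqr_integrable (mu \x P)%E (IT `*` setT) (fun q => Y q.1 q.2 i ord0).
Hypothesis sZ : forall i, sqr_integrable (mu2 \x P)%E ((IT `*` IT) `*` setT)
  (fun q => Z q.1.1 q.1.2 q.2 i ord0).

(** The versions [A1'] and [C1'] make this jointly measurable in the times and the sample point. *)
Definition backward_drift t s := mean_field_term P
  (fun w => row_mx (A0 t s w) (C0 t s w)) (fun p => row_mx (A1' (t, s) p) (C1' (t, s) p))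
  (fun w => col_mx (Y s w) (Z s t w)).

(** The forward equation averages over the first sample point of the kernel, whence the exchanged
    pair. *)
Definition forward_drift s t := mean_field_term P
  (fun w => (A0 s t w)^T) (fun p => (A1' (s, t) (p.2, p.1))^T) (X s).

Notation V := backward_drift.
Notation U := forward_drift.

Definition drift_pairing t s := \int[P]_w dotv (X t w) (V t s w).
Notation v := drift_pairing.

Let mT : measurable IT. Proof. exact: measurable_itv. Qed.
Let mTT : measurable (IT `*` IT). Proof. exact: measurableX. Qed.
Let mD : measurable (Delta T : set (mR * mR)). Proof. exact: measurable_Delta. Qed.

Let IT_fin : (mu IT < +oo)%E.
Proof. by rewrite /= lebesgue_measure_itv/=; case: ifP => // _; rewrite ltry. Qed.

Let Delta_fst (z : mR * mR) : Delta T z -> IT z.1.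
Proof. by move=> [h1 h2 h3]; rewrite /= in_itv/= h1 (le_trans h2). Qed.

Let Delta_snd (z : mR * mR) : Delta T z -> IT z.2.
Proof. by move=> [h1 h2 h3]; rewrite /= in_itv/= h3 (le_trans h1). Qed.

Let Delta_sub : Delta T `<=` IT `*` IT.
Proof. by move=> z Dz; split; [exact: Delta_fst|exact: Delta_snd]. Qed.

Let sq_X t := forall i, sqr_integrable P setT (fun w => X t w i ord0).
Let sq_Y t := forall i, sqr_integrable P setT (fun w => Y t w i ord0).
Let sq_Z (z : mR * mR) := forall i, sqr_integrable P setT (fun w => Z z.1 z.2 w i ord0).

Lemma ae_sqr_component (x : R -> Omega -> 'cV[R]_n) :
  (forall i, sqr_integrable (mu \x P)%E (IT `*` setT) (fun q => x q.1 q.2 i ord0)) ->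
  {ae mu, forall t, IT t -> forall i, sqr_integrable P setT (fun w => x t w i ord0)}.
Proof.
move=> sx; have h i := (sqr_integrable_section mT (sx i)).1.
have : {ae mu, forall t, forall i, IT t -> sqr_integrable P setT (fun w => x t w i ord0)}.
  by apply: filter_forall => i; exact: h.
by apply: filterS => t ht It i; exact: ht.
Qed.

Let ae_and (p q : mR -> Prop) : {ae mu, forall t, p t} -> {ae mu, forall t, q t} ->
  {ae mu, forall t, p t /\ q t}.
Proof. by apply: filterS2 => t hp hq; split. Qed.

Let ae_sqr_X : {ae mu, forall t, IT t -> sq_X t}.
Proof. exact: ae_sqr_component. Qed.

Let ae_sqr_Y : {ae mu, forall t, IT t -> sq_Y t}.
Proof. exact: ae_sqr_component. Qed.

Lemma ae_sqr_Z : {ae mu2, forall z, (IT `*` IT) z -> sq_Z z}.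
Proof.
have h i := (sqr_integrable_section mTT (sZ i)).1.
have : {ae mu2, forall z : mR * mR, forall i, (IT `*` IT) z ->
    sqr_integrable P setT (fun w => Z z.1 z.2 w i ord0)}.
  by apply: filter_forall => i; exact: h.
by apply: filterS => t ht IT i; exact: ht.
Qed.

Let eX t := \sum_i \int[P]_w (X t w i ord0 ^+ 2).
Let eY t := \sum_i \int[P]_w (Y t w i ord0 ^+ 2).
Let eZ (z : mR * mR) := \sum_i \int[P]_w (Z z.1 z.2 w i ord0 ^+ 2).

Let ieX : mu.-integrable IT (EFin \o eX).
Proof. by apply: Rintegrable_sum => // i _; exact: (sqr_integrable_section mT (sX i)).2. Qed.
Let ieY : mu.-integrable IT (EFin \o eY).
Proof. by apply: Rintegrable_sum => // i _; exact: (sqr_integrable_section mT (sY i)).2. Qed.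
Let ieZ : mu2.-integrable (IT `*` IT) (EFin \o eZ).
Proof. by apply: Rintegrable_sum => // i _; exact: (sqr_integrable_section mTT (sZ i)).2. Qed.

Lemma measurable_backward_drift : mx_measurable (Delta T `*` setT)
  (fun q : (mR * mR) * Omega => V q.1.1 q.1.2 q.2).
Proof.
apply: (@measurable_mean_field_term_family _ _ _ P _ (mR * mR)%type (Delta T) mD n (n + n)
  (fun z w => row_mx (A0 z.1 z.2 w) (C0 z.1 z.2 w))
  (fun z p => row_mx (A1' (z.1, z.2) p) (C1' (z.1, z.2) p))
  (fun z w => col_mx (Y z.2 w) (Z z.2 z.1 w))).
- exact: mx_measurable_row_mx.
- apply: mx_measurable_row_mx => i j.
    by apply: eq_measurable_fun (mA1 i j) => -[[t s] p] _.
  by apply: eq_measurable_fun (mC1 i j) => -[[t s] p] _.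
- apply: mx_measurable_col_mx => i j.
    apply: (@measurable_comp _ _ _ ((mR * mR) * Omega)%type (mR * Omega)%type R
      (IT `*` setT) (fun q => Y q.1 q.2 i j) _ (fun q => (q.1.2, q.2))).
    + exact: measurableX.
    + by move=> _ [q [Dq _] <-]; split => //; exact: Delta_snd.
    + exact: mY.
    + apply: measurable_funTS; apply: measurable_fun_pair; last exact: measurable_snd.
      exact: (measurableT_comp measurable_snd measurable_fst).
  apply: (@measurable_comp _ _ _ ((mR * mR) * Omega)%type ((mR * mR) * Omega)%type R
    ((IT `*` IT) `*` setT) (fun q => Z q.1.1 q.1.2 q.2 i j) _ (fun q => ((q.1.2, q.1.1), q.2))).
  + by apply: measurableX.
  + by move=> _ [q [Dq _] <-]; split => //; split; [exact: Delta_snd|exact: Delta_fst].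
  + exact: mZ.
  + apply: measurable_funTS; apply: measurable_fun_pair; last exact: measurable_snd.
    apply: measurable_fun_pair.
      exact: (measurableT_comp measurable_snd measurable_fst).
    exact: (measurableT_comp measurable_fst measurable_fst).
Qed.

Let mX_fst : mx_measurable (Delta T `*` setT) (fun q : (mR * mR) * Omega => X q.1.1 q.2).
Proof.
move=> i j; apply: (@measurable_comp _ _ _ ((mR * mR) * Omega)%type (mR * Omega)%type R
    (IT `*` setT) (fun q => X q.1 q.2 i j) _ (fun q => (q.1.1, q.2))).
- exact: measurableX.
- by move=> _ [q [Dq _] <-]; split => //; exact: Delta_fst.
- exact: mX.
- apply: measurable_funTS; apply: measurable_fun_pair; last exact: measurable_snd.
  exact: (measurableT_comp measurable_fst measurable_fst).
Qed.

Lemma measurable_forward_drift : mx_measurable (Delta T `*` setT)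
  (fun q : (mR * mR) * Omega => U q.1.1 q.1.2 q.2).
Proof.
apply: (@measurable_mean_field_term_family _ _ _ P _ (mR * mR)%type (Delta T) mD n n
  (fun z w => (A0 z.1 z.2 w)^T)
  (fun z p => (A1' (z.1, z.2) (p.2, p.1))^T) (fun z w => X z.1 w)).
- exact: mx_measurable_trmx.
- apply: mx_measurable_trmx => i j.
  apply: (@measurable_comp _ _ _ ((mR * mR) * (Omega * Omega))%type
    ((mR * mR) * (Omega * Omega))%type R
    (Delta T `*` setT) (fun q => A1' q.1 q.2 i j) _ (fun q => ((q.1.1, q.1.2), (q.2.2, q.2.1)))).
  + exact: measurableX.
  + by move=> _ [[[t s] q] [Dq _] <-]; split.
  + exact: mA1.
  + apply: measurable_funTS; apply: measurable_fun_pair.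
      apply: measurable_fun_pair.
        exact: (measurableT_comp measurable_fst measurable_fst).
      exact: (measurableT_comp measurable_snd measurable_fst).
    apply: measurable_fun_pair.
      exact: (measurableT_comp measurable_snd measurable_snd).
    exact: (measurableT_comp measurable_fst measurable_snd).
- exact: mX_fst.
Qed.

Let coef_t t s (G : R -> R -> Omega -> 'M[R]_n) : Delta T (t, s) ->
  mx_measurable (Delta T `*` setT) (fun q : (mR * mR) * Omega => G q.1.1 q.1.2 q.2) ->
  mx_measurable setT (G t s).
Proof.
by move=> Dts mG i j; exact: (measurable_fun_section1 (x := (t, s)) mD measurableT (mG i j)).
Qed.

Let coef2_t t s (G : mR * mR -> Omega * Omega -> 'M[R]_n) : Delta T (t, s) ->
  mx_measurable (Delta T `*` setT) (fun q : (mR * mR) * (Omega * Omega) => G q.1 q.2) ->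
  mx_measurable setT (G (t, s)).
Proof.
by move=> Dts mG i j; exact: (measurable_fun_section1 (x := (t, s)) mD measurableT (mG i j)).
Qed.

(** [2 * K] for each of the [n + n] entries of [Y] stacked over [Z], as in
    [Rintegral_norm_mean_field_term_le]. *)
Let cV : R := 2 * K * (n + n)%:R.

Lemma backward_drift_bound t s : Delta T (t, s) -> sq_Y s -> sq_Z (s, t) ->
  forall i xi, sqr_integrable P setT xi ->
  P.-integrable setT (EFin \o (fun w => xi w * V t s w i ord0)) /\
  \int[P]_w `|xi w * V t s w i ord0| <=
    cV * \int[P]_w (xi w ^+ 2) + 2 * K * (eY s + eZ (s, t)).
Proof.
move=> Dts sy sz i xi sxi.
have m1 := mx_measurable_row_mx (coef_t Dts mA0) (coef_t Dts mC0).
have m2 := mx_measurable_row_mx (coef2_t Dts mA1) (coef2_t Dts mC1).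
have b1 w k j : `|row_mx (A0 t s w) (C0 t s w) k j| <= K.
  by case: (split_ordP j) => l ->; rewrite ?row_mxEl ?row_mxEr ?A0K ?C0K.
have b2 p k j : `|row_mx (A1' (t, s) p) (C1' (t, s) p) k j| <= K.
  by case: (split_ordP j) => l ->; rewrite ?row_mxEl ?row_mxEr ?A1K ?C1K.
have syz j : sqr_integrable P setT (fun w => col_mx (Y s w) (Z s t w) j ord0).
  case: (split_ordP j) => l ->.
    by under eq_fun do rewrite col_mxEu; exact: sy.
  by under eq_fun do rewrite col_mxEd; exact: sz.
split; first exact: (integrable_mean_field_term m1 b1 m2 b2 syz sxi).
apply: (le_trans (Rintegral_norm_mean_field_term_le m1 b1 m2 b2 syz sxi i)).
rewrite -mulr_sumr big_split/= sumr_const card_ord big_split_ord/= /cV /eY /eZ.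
under [X in _ + (X + _)]eq_bigr => j _ do under eq_Rintegral do rewrite col_mxEu.
under [X in _ + (_ + X)]eq_bigr => j _ do under eq_Rintegral do rewrite col_mxEd.
by rewrite mulrDr -[X in 2 * K * X + _]mulr_natl mulrA.
Qed.

Lemma forward_drift_bound s t : Delta T (s, t) -> sq_X s ->
  forall i xi, sqr_integrable P setT xi ->
  P.-integrable setT (EFin \o (fun w => xi w * U s t w i ord0)) /\
  \int[P]_w `|xi w * U s t w i ord0| <=
    2 * K * n%:R * \int[P]_w (xi w ^+ 2) + 2 * K * eX s.
Proof.
move=> Dts sx i xi sxi.
have m1 := mx_measurable_trmx (coef_t Dts mA0).
have m2 : mx_measurable setT (fun p => (A1' (s, t) (p.2, p.1))^T).
  apply: mx_measurable_trmx => k j; apply: (measurableT_comp (coef2_t Dts mA1 k j)).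
  exact: measurable_fun_pair.
have b1 w k j : `|(A0 s t w)^T k j| <= K by rewrite mxE A0K.
have b2 (p : Omega * Omega) k j : `|(A1' (s, t) (p.2, p.1))^T k j| <= K by rewrite mxE A1K.
split; first exact: (integrable_mean_field_term m1 b1 m2 b2 sx sxi).
apply: (le_trans (Rintegral_norm_mean_field_term_le m1 b1 m2 b2 sx sxi i)).
rewrite -mulr_sumr big_split/= sumr_const card_ord /eX.
by rewrite mulrDr -[X in 2 * K * X + _]mulr_natl mulrA.
Qed.

Let ieZ_swap : mu2.-integrable (IT `*` IT) (EFin \o (fun z : mR * mR => eZ (z.2, z.1))).
Proof. exact: (@integrable_swap_domain _ _ mR mR R mu mu IT IT mT mT eZ ieZ). Qed.

Lemma ae_sqr_Z_swap : {ae mu2, forall z : mR * mR, (IT `*` IT) z -> sq_Z (z.2, z.1)}.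
Proof.
have := @ae_prod_swap _ _ mR mR R mu mu _ ae_sqr_Z.
by apply: filterS => -[t s] h [It Is]; exact: h.
Qed.

Lemma integrable_drift_pairing : mu2.-integrable (Delta T) (EFin \o (fun z => v z.1 z.2)).
Proof.
(* The drift bound with [xi] a component of [X], summed over the [n] components: the moments of [X]
   add up to [eX], and the rest is repeated [n] times. *)
pose e (z : mR * mR) := cV * eX z.1 + n%:R * (2 * K * (eY z.2 + eZ (z.2, z.1))).
have ie : mu2.-integrable (Delta T) (EFin \o e).
  apply: (@integrableS _ _ _ mu2 (IT `*` IT)) => //.
  apply: RintegrableD => //.
    apply: RintegrableZl => //.
    exact: (@integrable_comp_fst _ _ mR mR R mu mu IT IT eX mT mT IT_fin ieX).
  apply: RintegrableZl => //; apply: RintegrableZl => //; apply: RintegrableD => //.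
  apply: (@integrable_swap_domain _ _ mR mR R mu mu IT IT mT mT (fun z => eY z.1)).
  exact: (@integrable_comp_fst _ _ mR mR R mu mu IT IT eY mT mT IT_fin ieY).
have mv : measurable_fun (Delta T) (fun z => v z.1 z.2).
  apply: (@measurable_Rintegral_section _ _ (mR * mR)%type Omega R P (Delta T) setT
    mD measurableT (fun q => dotv (X q.1.1 q.2) (V q.1.1 q.1.2 q.2))).
  by apply: measurable_dotv; [exact: mX_fst|exact: measurable_backward_drift].
apply: Rintegrable_ae_le ie => //.
have hX := @ae_prod_fst _ _ mR mR R mu mu _ ae_sqr_X.
have hY := @ae_prod_snd _ _ mR mR R mu mu _ ae_sqr_Y.
apply: filterS3 hX hY ae_sqr_Z_swap => -[t s] /= hX hY hZ Dts.
have sx := hX (Delta_fst Dts); have sy := hY (Delta_snd Dts).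
have sz := hZ (Delta_sub Dts).
have h i := backward_drift_bound Dts sy sz i (sx i).
rewrite /v Rintegral_dotv; last by move=> i; exact: (h i).1.
rewrite (le_trans (ler_norm_sum _ _ _))//.
rewrite /e /eX mulr_sumr mulr_natl.
rewrite -[X in _ *+ X]card_ord -sumr_const -big_split/=.
apply: ler_sum => i _; apply: le_trans (h i).2.
exact: (le_normr_Rintegral measurableT (h i).1).
Qed.

Lemma Rintegral_backward_drift : {ae mu, forall t, IT t ->
  P.-integrable setT (EFin \o (fun w => dotv (X t w) (vint mu `[t, T] (fun s => V t s w)))) /\
  \int[P]_w dotv (X t w) (vint mu `[t, T] (fun s => V t s w)) =
  \int[mu]_(s in `[t, T]) v t s}.
Proof.
(* The backward drift at [t] contains [Z s t], so the second time argument is the one held fixed. *)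
have hZ := (@ae_prod_sections _ _ mR mR R mu mu _ ae_sqr_Z).2.
have iZ := @ae_integrable_section _ _ mR mR R mu mu IT IT mT mT _ ieZ_swap.
apply: filterS3 ae_sqr_X hZ iZ => t hX hZ iZ It.
have subI : (`[t, T]%classic : set mR) `<=` IT.
  move=> s /=; rewrite !in_itv/= => /andP[ts ->]; rewrite andbT.
  by move: It; rewrite /= in_itv/= => /andP[/le_trans->].
have mtT : measurable (`[t, T]%classic : set mR) by exact: measurable_itv.
have sx := hX It.
have Dt s : (`[t, T]%classic : set mR) s -> Delta T (t, s).
  move: It; rewrite /= !in_itv/= => /andP[t0 _] /andP[ts sT]; by split.
have [] := @Rintegral_dotv_vint _ _ _ Omega mR P mu `[t, T]%classic mtT n
  (fun s w => V t s w) cV (fun s => 2 * K * (eY s + eZ (s, t))) (X t) _ _ _ _ sx.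
- apply: le_lt_trans IT_fin; apply: le_measure => //; exact/mem_set.
- move=> i j; apply: (@measurable_comp _ _ _ (mR * Omega)%type ((mR * mR) * Omega)%type R
    (Delta T `*` setT) (fun q => V q.1.1 q.1.2 q.2 i j) _ (fun q => ((t, q.1), q.2))).
  + by apply: measurableX.
  + by move=> _ [q [Dq _] <-]; split => //; exact: Dt.
  + exact: measurable_backward_drift.
  + apply: measurable_funTS; apply: measurable_fun_pair; last exact: measurable_snd.
    by apply: measurable_fun_pair; [exact: measurable_cst|exact: measurable_fst].
- apply: (@integrableS _ _ _ mu IT) => //.
  apply: RintegrableZl => //; apply: RintegrableD => //.
  exact: iZ.
- apply: filterS2 ae_sqr_Y hZ => s hY hZ ts i xi sxi.
  apply: backward_drift_bound => //; first exact: Dt.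
    exact: (hY (subI _ ts)).
  by apply: hZ; split; [exact: subI|].
by move=> h1 h2 h3; split.
Qed.

Lemma Rintegral_forward_drift : {ae mu, forall t, IT t ->
  [/\ P.-integrable setT (EFin \o (fun w => dotv (Y t w) (vint mu `[0, t] (fun s => U s t w)))),
   mu.-integrable `[0, t] (EFin \o (fun s => \int[P]_w dotv (Y t w) (U s t w))) &
  \int[P]_w dotv (Y t w) (vint mu `[0, t] (fun s => U s t w)) =
  \int[mu]_(s in `[0, t]) \int[P]_w dotv (Y t w) (U s t w)]}.
Proof.
apply: filterS ae_sqr_Y => t hY It.
have subI : (`[0, t]%classic : set mR) `<=` IT.
  move=> s /=; rewrite !in_itv/= => /andP[-> st]/=.
  by move: It; rewrite /= in_itv/= => /andP[_]; exact: le_trans.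
have mtT : measurable (`[0, t]%classic : set mR) by exact: measurable_itv.
have sy := hY It.
have Dt s : (`[0, t]%classic : set mR) s -> Delta T (s, t).
  move: It; rewrite /= !in_itv/= => /andP[_ tT] /andP[ts sT]; by split.
apply: (@Rintegral_dotv_vint _ _ _ Omega mR P mu `[0, t]%classic mtT n
  (fun s w => U s t w) (2 * K * n%:R) (fun s => 2 * K * eX s) (Y t) _ _ _ _ sy).
- apply: le_lt_trans IT_fin; apply: le_measure => //; exact/mem_set.
- move=> i j; apply: (@measurable_comp _ _ _ (mR * Omega)%type ((mR * mR) * Omega)%type R
    (Delta T `*` setT) (fun q => U q.1.1 q.1.2 q.2 i j) _ (fun q => ((q.1, t), q.2))).
  + by apply: measurableX.
  + by move=> _ [q [Dq _] <-]; split => //; exact: Dt.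
  + exact: measurable_forward_drift.
  + apply: measurable_funTS; apply: measurable_fun_pair; last exact: measurable_snd.
    by apply: measurable_fun_pair; [exact: measurable_fst|exact: measurable_cst].
- apply: (@integrableS _ _ _ mu IT) => //.
  exact: RintegrableZl.
- apply: filterS ae_sqr_X => s hX ts i xi sxi.
  apply: forward_drift_bound => //; first exact: Dt.
  exact: (hX (subI _ ts)).
Qed.

Variables (A1 C1 : R -> R -> Omega * Omega -> 'M[R]_n).
Variables (D0 : R -> R -> Omega -> 'M[R]_n) (D1 : R -> R -> Omega * Omega -> 'M[R]_n).
Variable N : set (Omega * Omega).
Hypothesis K0 : 0 <= K.
Hypothesis mN : measurable N.
Hypothesis QN : Q N = 0%E.
Hypothesis A1N : forall z p, ~ N p -> A1' z p = A1 z.1 z.2 p.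
Hypothesis C1N : forall z p, ~ N p -> C1' z p = C1 z.1 z.2 p.
Hypothesis C1bK : forall t s p i j, Delta T (t, s) -> `|C1 t s p i j| <= K.
Hypothesis hD : cond_exp_coef P W T C0 C1 D0 D1.
Hypothesis aX : adapted F 0 T X.
Hypothesis aZ : {ae mu, forall t : R, 0 <= t <= T -> adapted F 0 T (Z t)}.

Let diffusion s t w := D0 s t w *m X s w + vint P setT (fun w' => D1 s t (w', w) *m X s w').

Lemma drift_pairingE : {ae mu, forall t, IT t -> {ae mu, forall s, (`[0, t]%classic : set mR) s ->
  v s t = \int[P]_w dotv (Y t w) (U s t w) + \int[P]_w dotv (Z t s w) (diffusion s t w)}}.
Proof.
have hZ := (@ae_prod_sections _ _ mR mR R mu mu _ ae_sqr_Z).1.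
apply: filterS3 ae_sqr_Y hZ aZ => t hY hZ aZt It.
apply: filterS2 ae_sqr_X hZ => s hX hZs st.
move: (It) (st); rewrite /= !in_itv/= => /andP[t0 tT] /andP[s0 s_t].
have Is : IT s by rewrite /= in_itv/= s0 (le_trans s_t).
have Dst : Delta T (s, t) by split.
apply: (@duality_fixed_time _ _ _ P W cP bW n s (A0 s t) (C0 s t) (D0 s t) (C1 s t) (D1 s t)
  (A1' (s, t)) (C1' (s, t)) (X s) (Y t) (Z t s) K N).
- exact: K0.
- exact: coef_t.
- by move=> w i j; exact: A0K.
- exact: coef_t.
- by move=> w i j; exact: C0K.
- exact: coef2_t.
- by move=> w i j; exact: A1K.
- exact: coef2_t.
- by move=> w i j; exact: C1K.
- by move=> w i j; exact: C1bK.
- exact: mN.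
- exact: QN.
- by move=> w; exact: C1N.
- exact: (D0_cond_exp hD Dst).
- exact: (D1_cond_exp hD Dst).
(* Here the conditioning becomes legitimate: [X s] and [Z t s] are both known at time [s]. *)
- by move=> i; apply: (aX _ i ord0); exact: Is.
- by move=> i; apply: (aZt _ _ _ i ord0); [exact: It|exact: Is].
- exact: hX.
- exact: hY.
- by apply: hZs; split.
Qed.

Let mX_t t : IT t -> mx_measurable setT (X t).
Proof. by move=> It i j; exact: (measurable_fun_section1 mT measurableT (mX i j) It). Qed.

Let mY_t t : IT t -> mx_measurable setT (Y t).
Proof. by move=> It i j; exact: (measurable_fun_section1 mT measurableT (mY i j) It). Qed.

Let mZ_t (z : mR * mR) : (IT `*` IT) z -> mx_measurable setT (Z z.1 z.2).
Proof. by move=> Iz i j; exact: (measurable_fun_section1 mTT measurableT (mZ i j) Iz). Qed.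

Let eq_vint (D : set mR) (f g : R -> 'cV[R]_n) :
  (forall s, D s -> f s = g s) -> vint mu D f = vint mu D g.
Proof.
move=> fg; apply/matrixP => i j; rewrite !mxE.
by apply: eq_Rintegral => s /set_mem Ds; rewrite fg.
Qed.

(** The average runs over the first sample point, so the sections of [N] at a fixed second point are
    used. As [N] does not depend on the times, one good [w] is good for every [s]. *)
Lemma forward_drift_version t : IT t -> {ae P, forall w,
  vint mu `[0, t] (fun s => (A0 s t w)^T *m X s w
    + vint P setT (fun w' => (A1 s t (w', w))^T *m X s w')) =
  vint mu `[0, t] (fun s => U s t w)}.
Proof.
move=> It; have [_] := PxP_section_null mN QN.
apply: filterS => w nN; apply: eq_vint => s st.
move: (It) (st); rewrite /= !in_itv/= => /andP[t0 tT] /andP[s0 s_t].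
have Is : IT s by rewrite /= in_itv/= s0 (le_trans s_t).
have Dst : Delta T (s, t) by split.
congr (_ + _); apply: (vint_ae_eq cP).
- by apply: filterS nN => w' nN; rewrite A1N.
- apply: mx_measurable_trmx => i j.
  by apply: (@measurable_fun_pair1 _ _ _ _ _ _ _ w (coef2_t Dst mA1 i j)).
- exact: mX_t.
Qed.

Lemma backward_drift_version t : IT t -> {ae P, forall w,
  vint mu `[t, T] (fun s => A0 t s w *m Y s w + C0 t s w *m Z s t w
    + vint P setT (fun w' => A1 t s (w, w') *m Y s w' + C1 t s (w, w') *m Z s t w')) =
  vint mu `[t, T] (fun s => V t s w)}.
Proof.
move=> It; have [+ _] := PxP_section_null mN QN.
apply: filterS => w nN; apply: eq_vint => s st.
move: (It) (st); rewrite /= !in_itv/= => /andP[t0 tT] /andP[t_s sT].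
have Is : IT s by rewrite /= in_itv/= sT (le_trans t0).
have Dts : Delta T (t, s) by split.
rewrite /backward_drift /mean_field_term mul_row_col; congr (_ + _).
have -> : (fun w' => A1 t s (w, w') *m Y s w' + C1 t s (w, w') *m Z s t w') =
    (fun w' => row_mx (A1 t s (w, w')) (C1 t s (w, w')) *m col_mx (Y s w') (Z s t w')).
  by apply/funext => w'; rewrite mul_row_col.
apply: (vint_ae_eq cP).
- by apply: filterS nN => w' nN; rewrite A1N// C1N.
- by apply: mx_measurable_row_mx => i j; exact: (measurable_fun_pair2 w (coef2_t Dts _ i j)).
- by apply: mx_measurable_col_mx; [exact: mY_t|exact: (@mZ_t (s, t))].
Qed.

Variables (phi psi : R -> Omega -> 'cV[R]_n).
Hypothesis sphi : forall i, sqr_integrable (mu \x P)%E (IT `*` setT) (fun q => phi q.1 q.2 i ord0).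
Hypothesis spsi : forall i, sqr_integrable (mu \x P)%E (IT `*` setT) (fun q => psi q.1 q.2 i ord0).
Hypothesis eqX : {ae mu, forall t : R, 0 <= t <= T ->
  exists2 I : Omega -> 'cV[R]_n,
    is_ito_integral P F W 0 t (fun s w => diffusion s t w) I &
    {ae P, forall w, X t w = phi t w
      + vint mu `[0, t] (fun s => (A0 s t w)^T *m X s w
          + vint P setT (fun w' => (A1 s t (w', w))^T *m X s w'))
      + I w}}.
Hypothesis eqY : {ae mu, forall t : R, 0 <= t <= T ->
  exists2 I : Omega -> 'cV[R]_n,
    is_ito_integral P F W t T (Z t) I &
    {ae P, forall w, Y t w = psi t w
      + vint mu `[t, T] (fun s => A0 t s w *m Y s w + C0 t s w *m Z s t w
          + vint P setT (fun w' => A1 t s (w, w') *m Y s w' + C1 t s (w, w') *m Z s t w'))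
      - I w}}.
Hypothesis eqM : {ae mu, forall t : R, 0 <= t <= T ->
  exists2 I : Omega -> 'cV[R]_n,
    is_ito_integral P F W 0 t (Z t) I &
    {ae P, forall w, Y t w = vint P setT (Y t) + I w}}.

Let idot (x y : Omega -> 'cV[R]_n) :
  (forall i, sqr_integrable P setT (fun w => x w i ord0)) ->
  (forall i, sqr_integrable P setT (fun w => y w i ord0)) ->
  P.-integrable setT (EFin \o (fun w => dotv (x w) (y w))).
Proof. by move=> sx sy; apply: integrable_dotv => i; exact: sqr_integrableM. Qed.

Let mv_fst t : IT t -> measurable_fun (`[0, t]%classic : set mR) (fun s => v s t).
Proof.
move=> It; apply: (@measurable_comp _ _ _ mR (mR * mR)%type R (Delta T) (fun z => v z.1 z.2)
  `[0, t]%classic (fun s => (s, t))).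
- exact: mD.
- move=> _ [s + <-]; move: It; rewrite /= !in_itv/= => /andP[_ tT] /andP[s0 st].
  by split.
- exact: (Rintegrable_measurable integrable_drift_pairing).
- by apply: measurable_funTS; apply: measurable_fun_pair; [exact: measurable_id|exact: measurable_cst].
Qed.

Lemma backward_forward_pairing : {ae mu, forall t, IT t ->
  \int[P]_w dotv (Y t w) (phi t w) =
  \int[P]_w dotv (Y t w) (X t w) - \int[mu]_(s in `[0, t]) v s t}.
Proof.
apply: filterS3 (ae_and Rintegral_forward_drift drift_pairingE) (ae_and eqX eqM)
  (ae_and (ae_and ae_sqr_X ae_sqr_Y) (ae_sqr_component sphi)).
move=> t [hU hv] [hX hM] [[hsx hsy] hsp] It.
have [iU iu eU] := hU It; have ev := hv It.
have [I hI eI] := hX It; have [J hJ eJ] := hM It.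
have sx := hsx It; have sy := hsy It; have sp := hsp It.
have m0t : measurable (`[0, t]%classic : set mR) by exact: measurable_itv.
have t0 : (0 : R) <= 0 by [].
have sI i := ito_sqr_integrable cP bW t0 i hI.
have sJ i := ito_sqr_integrable cP bW t0 i hJ.
pose c := vint P setT (Y t).
have sc i : sqr_integrable P setT (fun _ => c i ord0).
  split; first exact: measurable_cst.
  exact: (@finite_measure_integrable_cst _ _ _ P setT (c i ord0 ^+ 2)).
(* [Y t] is its mean plus [J]: the constant is orthogonal to [I], and the isometry pairs [J] with
   [I]. *)
have EI : \int[P]_w dotv (Y t w) (I w) =
    \int[mu]_(s in `[0, t]) \int[P]_w dotv (Z t s w) (diffusion s t w).
  rewrite -(ito_isometry_dotv cP bW t0 hJ hI).2.
  rewrite -[RHS]add0r -(@ito_orthogonal_dotv _ _ _ P W cP bW n 0 t t0 _ I (fun _ => c) hI _ sc); last first.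
    by move=> i j; exact: measurable_cst.
  rewrite -RintegralD//; [|exact: idot..].
  apply: ae_eq_Rintegral => //.
  - exact: Rintegrable_measurable (idot sy sI).
  - exact: Rintegrable_measurable (RintegrableD measurableT (idot sc sI) (idot sJ sI)).
  - by apply: filterS eJ => w -> _; rewrite dotvDl.
transitivity (\int[P]_w (dotv (Y t w) (X t w) - dotv (Y t w) (vint mu `[0, t] (fun s => U s t w))
    - dotv (Y t w) (I w))).
  apply: ae_eq_Rintegral => //.
  - exact: Rintegrable_measurable (idot sy sp).
  - exact: Rintegrable_measurable (RintegrableB measurableT
      (RintegrableB measurableT (idot sy sx) iU) (idot sy sI)).
  - apply: filterS2 eI (forward_drift_version It) => w -> -> _.
    by rewrite !dotvDr; ring.
rewrite RintegralB//; [|exact: RintegrableB measurableT (idot sy sx) iU|exact: idot].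
rewrite RintegralB//; last exact: idot.
rewrite eU EI -addrA -opprD; congr (_ - _).
(* With both pairings integrable in time, their sum goes under one integral, where it equals [v s t]
   for almost every [s]. *)
have [ih _] := ito_isometry_dotv cP bW t0 hJ hI.
have muh := Rintegrable_measurable (RintegrableD m0t iu ih).
have := @ae_eq_Rintegral _ _ _ mu _ _ _ m0t (mv_fst It) muh ev.
move=> /esym; apply: etrans; apply/esym.
by apply: RintegralD; [exact: m0t|exact: iu|exact: ih].
Qed.

Lemma forward_backward_pairing : {ae mu, forall t, IT t ->
  \int[P]_w dotv (X t w) (psi t w) =
  \int[P]_w dotv (X t w) (Y t w) - \int[mu]_(s in `[t, T]) v t s}.
Proof.
apply: filterS2 (ae_and Rintegral_backward_drift eqY)
  (ae_and (ae_and ae_sqr_X ae_sqr_Y) (ae_sqr_component spsi)).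
move=> t [hV hY] [[hsx hsy] hsp] It.
have [iV eV] := hV It; have [I hI eI] := hY It.
have sx := hsx It; have sy := hsy It; have sp := hsp It.
have t0 : 0 <= t by move: It; rewrite /= in_itv/= => /andP[].
have sI i := ito_sqr_integrable cP bW t0 i hI.
have EI : \int[P]_w dotv (X t w) (I w) = 0.
  exact: (@ito_orthogonal_dotv _ _ _ P W cP bW n t T t0 _ I (X t) hI (aX It) sx).
transitivity (\int[P]_w (dotv (X t w) (Y t w) - dotv (X t w) (vint mu `[t, T] (fun s => V t s w))
    + dotv (X t w) (I w))).
  apply: ae_eq_Rintegral => //.
  - exact: Rintegrable_measurable (idot sx sp).
  - exact: Rintegrable_measurable (RintegrableD measurableT
      (RintegrableB measurableT (idot sx sy) iV) (idot sx sI)).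
  - apply: filterS2 eI (backward_drift_version It) => w -> -> _.
    by rewrite !dotvDr dotvNr; ring.
rewrite RintegralD//; [|exact: RintegrableB measurableT (idot sx sy) iV|exact: idot].
rewrite RintegralB//; last exact: idot.
by rewrite EI addr0 eV.
Qed.

(** Extension by zero from the triangle to the square: the variable limits of integration disappear,
    and exchanging the order is Fubini on a rectangle. *)
Let vD (z : mR * mR) : R := ((fun z => v z.1 z.2) \_ (Delta T)) z.

Let ivD : mu2.-integrable (IT `*` IT) (EFin \o vD).
Proof.
have := integrable_drift_pairing; rewrite integrable_mkcond//.
rewrite -restrict_EFin; apply: integrableS => //.
Qed.

Let Rintegral_vD_fst t : IT t ->
  \int[mu]_(s in `[0, t]) v s t = \int[mu]_(s in IT) vD (s, t).
Proof.
move=> It; rewrite Rintegral_mkcond [RHS]Rintegral_mkcond.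
apply: eq_Rintegral => s _; rewrite /vD /patch/=.
have -> : (s \in (`[0, t]%classic : set mR)) = ((s, t) \in Delta T).
  apply/idP/idP => /set_mem h; apply/mem_set; move: It h; rewrite /= !in_itv/=.
    by move=> /andP[_ tT] /andP[s0 st].
  by move=> _ [/= -> ->].
by case: ifPn => [/set_mem/Delta_fst/mem_set ->|]; last by case: ifP.
Qed.

Let Rintegral_vD_snd t : IT t ->
  \int[mu]_(s in `[t, T]) v t s = \int[mu]_(s in IT) vD (t, s).
Proof.
move=> It; rewrite Rintegral_mkcond [RHS]Rintegral_mkcond.
apply: eq_Rintegral => s _; rewrite /vD /patch/=.
have -> : (s \in (`[t, T]%classic : set mR)) = ((t, s) \in Delta T).
  apply/idP/idP => /set_mem h; apply/mem_set; move: It h; rewrite /= !in_itv/=.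
    by move=> /andP[t0 _] /andP[ts sT].
  by move=> _ [/= _ -> ->].
by case: ifPn => [/set_mem/Delta_snd/mem_set ->|]; last by case: ifP.
Qed.

Lemma integrable_time_dotv (x y : R -> Omega -> 'cV[R]_n) :
  (forall i, sqr_integrable (mu \x P)%E (IT `*` setT) (fun q => x q.1 q.2 i ord0)) ->
  (forall i, sqr_integrable (mu \x P)%E (IT `*` setT) (fun q => y q.1 q.2 i ord0)) ->
  (mu \x P)%E.-integrable (IT `*` setT) (EFin \o (fun q => dotv (x q.1 q.2) (y q.1 q.2))).
Proof.
have mITT : measurable (IT `*` setT : set (mR * Omega)) by exact: measurableX.
by move=> sx sy; apply: Rintegrable_sum => // i _; exact: sqr_integrableM.
Qed.

Lemma expectation_time_dotv (x y : R -> Omega -> 'cV[R]_n) :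
  (forall i, sqr_integrable (mu \x P)%E (IT `*` setT) (fun q => x q.1 q.2 i ord0)) ->
  (forall i, sqr_integrable (mu \x P)%E (IT `*` setT) (fun q => y q.1 q.2 i ord0)) ->
  ('E_P[(fun w => \int[mu]_(t in IT) dotv (x t w) (y t w))%R] =
   (\int[mu]_(t in IT) \int[P]_w dotv (x t w) (y t w))%R%:E)%E.
Proof.
move=> sx sy; have ixy := integrable_time_dotv sx sy.
have h := integrable_Rintegral_section measurableT mT (integrable_swap_domain mT measurableT ixy).
rewrite unlock (Rintegral_EFin measurableT h); congr (_%:E).
by apply/esym; exact: (Rfubini mT measurableT ixy).
Qed.

Lemma time_duality :
  \int[mu]_(t in IT) \int[P]_w dotv (Y t w) (phi t w) =
  \int[mu]_(t in IT) \int[P]_w dotv (X t w) (psi t w).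
Proof.
have iYX := integrable_Rintegral_section mT measurableT (integrable_time_dotv sY sX).
have iYp := integrable_Rintegral_section mT measurableT (integrable_time_dotv sY sphi).
have iXp := integrable_Rintegral_section mT measurableT (integrable_time_dotv sX spsi).
have iv2 := @integrable_Rintegral_section _ _ mR mR R mu mu IT IT mT mT _ ivD.
have iv1 := @integrable_Rintegral_section _ _ mR mR R mu mu IT IT mT mT _
  (@integrable_swap_domain _ _ mR mR R mu mu IT IT mT mT _ ivD).
transitivity (\int[mu]_(t in IT) (\int[P]_w dotv (Y t w) (X t w) - \int[mu]_(s in IT) vD (s, t))).
  apply: (@ae_eq_Rintegral _ _ _ mu IT _ _ mT (Rintegrable_measurable iYp)
    (Rintegrable_measurable (RintegrableB mT iYX iv1))).
  apply: filterS backward_forward_pairing => t h It.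
  by rewrite h// Rintegral_vD_fst.
transitivity (\int[mu]_(t in IT) (\int[P]_w dotv (Y t w) (X t w) - \int[mu]_(s in IT) vD (t, s))).
  transitivity (\int[mu]_(t in IT) \int[P]_w dotv (Y t w) (X t w) -
      \int[mu]_(t in IT) \int[mu]_(s in IT) vD (s, t)).
    by apply: RintegralB; [exact: mT|exact: iYX|exact: iv1].
  (* The corrections from the two equations are iterated integrals of the same [vD] in opposite
     orders. *)
  rewrite -(@Rfubini _ _ mR mR R mu mu IT IT mT mT _ ivD).
  by apply/esym/RintegralB; [exact: mT|exact: iYX|exact: iv2].
apply/esym; apply: (@ae_eq_Rintegral _ _ _ mu IT _ _ mT (Rintegrable_measurable iXp)
    (Rintegrable_measurable (RintegrableB mT iYX iv2))).
apply: filterS forward_backward_pairing => t h It.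
rewrite h// Rintegral_vD_snd//; congr (_ - _).
by apply: eq_Rintegral => w _; rewrite dotvC.
Qed.

End duality.

Theorem theorem4p2 (R : realType) (d : measure_display)
  (Omega : measurableType d) (P : probability Omega R)
  (W : R -> Omega -> R) (T : R) (n : nat)
  (A0 C0 : R -> R -> Omega -> 'M[R]_n)
  (A1 C1 : R -> R -> Omega * Omega -> 'M[R]_n)
  (psi phi Y X : R -> Omega -> 'cV[R]_n)
  (Z : R -> R -> Omega -> 'cV[R]_n) :
  0 < T ->
  measure_is_complete P ->
  brownian_motion P W ->
  hypothesis_L2 P W T A0 C0 A1 C1 ->
  L2_FT P W T psi ->
  adapted_M_solution P W T A0 C0 A1 C1 psi Y Z ->
  L2_F P W T phi ->
  fsvie_solution P W T A0 C0 A1 C1 phi X ->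
  ('E_P[(fun w => \int[@lebesgue_measure R]_(t in `[0%R, T])
           dotv (Y t w) (phi t w))%R] =
   'E_P[(fun w => \int[@lebesgue_measure R]_(t in `[0%R, T])
           dotv (X t w) (psi t w))%R])%E.
Proof.
move=> _ cP bW [hA0 hC0 hA1 hC1] Lpsi hYZ Lphi [LX [D0 [D1 [hD eqX]]]].
have [mA0 [KA0 A0K] _] := hA0; have [mC0 [KC0 C0K] _] := hC0.
have [mA1 [KA1 A1K] _] := hA1; have [mC1 [KC1 C1K] _] := hC1.
have [hM eqY eqM] := hYZ; have LY := M2_y hM.
have [A1' [N1 [mN1 QN1 mA1' A1le A1E]]] := coefficient_version mA1.
have [C1' [N2 [mN2 QN2 mC1' C1le C1E]]] := coefficient_version mC1.
have subF := brownian_filtration_sigma_measurable cP bW (t := T).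
have mX := L2_measurable subF LX.1.
have mY := L2_measurable subF LY.1.
have sX i := L2_sqr_integrable_time i subF LX.1.
have sY i := L2_sqr_integrable_time i subF LY.1.
have sphi i := L2_sqr_integrable_time i subF Lphi.1.
have spsi i := L2_sqr_integrable_time i subF Lpsi.
(* A sum of absolute values gives one nonnegative bound for all four coefficients, whatever the
   signs of the given ones. *)
pose K := `|KA0| + `|KC0| + `|KA1| + `|KC1|.
have leK a (k : R) : a <= k -> `|k| <= K -> a <= K.
  by move=> ak; apply: le_trans; exact: le_trans ak (ler_norm _).
have KA0K : `|KA0| <= K by rewrite /K -!addrA lerDl !addr_ge0.
have KC0K : `|KC0| <= K by rewrite /K -!addrA addrCA lerDl !addr_ge0.
have KA1K : `|KA1| <= K by rewrite /K -addrA addrCA lerDl !addr_ge0.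
have KC1K : `|KC1| <= K by rewrite /K addrC lerDl !addr_ge0.
rewrite (expectation_time_dotv sY sphi) (expectation_time_dotv sX spsi).
congr (_%:E).
(* The union of [N1] and [N2] is a single null set off which both mean-field kernels agree with
   their versions. *)
apply: (@time_duality _ _ _ P W T n cP bW A0 C0 A1' C1' X Y Z K mA0 mC0 mA1' mC1'
  _ _ _ _ mX mY (M2_measurable cP bW hM) sX sY (M2_sqr_integrable cP bW hM)
  A1 C1 D0 D1 (N1 `|` N2) _ _ _ _ _ _ hD LX.2 (M2_z_adapted hM) phi psi sphi spsi eqX eqY eqM).
- by move=> t s w i j Dts; exact: leK (A0K _ _ _ _ _ Dts) KA0K.
- by move=> t s w i j Dts; exact: leK (C0K _ _ _ _ _ Dts) KC0K.
- move=> [t s] p i j Dts; apply: le_trans (A1le _ _ _ _) _.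
  exact: leK (A1K _ _ _ _ _ Dts) KA1K.
- move=> [t s] p i j Dts; apply: le_trans (C1le _ _ _ _) _.
  exact: leK (C1K _ _ _ _ _ Dts) KC1K.
- by apply: le_trans KA0K.
- exact: measurableU.
- exact: etrans (measureU0 mN1 mN2 QN2) QN1.
- by move=> z p nN; apply: A1E => Np; apply: nN; left.
- by move=> z p nN; apply: C1E => Np; apply: nN; right.
- by move=> t s p i j Dts; exact: leK (C1K _ _ _ _ _ Dts) KC1K.
Qed.
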